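(* For any parabolic subalgebra $\mathfrak{p}$ as in the context, the system of polynomials $$\{M_\xi,\ \xi\in S;\ L_\varphi,\ \varphi\in\Phi\}$$ is contained in the algebra of invariants $K[\mathfrak{m}]^N$ and is algebraically independent over $K$.
   Context: **Setting.** $K$ is an algebraically closed field of characteristic zero, $n$ is a positive integer, and $G$ is one of $\mathrm{Sp}_{2n}(K)$, $\mathrm{O}_{2n}(K)$ (put $m=2n$) or $\mathrm{O}_{2n+1}(K)$ (put $m=2n+1$). Rows and columns of $m\times m$ matrices are indexed according to the order $1\prec 2\prec\dots\prec n\prec 0\prec -n\prec\dots\prec -2\prec -1$, the index $0$ being present only if $m=2n+1$. $G$ preserves the form with Gram matrix $\sum_i E_{i,-i}$ (sum over all indices) in the orthogonal cases and $\sum_{i=1}^n(E_{i,-i}-E_{-i,i})$ in the symplectic case, where $E_{i,j}$ are the matrix units. $N$ (resp. $B$) is the subgroup of all upper unitriangular (resp. upper triangular) matrices in $G$. $P\supset B$ is a parabolic subgroup of $G$, and $\mathfrak{p}=\mathrm{Lie}\,P=\mathfrak{r}\oplus\mathfrak{m}$, where $\mathfrak{m}$ is the nilradical and $\mathfrak{r}$ is the block diagonal reductive subalgebra with block sizes $(r_1,\dots,r_{p-1},r_p,r_{p-1},\dots,r_1)$. Put $R=\sum_{t=1}^{p-1}r_t$. The group $N$ acts on $\mathfrak{m}$ by $\mathrm{Ad}_g x=gxg^{-1}$ and on $K[\mathfrak{m}]$ by $\mathrm{Ad}_g f(x)=f(g^{-1}xg)$; $K[\mathfrak{m}]^N$ is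 the algebra of invariants. **Roots.** With respect to the diagonal torus, $\varepsilon_i$ is the character $t\mapsto t_{i,i}$ ($1\le i\le n$). The set of positive roots $\Delta^+$ consists of $\varepsilon_i\pm\varepsilon_j$ ($1\le i<j\le n$), together with $2\varepsilon_i$ ($1\le i\le n$) if $G=\mathrm{Sp}_{2n}(K)$, and together with $\varepsilon_i$ ($1\le i\le n$) if $G=\mathrm{O}_{2n+1}(K)$. $\Delta^+_{\mathfrak{r}}\subset\Delta^+$ is the system of positive roots of $\mathfrak{r}$. $M$ is the set of $\gamma\in\Delta^+$ whose root subspace lies in $\mathfrak{m}$. Put $\mathcal{E}(\varepsilon_i-\varepsilon_j)=(-j,-i)$ and $\mathcal{E}(\varepsilon_i+\varepsilon_j)=(j,-i)$ for $i<j$; $\mathcal{E}(2\varepsilon_i)=(i,-i)$ (also for the formal element $2\varepsilon_i$ used below in the orthogonal cases); $\mathcal{E}(\varepsilon_i)=(0,-i)$ if $G=\mathrm{O}_{2n+1}(K)$. **Base.** For $\gamma,\gamma'\in\Delta^+$ write $\gamma'\succ\gamma$ whenever $\gamma'-\gamma\in\Delta^+$; $\gamma,\gamma'$ are comparable if $\gamma'\succ\gamma$ or $\gamma\succ\gamma'$. $S\subset M$ denotes the base of $M$: the unique subset whose elements are pairwise not comparable and such that for every $\gamma\in M\setminus S$ there is $\xi\in S$ with $\gamma\succ\xi$. (Between indices, $\prec,\succ$ refer to the order on indices above.) **Matrix $\mathbb{X}$.** $K[\mathfrak{m}]$ is identified with the polynomial algebra in the variables $x_{i,j}$ with $i\prec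 j$, $(-j,-i)=\mathcal{E}(\gamma)$, $\gamma\in M$. The matrix $\mathbb{X}$ is formed as follows: for each $\gamma\in M$ with $\mathcal{E}(\gamma)=(-j,-i)$, $i>0$, position $(i,j)$ contains $x_{i,j}$, and position $(-j,-i)$ contains $x_{i,j}$ when $G=\mathrm{Sp}_{2n}(K)$ and $j<0$, and $-x_{i,j}$ in the other cases; if $\mathcal{E}(\gamma)=(i,-i)$, position $(i,-i)$ contains $x_{i,-i}$. All other entries are $0$. **Minors.** Let $\gamma\in M$, $\mathcal{E}(\gamma)=(a,-b)$, $b>0$. Let $S_\gamma$ be the set of $\xi\in S$ with $\mathcal{E}(\xi)=(i,j)$, $i\succ a$, $j\prec -b$; write $S_\gamma=\{\xi_1,\dots,\xi_k\}$, $\mathcal{E}(\xi_t)=(a_t,-b_t)$, $b_t>0$. Let $b_{i_1},\dots,b_{i_s}$ be those of $b_1,\dots,b_k$ that are greater than $a$ with respect to $\prec$. $M_\gamma$ is the minor of $\mathbb{X}$ with row set $I=\{b_1,\dots,b_k,b,a_{i_1},\dots,a_{i_s}\}$ and column set $J=\{-a,-a_1,\dots,-a_k,-b_{i_1},\dots,-b_{i_s}\}$; $\overline{M}_\gamma$ is the minor of $\mathbb{X}$ with row set $\{a,a_1,\dots,a_k,b_{i_1},\dots,b_{i_s}\}$ and column set $\{-b_1,\dots,-b_k,-b,-a_{i_1},\dots,-a_{i_s}\}$. All these sets are put in increasing order with respect to $\prec$. **Admissible pairs and $\Phi$.** A root $\gamma\in S$ with $\mathcal{E}(\gamma)=(a,-b)$,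 $b>0$, lies to the right of the central block if $R\prec a\prec -R$. Let $k$ be the greatest number such that $\varepsilon_k+\varepsilon_{k+1}\in M$. Put $\Gamma_{\mathfrak{r}}=\Delta^+_{\mathfrak{r}}\cup\{2\varepsilon_i:k<i\le n\}$ in the orthogonal cases and $\Gamma_{\mathfrak{r}}=\Delta^+_{\mathfrak{r}}\setminus\{2\varepsilon_i:k<i\le n\}$ in the symplectic case. Let $\xi,\xi'\in S$ (possibly equal), $\mathcal{E}(\xi)=(a,-b)$, $\mathcal{E}(\xi')=(a',-b')$, $b,b'>0$, $a\preccurlyeq a'$. The pair $q=(\xi,\xi')$ is admissible if: - in case at least one of $\xi,\xi'$ does not lie to the right of the central block: there is $\alpha_q\in\Delta^+_{\mathfrak{r}}$ such that $\{\xi,\alpha_q,\xi'\}$ is a chain, i.e. $\mathcal{E}(\alpha_q)=(-b,a')$; - in case both lie to the right of the central block: there is $\alpha_q\in\Gamma_{\mathfrak{r}}$ with $\mathcal{E}(\alpha_q)=(-a,a')$. The element $\alpha_q$ is uniquely determined by $q$. Let $Q$ be the set of admissible pairs, $\varphi_q=\alpha_q+\xi'$ (a positive root) for $q=(\xi,\xi')\in Q$, and $\Phi=\{\varphi_q:q\in Q\}$. **Polynomials $L_\varphi$.** If $\varphi\in\Phi$ corresponds to the admissible pair $q=(\xi,\xi')$, then $$L_\varphi=\sum_{\substack{\alpha_1,\alpha_2\in\Gamma_{\mathfrak{r}}\cup\{0\}\\ \alpha_1+\alpha_2=\alpha_q}}M_{\xi+\alpha_1}\,\overline{M}_{\alpha_2+\xi'},$$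 where only those terms occur for which $\xi+\alpha_1$ and $\alpha_2+\xi'$ are roots in $M$ (so that the minors are defined).
   Formalization: In the orthogonal cases γ'≻γ also holds when γ'−γ is a formal 2ε_i (literal base fails, e.g. O_5, blocks (1,3,1)); in the symplectic case α_1, α_2 in L_φ range over Δ_r^+∪{0} instead of Γ_r∪{0} (literal sum is not invariant, e.g. Sp_8, blocks (2,4,2)). *)

(* Defs.v *)
From HB Require Import structures.
From mathcomp Require Import all_boot all_order all_algebra.
From mathcomp.multinomials Require Import mpoly.

Set Implicit Arguments.
Unset Strict Implicit.
Unset Printing Implicit Defensive.

Import GRing.Theory.
Local Open Scope ring_scope.

(* Sp_{2n}, O_{2n} and O_{2n+1} respectively. *)
Inductive classical := Symp | OrthEven | OrthOdd.

Definition is_symp (c : classical) := if c is Symp then true else false.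
Definition is_odd (c : classical) := if c is OrthOdd then true else false.

Definition dimG (c : classical) (n : nat) : nat := (n.*2 + is_odd c)%N.

(* The ordered index set 1 < 2 < .. < n < 0 < -n < .. < -1 (0 being present   *)
(* for OrthOdd only) is represented by positions, so that its order is the    *)
(* order of naturals and i |-> -i is rev_ord.  Positions start at 0: index    *)
(* i > 0 is position i - 1, index 0 is position n.                            *)
Notation idx c n := 'I_(dimG c n).

Lemma leq_dimG c n : (n <= dimG c n)%N.
Proof. by rewrite /dimG -addnn -addnA leq_addr. Qed.

Definition neg c n (a : idx c n) : idx c n := rev_ord a.
Definition posidx c n (i : 'I_n) : idx c n := widen_ord (leq_dimG c n) i.
Definition is_pos c n (a : idx c n) : bool := (a < n)%N.

(* Symbols for eps_i - eps_j, eps_i + eps_j, 2 eps_i, eps_i.  The first two   *)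
(* stand for roots only when i < j; 2 eps_i is a root for Symp only, and is   *)
(* a formal element for the orthogonal groups (see pos_root).                 *)
Inductive rsym (n : nat) :=
  | Diff of 'I_n & 'I_n
  | Sum of 'I_n & 'I_n
  | Dbl of 'I_n
  | Sht of 'I_n.

Definition rsym_code n (g : rsym n) :
    ('I_n * 'I_n + 'I_n * 'I_n) + ('I_n + 'I_n) :=
  match g with
  | Diff i j => inl (inl (i, j))
  | Sum i j => inl (inr (i, j))
  | Dbl i => inr (inl i)
  | Sht i => inr (inr i)
  end.
Definition rsym_decode n
    (x : ('I_n * 'I_n + 'I_n * 'I_n) + ('I_n + 'I_n)) : rsym n :=
  match x with
  | inl (inl (i, j)) => Diff i j
  | inl (inr (i, j)) => Sum i j
  | inr (inl i) => Dbl i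
  | inr (inr i) => Sht i
  end.
Lemma rsym_codeK n : cancel (@rsym_code n) (@rsym_decode n).
Proof. by case. Qed.
HB.instance Definition _ n :=
  Countable.copy (rsym n) (can_type (@rsym_codeK n)).
HB.instance Definition _ n : isFinite (rsym n) := CanIsFinite (@rsym_codeK n).

Definition eps n (i : 'I_n) : 'rV[int]_n := delta_mx 0 i.

Definition rvec n (g : rsym n) : 'rV[int]_n :=
  match g with
  | Diff i j => eps i - eps j
  | Sum i j => eps i + eps j
  | Dbl i => eps i *+ 2
  | Sht i => eps i
  end.

Definition pos_root (c : classical) n (g : rsym n) : bool :=
  match g with
  | Diff i j | Sum i j => (i < j)%N
  | Dbl _ => is_symp c
  | Sht _ => is_odd c
  end.

(* The map E.  In the last clause the value of insubd is the index 0 when     *)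
(* c = OrthOdd; the default is taken only when eps_i is not a root.           *)
Definition Epos c n (g : rsym n) : idx c n * idx c n :=
  match g with
  | Diff i j => (neg (posidx c j), neg (posidx c i))
  | Sum i j => (posidx c j, neg (posidx c i))
  | Dbl i => (posidx c i, neg (posidx c i))
  | Sht i => (insubd (posidx c i) n, neg (posidx c i))
  end.

(* E(g) = (a, -b) *)
Definition Ea c n (g : rsym n) : idx c n := (Epos c g).1.
Definition Eb c n (g : rsym n) : idx c n := neg (Epos c g).2.

(* g' succ g.  For the orthogonal groups the difference may also be one of    *)
(* the formal elements 2 eps_i, as in Gamma_r below: otherwise, say for       *)
(* O_5 and blocks (1, 3, 1), eps_1 + eps_2 would belong to the base although  *)
(* its minor, the single variable x_{1,-2}, is not N-invariant.  For Symp     *)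
(* this is membership of the difference in the set of positive roots.         *)
Definition root_gt c n (g' g : rsym n) : bool :=
  [exists d : rsym n,
     (pos_root c d || [exists i : 'I_n, d == Dbl i])
     && (rvec g' - rvec g == rvec d)].

Definition root_comparable c n (g g' : rsym n) : bool :=
  root_gt c g' g || root_gt c g g'.

(* Block sizes (r_1, .., r_p, .., r_1) where r = [:: r_1; ..; r_(p-1)].       *)
(* The central size r_p may be 0.                                             *)
Definition block_sizes c n (r : seq nat) : seq nat :=
  r ++ (dimG c n - (sumn r).*2)%N :: rev r.

Definition block c n (r : seq nat) (a : idx c n) : nat :=
  reshape_index (block_sizes c n r) a.

Section Group.
Variables (K : fieldType) (c : classical) (n : nat).

Definition gram : 'M[K]_(dimG c n) :=
  \matrix_(i, j) if j == neg i
                 then (if is_symp c && ~~ is_pos i then -1 else 1) else 0.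

Definition in_G (g : 'M[K]_(dimG c n)) : bool := g^T *m gram *m g == gram.

Definition in_N (g : 'M[K]_(dimG c n)) : bool :=
  [&& in_G g, [forall i, g i i == 1]
    & [forall i : idx c n, forall j : idx c n, (j < i)%N ==> (g i j == 0)]].

Definition in_lieG (x : 'M[K]_(dimG c n)) : bool :=
  x^T *m gram + gram *m x == 0.

(* A spanning vector of the root subspace of g, E(g) = (-j, -i), normalised   *)
(* so that the entry (i, j) is 1.                                             *)
Definition root_mx (g : rsym n) : 'M[K]_(dimG c n) :=
  let i := neg (Epos c g).2 in let j := neg (Epos c g).1 in
  delta_mx i j
  + (if (i, j) == Epos c g then 0
     else (if is_symp c && is_pos (neg j) then 1 else -1)
          *: delta_mx (neg j) (neg i)).
End Group.

Section Parabolic.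
Variables (K : fieldType) (c : classical) (n : nat) (r : seq nat).

Definition in_r (x : 'M[K]_(dimG c n)) : bool :=
  in_lieG x && [forall i, forall j, (x i j != 0) ==> (block r i == block r j)].

Definition in_m (x : 'M[K]_(dimG c n)) : bool :=
  in_lieG x && [forall i : idx c n, forall j : idx c n,
                  (x i j != 0) ==> (block r i < block r j)%N].

Definition rootsR : {set rsym n} :=
  [set g | pos_root c g & in_r (root_mx K c g)].

Definition rootsM : {set rsym n} :=
  [set g | pos_root c g & in_m (root_mx K c g)].

Definition is_base (S : {set rsym n}) : bool :=
  [&& S \subset rootsM,
      [forall x in S, forall y in S, ~~ root_comparable c x y]
    & [forall g in rootsM :\: S, exists x in S, root_gt c g x]].

Definition Rsum : nat := sumn r.

Definition right_of_center (g : rsym n) : bool :=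
  (Rsum <= Ea c g < dimG c n - Rsum)%N.

(* The k of the definition of Gamma_r, with k = 0 if there is none; as the    *)
(* ordinal i stands for the integer i + 1, this is a maximum of i.+1.         *)
Definition kmax : nat :=
  \max_(i : 'I_n | [exists j : 'I_n, (j == i.+1 :> nat)
                                     && (Sum i j \in rootsM)]) i.+1.

Definition tail_doubles : {set rsym n} :=
  [set Dbl i | i : 'I_n & (kmax < i.+1)%N].

Definition GammaR : {set rsym n} :=
  if is_symp c then rootsR :\: tail_doubles else rootsR :|: tail_doubles.

Definition alpha (q : rsym n * rsym n) : option (rsym n) :=
  if right_of_center q.1 && right_of_center q.2
  then [pick d in GammaR | Epos c d == (neg (Ea c q.1), Ea c q.2)]
  else [pick d in rootsR | Epos c d == (neg (Eb c q.1), Ea c q.2)].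

Definition ovec (o : option (rsym n)) : 'rV[int]_n :=
  if o is Some g then rvec g else 0.

Section Base.
Variable S : {set rsym n}.

Definition pairsQ : {set rsym n * rsym n} :=
  [set q | [&& q.1 \in S, q.2 \in S, (Ea c q.1 <= Ea c q.2)%N
             & isSome (alpha q)]].

Definition phi (q : rsym n * rsym n) : 'rV[int]_n :=
  ovec (alpha q) + rvec q.2.

Definition Phi : seq 'rV[int]_n := undup [seq phi q | q <- enum pairsQ].

Definition below (g : rsym n) : {set rsym n} :=
  [set x in S | (Ea c g < Ea c x)%N && ((Epos c x).2 < (Epos c g).2)%N].

(* {b_1, .., b_k, b, a_{i_1}, .., a_{i_s}} *)
Definition setB (g : rsym n) : {set idx c n} :=
  [set Eb c x | x in below g] :|: [set Eb c g]
  :|: [set Ea c x | x in below g & (Ea c g < Eb c x)%N].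

(* {a, a_1, .., a_k, b_{i_1}, .., b_{i_s}} *)
Definition setA (g : rsym n) : {set idx c n} :=
  [set Ea c g] :|: [set Ea c x | x in below g]
  :|: [set Eb c x | x in below g & (Ea c g < Eb c x)%N].

(* K[m]: the variable of index v is x_{i,j}, where E(enum_val v) = (-j, -i).  *)
Notation polM := {mpoly K[#|rootsM|]}.

Definition bbX : 'M[polM]_(dimG c n) :=
  \matrix_(i, j) \sum_(v < #|rootsM|) root_mx K c (enum_val v) i j *: 'X_v.

(* enum and enum_val list a set of ordinals in increasing order; the default  *)
(* value of nth is used only if I and J have distinct cardinals, which does   *)
(* not happen for the minors below.                                           *)
Definition minor (I J : {set idx c n}) : polM :=
  \det (\matrix_(i < #|I|, j < #|I|)
          bbX (enum_val i) (nth (enum_val i) (enum J) j)).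

Definition Mminor (g : rsym n) : polM :=
  minor (setB g) [set neg a | a in setA g].

Definition Mbar (g : rsym n) : polM :=
  minor (setA g) [set neg b | b in setB g].

(* The range of alpha_1 and alpha_2, None standing for 0.  It is              *)
(* Gamma_r u {0} for the orthogonal groups and Delta_r^+ u {0} for Symp.      *)
(* For Symp the roots 2 eps_i of r, which Gamma_r omits as values of          *)
(* alpha_q, are needed as values of alpha_1 and alpha_2: for Sp_8 and blocks  *)
(* (2, 4, 2) the sum over Gamma_r u {0} is not N-invariant.                   *)
Definition Gamma0 : {set option (rsym n)} :=
  None |: [set Some d | d in GammaR :|: rootsR].

(* In the two inner sums there is at most one term: g1 = xi + alpha_1 and     *)
(* g2 = alpha_2 + xi'.                                                        *)
Definition Lpair (q : rsym n * rsym n) : polM :=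
  \sum_(a1 in Gamma0)
  \sum_(a2 in Gamma0 | ovec a1 + ovec a2 == ovec (alpha q))
  \sum_(g1 in rootsM | rvec g1 == rvec q.1 + ovec a1)
  \sum_(g2 in rootsM | rvec g2 == ovec a2 + rvec q.2)
    Mminor g1 * Mbar g2.

Definition Lpol (f : 'rV[int]_n) : polM :=
  if [pick q in pairsQ | phi q == f] is Some q then Lpair q else 0.

Definition system : seq polM :=
  [seq Mminor x | x <- enum S] ++ [seq Lpol f | f <- Phi].

Definition eval_m (f : polM) (x : 'M[K]_(dimG c n)) : K :=
  f.@[fun v => x (neg (Epos c (enum_val v)).2) (neg (Epos c (enum_val v)).1)].

Definition N_invariant (f : polM) : Prop :=
  forall g x, in_N g -> in_m x -> eval_m f (invmx g *m x *m g) = eval_m f x.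
End Base.
End Parabolic.

Definition alg_independent (K : fieldType) (N : nat) (s : seq {mpoly K[N]}) :
    Prop :=
  forall p : {mpoly K[size s]}, p \mPo in_tuple s = 0 -> p = 0.

(* Main.v *)
Require Import Defs.
From mathcomp Require Import all_boot all_order all_fingroup all_algebra.
From mathcomp Require Import zify.
From mathcomp.multinomials Require Import mpoly.

Set Implicit Arguments.
Unset Strict Implicit.
Unset Printing Implicit Defensive.
Import GRing.Theory.
Local Open Scope ring_scope.

(** The groups are treated inside of [GL_m].  The positions of the base and their
    reflections in the antidiagonal form a set of rooks, at most one in each row
    and column, and every position of the nilradical that carries no rook has one
    to its left or below it ([rookset_row], [rookset_base]); in the orthogonal
    cases the positions of the antidiagonal are excepted.  Peeling off rows and
    columns shows that, on the nilradical, the rank of the lower left corner at any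
    position is at most the number of rooks in it; on the antidiagonal of an
    orthogonal group this rests on the evenness of the rank of a skew matrix
    ([nilradical_rook_bounded]).  These rank bounds persist under multiplication by
    upper unitriangular matrices from both sides, and a minor of maximal size
    allowed by them does not change under such multiplications
    ([det_rowsub_unitri]).

    Both minors of a root consist of the rooks below and to the left of a position,
    completed by the row and the column of that position ([hookminor]).  At a rook
    this is a minor of maximal size, so [M_xi] is invariant.  Moving the last column
    of such a minor within a block gives a row vector of minors, which conjugation
    by [g] multiplies by [g]; moving the first row gives a column vector, multiplied
    by the inverse of [g] ([rookdet_mull], [rookdet_mulr]).  The sum over the
    decompositions of the root of an admissible pair is the product of two such
    vectors, with the index running through an interval of one block
    ([Lpair_sum], [Lpair_hook]); hence it is invariant ([rookpair_invariant]).

    For the algebraic independence, the Jacobian matrix is computed at the sum of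
    the root vectors of the base, with respect to the coordinates of the roots of
    the base and of the roots of the pairs ([jacobian_alg_independent]).  There the
    submatrices of the minors are supported on the rooks.  The derivative of [M_xi]
    involves the rooks of its minor only, among which [xi] is the corner
    ([Mminor_dirder]).  In the sum of a pair only the two extreme terms have a
    nonzero derivative, which involves the position above the right rook and the
    position to the right of the left rook ([Lpair_dirder]).  For a suitable order
    on these positions the matrix is triangular ([Lpair_dirder_key]), and its
    diagonal entries are nonzero ([Lpair_dirder_self]). *)


(** * Determinants and ranks *)

(** A permutation with a nonzero term in the expansion never lowers the key; as
    it preserves the sum of the keys, it is the identity. *)
Lemma det_keyed (R : comNzRingType) k (A : 'M[R]_k) (key : 'I_k -> nat) :
  (forall i j, A i j != 0 -> i = j \/ (key i < key j)%N) ->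
  \det A = \prod_i A i i.
Proof.
move=> Akey; rewrite /determinant (bigD1 (1%g : 'S_k)) //= [X in _ + X]big1 ?addr0.
  by rewrite odd_perm1 expr0 mul1r; under eq_bigr do rewrite perm1.
move=> s s_neq1.
case: (pickP (fun i => A i (s i) == 0)) => [i /eqP Ai0|An0].
  by rewrite (bigD1 i) //= Ai0 mul0r mulr0.
have keyS i : i = s i \/ (key i < key (s i))%N by apply: Akey; rewrite An0.
have [i si] : exists i, s i != i.
  by apply/existsP; apply: contraNT s_neq1 => /existsPn sid;
     apply/eqP/permP=> i; rewrite perm1; apply/eqP; have := sid i; rewrite negbK.
have : (\sum_i key i < \sum_i key (s i))%N.
  rewrite (bigD1 i) //= [ltnRHS](bigD1 i) //= -addSn.
  have ki : (key i < key (s i))%N.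
    by case: (keyS i) => [e|//]; move: si; rewrite -e eqxx.
  by apply: (leq_add ki); apply: leq_sum => j _; case: (keyS j) => [<-|/ltnW].
by rewrite [ltnLHS](reindex_inj (@perm_inj _ s)) ltnn.
Qed.

Lemma mxrank_mxsub (F : fieldType) m n m' n' (f : 'I_m' -> 'I_m)
    (g : 'I_n' -> 'I_n) (A : 'M[F]_(m, n)) :
  (\rank (mxsub f g A) <= \rank A)%N.
Proof.
have -> : mxsub f g A = rowsub f 1%:M *m A *m colsub g 1%:M.
  by rewrite mulmx_colsub mulmx1 mul_rowsub_mx mul1mx; apply/matrixP=> i j; rewrite !mxE.
by apply: leq_trans (mxrankM_maxl _ _) (mxrankM_maxr _ _).
Qed.

(** Triangularity is taken with respect to an arbitrary weight on the indices, so
    that reversed orders, and with them transposed matrices, are covered. *)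
Definition unitri (R : nzRingType) m (w : 'I_m -> nat) (h : 'M[R]_m) : Prop :=
  (forall i, h i i = 1) /\ (forall i j, h i j != 0 -> i = j \/ (w i < w j)%N).

Definition rows_from (R : nzRingType) m k (w : 'I_m -> nat) (r : nat)
    (y : 'M[R]_(m, k)) : 'M[R]_(m, k) :=
  \matrix_(a, j) if (r <= w a)%N then y a j else 0.

Lemma mulmx_rows_from (R : nzRingType) m k (w : 'I_m -> nat) (h : 'M[R]_m)
    (y : 'M[R]_(m, k)) r :
  unitri w h -> rows_from w r (h *m y) = rows_from w r h *m rows_from w r y.
Proof.
move=> [_ hw]; apply/matrixP=> a j; rewrite !mxE.
case: leqP => ra; last by rewrite big1 // => b _; rewrite !mxE leqNgt ra mul0r.
apply: eq_bigr => b _; rewrite !mxE ra; have [->|/hw] := eqVneq (h a b) 0.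
  by rewrite !mul0r.
by case=> [<-|ab]; rewrite ?ra // (leq_trans ra) // ltnW.
Qed.

Lemma rank_rows_from_unitri (F : fieldType) m k (w : 'I_m -> nat) (h : 'M[F]_m)
    (y : 'M[F]_(m, k)) r :
  unitri w h -> (\rank (rows_from w r (h *m y)) <= \rank (rows_from w r y))%N.
Proof. by move=> hw; rewrite mulmx_rows_from // mxrankM_maxr. Qed.

(** As the rows selected by [f] are independent, the rank bound makes every row
    of [y] a combination of selected rows of at least the same weight.  Replacing
    [y] by [h *m y] therefore multiplies the selected rows by a unitriangular
    matrix. *)
Lemma det_rowsub_unitri_neq0 (F : fieldType) m k (w : 'I_m -> nat)
    (f : 'I_k -> 'I_m) (h : 'M[F]_m) (y : 'M[F]_(m, k)) :
  unitri w h ->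
  (forall r, (\rank (rows_from w r y) <= #|[pred i | r <= w (f i)]|)%N) ->
  \det (rowsub f y) != 0 -> \det (rowsub f (h *m y)) = \det (rowsub f y).
Proof.
move=> [h1 hw] rk dy0; set Y := rowsub f y.
have Yu : Y \in unitmx by rewrite unitmxE unitfE.
have [U yE Uf] : exists2 U : 'M_(m, k), y = U *m Y &
    forall i j, U (f i) j = (i == j)%:R.
  exists (y *m invmx Y) => [|i j]; first by rewrite mulmxKV.
  have : rowsub f (y *m invmx Y) = 1%:M by rewrite -mul_rowsub_mx mulmxV.
  by move/matrixP/(_ i j); rewrite !mxE.
(* A row [a] using a selected row of smaller weight would make the rows of
     weight at least [w a] span more than the selected rows among them. *)
have Uz a j : U a j != 0 -> (w a <= w (f j))%N.
  apply: contraNT; rewrite -ltnNge => ja.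
  pose V := rows_from w (w a) U.
  pose P : 'M[F]_k := diag_mx (\row_j (w a <= w (f j))%:R).
  have rkV : (\rank V <= #|[pred i | w a <= w (f i)]|)%N.
    apply: leq_trans (rk _); rewrite -(mxrankMfree _ (_ : row_free Y)) ?row_free_unit //.
    rewrite [X in (_ <= \rank X)%N](_ : _ = V *m Y) //.
    rewrite yE; apply/matrixP=> b c; rewrite !mxE; case: leqP => ab.
      by apply: eq_bigr => l _; rewrite !mxE ab.
    by rewrite big1 // => l _; rewrite !mxE leqNgt ab mul0r.
  have PV : (P <= V)%MS.
    apply/row_subP=> i; rewrite row_diag_mx !mxE; case: leqP => ai;
      last by rewrite scale0r sub0mx.
    rewrite scale1r (_ : delta_mx _ _ = row (f i) V) ?row_sub //.
    by apply/rowP=> j'; rewrite !mxE ai Uf eqxx /= eq_sym.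
  have rkP : (#|[pred i | (w a <= w (f i))%N]| <= \rank P)%N.
    set s := [pred i | _]; pose e : 'I_#|s| -> 'I_k := enum_val.
    apply: leq_trans (mxrank_mxsub e e P).
    rewrite (_ : mxsub e e P = 1%:M) ?mxrank1 //; apply/matrixP=> i j'.
    rewrite !mxE (inj_eq enum_val_inj); have := enum_valP i; rewrite !inE => ->.
    by case: eqP.
  have VP : (V <= P)%MS by rewrite -(mxrank_leqif_sup PV) eqn_leq mxrankS //= (leq_trans rkV).
  have [D VE] := submxP VP.
  have : V a j = U a j by rewrite mxE leqnn.
  rewrite VE mul_mx_diag !mxE leqNgt ja mulr0 => <- //.
have -> : rowsub f (h *m y) = rowsub f (h *m U) *m Y.
  by rewrite mul_rowsub_mx -mulmxA -yE.
rewrite det_mulmx (@det_keyed _ _ _ (fun i => w (f i))); last first.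
  move=> i j; have [->|ij] := eqVneq i j; first by left.
  rewrite !mxE => s0; right; apply: contraNT s0; rewrite -leqNgt => ji.
  apply/eqP/big1 => b _; have [->|/hw] := eqVneq (h (f i) b) 0; first by rewrite mul0r.
  case=> [<-|ib]; first by rewrite Uf (negPf ij) mulr0.
  have [->|/Uz bj] := eqVneq (U b j) 0; first by rewrite mulr0.
  by have := leq_trans (leq_trans ib bj) ji; rewrite ltnn.
rewrite big1 ?mul1r // => i _; rewrite !mxE (bigD1 (f i)) //= h1 Uf eqxx mulr1.
rewrite big1 ?addr0 // => b bi; have [->|/hw] := eqVneq (h (f i) b) 0;
  first by rewrite mul0r.
case=> [/eqP|ib]; first by rewrite eq_sym (negPf bi).
have [->|/Uz bj] := eqVneq (U b i) 0; first by rewrite mulr0.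
by have := leq_trans ib bj; rewrite ltnn.
Qed.

(** Invariance of the nonvanishing minors, applied to the inverse of [h], also
    shows that a zero minor stays zero. *)
Lemma det_rowsub_unitri (F : fieldType) m k (w : 'I_m -> nat)
    (f : 'I_k -> 'I_m) (h h' : 'M[F]_m) (y : 'M[F]_(m, k)) :
  unitri w h -> unitri w h' -> h' *m h = 1%:M ->
  (forall r, (\rank (rows_from w r y) <= #|[pred i | r <= w (f i)]|)%N) ->
  \det (rowsub f (h *m y)) = \det (rowsub f y).
Proof.
move=> hw h'w hh rk; have [y0|] := eqVneq (\det (rowsub f y)) 0;
  last exact: det_rowsub_unitri_neq0 hw rk.
have [->|hy0] := eqVneq (\det (rowsub f (h *m y))) 0; first by rewrite y0.
have := @det_rowsub_unitri_neq0 _ _ _ w f h' (h *m y) h'w _ hy0.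
rewrite mulmxA hh mul1mx => <- // r.
exact: leq_trans (rank_rows_from_unitri _ _ hw) (rk r).
Qed.

(** A maximal set of independent rows cuts out an invertible antisymmetric
    principal block, and an antisymmetric matrix of odd size is singular. *)
Lemma antisym_rank_even (F : fieldType) m (A : 'M[F]_m) :
  2%:R != 0 :> F -> A^T = - A -> ~~ odd (\rank A).
Proof.
move=> F2 AT; apply/negP=> rodd.
set f := maxrankfun A; pose Af := rowsub f A.
have [D AE] : exists D, A = D *m Af by apply/submxP; rewrite eq_maxrowsub.
pose B := colsub f Af.
have BT : B^T = - B.
  by apply/matrixP=> i j; move/matrixP/(_ (f i) (f j)): AT; rewrite !mxE.
have AfE : Af = - (B^T *m D^T).
  have -> : Af = - (rowsub f A^T) by rewrite AT; apply/matrixP=> i j; rewrite !mxE opprK.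
  congr (- _); rewrite -trmx_mul; apply/matrixP=> i j.
  have -> : (rowsub f A^T) i j = (D *m Af) j (f i) by rewrite -AE !mxE.
  by rewrite !mxE; apply: eq_bigr => l _; rewrite !mxE.
have rB : \rank B = \rank A.
  apply/eqP; rewrite eqn_leq rank_leq_row /=.
  rewrite -{1}(eq_maxrowsub A) -/Af AfE mxrank_opp.
  by apply: leq_trans (mxrankM_maxl _ _) _; rewrite mxrank_tr.
have Bu : B \in unitmx by rewrite -row_full_unit /row_full rB.
have : \det B = - \det B.
  by rewrite -{1}det_tr BT -scaleN1r detZ -signr_odd rodd mulN1r.
move/eqP; rewrite -subr_eq0 opprK -mulr2n -mulr_natl mulf_eq0 (negPf F2) /=.
by move: Bu; rewrite unitmxE unitfE => /negPf->.
Qed.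


(** * Derivatives and algebraic independence *)

Section Derivation.
Variables (K : fieldType) (N : nat) (x0 : 'I_N -> K) (w : 'I_N).

Definition dirder (p : {mpoly K[N]}) : K := (mderiv w p).@[x0].

Lemma dirderD p q : dirder (p + q) = dirder p + dirder q.
Proof. by rewrite /dirder mderivD mevalD. Qed.
Lemma dirderN p : dirder (- p) = - dirder p.
Proof. by rewrite /dirder mderivN mevalN. Qed.
Lemma dirder0 : dirder 0 = 0.
Proof. by rewrite /dirder mderiv0 meval0. Qed.
Lemma dirderM p q : dirder (p * q) = dirder p * q.@[x0] + p.@[x0] * dirder q.
Proof. by rewrite /dirder mderivM mevalD !mevalM. Qed.
Lemma dirder_sum I r (P : pred I) (F : I -> {mpoly K[N]}) :
  dirder (\sum_(i <- r | P i) F i) = \sum_(i <- r | P i) dirder (F i).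
Proof. exact: (big_morph dirder dirderD dirder0). Qed.
Lemma dirder1 : dirder 1 = 0.
Proof. by rewrite /dirder -mpolyC1 mderivC meval0. Qed.

Lemma dirder_prod (I : eqType) (r : seq I) (F : I -> {mpoly K[N]}) :
  uniq r ->
  dirder (\prod_(i <- r) F i)
  = \sum_(j <- r) \prod_(i <- r) (if i == j then dirder (F i) else (F i).@[x0]).
Proof.
elim: r => [|a r IH] /= => [_|/andP[ar ur]]; first by rewrite !big_nil dirder1.
rewrite big_cons dirderM IH // [RHS]big_cons big_cons eqxx; congr (_ + _).
  rewrite rmorph_prod; congr (_ * _); apply: eq_big_seq => i ir.
  by case: eqP ar => // <-; rewrite ir.
rewrite big_distrr /=; apply: eq_big_seq => j jr; rewrite big_cons.
by case: eqP ar => // ->; rewrite jr.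
Qed.

Lemma dirder_det k (A : 'M[{mpoly K[N]}]_k) :
  dirder (\det A)
  = \sum_j \det (\matrix_(a, b) if b == j then dirder (A a b) else (A a b).@[x0]).
Proof.
rewrite /determinant dirder_sum exchange_big /=; apply: eq_bigr => s _.
rewrite [RHS](reindex_inj (@perm_inj _ s)) /= -big_distrr /=.
have -> (p : {mpoly K[N]}) : dirder ((-1) ^+ s * p) = (-1) ^+ s * dirder p.
  by rewrite !mulr_sign; case: ifP => // _; rewrite dirderN.
congr (_ * _); rewrite dirder_prod ?index_enum_uniq //.
apply: eq_bigr => j _; apply: eq_bigr => i _.
by rewrite mxE (inj_eq (@perm_inj _ s)).
Qed.

End Derivation.

Section Jacobian.
Variables (K : fieldType) (charK0 : [pchar K] =i pred0) (N : nat).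

Lemma mderiv_comp k (t : k.-tuple {mpoly K[N]}) (p : {mpoly K[k]}) w :
  mderiv w (p \mPo t) = \sum_(i < k) (mderiv i p \mPo t) * mderiv w (tnth t i).
Proof.
pose chain q := mderiv w (q \mPo t) =
  \sum_(i < k) (mderiv i q \mPo t) * mderiv w (tnth t i).
have ch1 : chain 1.
  rewrite /chain comp_mpoly1 -!mpolyC1 mderivC big1 // => i _.
  by rewrite mderivC comp_mpoly0 mul0r.
have chM q1 q2 : chain q1 -> chain q2 -> chain (q1 * q2).
  rewrite /chain rmorphM mderivM => -> ->.
  rewrite big_distrl big_distrr -big_split /=; apply: eq_bigr => i _.
  by rewrite mderivM comp_mpolyD !rmorphM /= mulrDl mulrAC mulrA.
have chX i : chain 'X_i.
  rewrite /chain comp_mpolyXU -tnth_nth (bigD1 i) //= big1 ?addr0.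
    rewrite mderivX mnm1E eqxx scale1r (_ : (U_(i) - U_(i))%MM = 0%MM).
      by rewrite mpolyX0 comp_mpoly1 mul1r.
    by apply/mnmP=> j; rewrite mnmBE subnn mnm0E.
  by move=> j ji; rewrite mderivX mnm1E eq_sym (negPf ji) scale0r comp_mpoly0 mul0r.
rewrite -/(chain p); elim/mpolyind: p => [|c m p _ _ IH].
  by rewrite /chain comp_mpoly0 mderiv0 big1 // => i _; rewrite mderiv0 comp_mpoly0 mul0r.
have chm : chain 'X_[m].
  rewrite mpolyXE_id; apply: (big_ind chain) => // i _.
  by elim: (m i) => [|e]; rewrite ?expr0 // exprS; apply: chM.
rewrite /chain comp_mpolyD comp_mpolyZ mderivD mderivZ chm IH scaler_sumr -big_split /=.
apply: eq_bigr => i _.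
by rewrite mderivD mderivZ comp_mpolyD comp_mpolyZ mulrDl scalerAl.
Qed.

(** A relation [p] of least degree would have all its derivatives among the
    relations, by the chain rule and the invertibility of the Jacobian matrix;
    in characteristic zero these are nonzero of smaller degree unless [p] is a
    constant. *)
Lemma jacobian_alg_independent (s : seq {mpoly K[N]}) (x0 : 'I_N -> K)
    (w : 'I_(size s) -> 'I_N) :
  \det (\matrix_(i, j) dirder x0 (w j) (tnth (in_tuple s) i)) != 0 ->
  alg_independent s.
Proof.
move=> J0; set t := in_tuple s.
pose J : 'M[{mpoly K[N]}]_(size s) := \matrix_(i, j) mderiv (w j) (tnth t i).
have detJ : \det J != 0.
  apply: contraNneq J0 => dJ; apply/eqP.
  rewrite -[RHS](meval0 x0) -dJ -det_map_mx; congr (\det _).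
  by apply/matrixP=> i j; rewrite !mxE.
have step p : p \mPo t = 0 -> forall i, mderiv i p \mPo t = 0.
  move=> p0; pose v : 'rV_(size s) := \row_i (mderiv i p \mPo t).
  have vJ : v *m J = 0.
    apply/rowP=> j; rewrite !mxE.
    transitivity (mderiv (w j) (p \mPo t)); last by rewrite p0 mderiv0.
    by rewrite mderiv_comp; apply: eq_bigr => i _; rewrite !mxE.
  have : v *m J *m \adj J = 0 by rewrite vJ mul0mx.
  rewrite -mulmxA mul_mx_adj mul_mx_scalar => /matrixP v0 i.
  have := v0 0 i; rewrite !mxE => /eqP; rewrite mulf_eq0 (negPf detJ) /=.
  by move/eqP.
suff H d (p : {mpoly K[size s]}) : (forall m, p@_m != 0 -> (mdeg m < d)%N) -> p \mPo t = 0 -> p = 0.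
  move=> p p0; apply: (H (msize p)) => // m; rewrite -mcoeff_msupp.
  exact: msize_mdeg_lt.
elim: d p => [|d IH] p dp p0.
  by apply/mpolyP=> m; rewrite mcoeff0; apply/eqP; apply: contraT => /dp.
have D0 i : mderiv i p = 0.
  apply: IH; last exact: step.
  move=> m; rewrite mcoeff_mderiv => m0; have : p@_(m + U_(i)) != 0.
    by apply: contraNneq m0 => ->; rewrite mul0rn.
  by move/dp; rewrite mdegD mdeg1 addn1 ltnS.
have pC : p = (p@_0)%:MP.
  apply/mpolyP=> m; rewrite mcoeffC; case: eqP => [<-|/eqP m0]; first by rewrite mulr1.
  rewrite mulr0; have [i mi] : exists i, m i != 0%N.
    apply/existsP; apply: contraNT m0 => /existsPn mz.
    by apply/eqP/mnmP=> i; rewrite mnm0E; apply/eqP; have := mz i; rewrite negbK.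
  have := congr1 (mcoeff (m - U_(i))) (D0 i).
  rewrite mcoeff_mderiv mcoeff0 submK; last first.
    by apply/mnm_lepP=> j; rewrite mnm1E; case: eqP => // <-; rewrite lt0n.
  rewrite -mulr_natr => /eqP; rewrite mulf_eq0 => /orP[/eqP //|].
  by rewrite ((pcharf0P K).1 charK0).
by move: p0; rewrite pC comp_mpolyC => /eqP; rewrite mpolyC_eq0 => /eqP ->.
Qed.
End Jacobian.


(** * Rook placements *)

Section Rooks.
Variables (m : nat) (T : {set 'I_m * 'I_m}).

Definition rooks (lo hi : nat) : {set 'I_m * 'I_m} :=
  [set t in T | (lo <= t.1)%N && (t.2 < hi)%N].

Definition corner (R : nzRingType) (lo hi : nat) (x : 'M[R]_m) : 'M[R]_m :=
  \matrix_(a, b) if (lo <= a)%N && (b < hi)%N then x a b else 0.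

(** The condition satisfied by the matrices supported on a staircase that [T]
    fills greedily; unlike the support, it survives multiplication by upper
    unitriangular matrices on either side. *)
Definition rook_bounded (F : fieldType) (x : 'M[F]_m) : Prop :=
  forall lo hi, (\rank (corner lo hi x) <= #|rooks lo hi|)%N.

Definition uppertri (R : nzRingType) (h : 'M[R]_m) : Prop :=
  unitri (@nat_of_ord m) h.

(** Unlike the transpose, the reflection in the antidiagonal preserves upper
    triangular matrices; it carries results on columns over to rows. *)
Definition antitr (R : nzRingType) (x : 'M[R]_m) : 'M[R]_m :=
  \matrix_(i, j) x (rev_ord j) (rev_ord i).

Lemma antitrM (R : comNzRingType) (x y : 'M[R]_m) :
  antitr (x *m y) = antitr y *m antitr x.
Proof.
apply/matrixP=> i j; rewrite !mxE (reindex_inj rev_ord_inj) /=.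
by apply: eq_bigr => a _; rewrite !mxE mulrC.
Qed.

Lemma antitr1 (R : nzRingType) : antitr (1%:M : 'M[R]_m) = 1%:M.
Proof. by apply/matrixP=> i j; rewrite !mxE (inj_eq rev_ord_inj) eq_sym. Qed.

Lemma uppertri_antitr (R : nzRingType) (h : 'M[R]_m) :
  uppertri h -> uppertri (antitr h).
Proof.
move=> [h1 hw]; split=> [i|i j]; rewrite mxE // => /hw [/rev_ord_inj->|/=].
  by left.
by move=> H; right; have := ltn_ord i; have := ltn_ord j; lia.
Qed.

Lemma rook_bounded_mull (F : fieldType) (h x : 'M[F]_m) :
  uppertri h -> rook_bounded x -> rook_bounded (h *m x).
Proof.
move=> [_ hw] bx lo hi; apply: leq_trans (bx lo hi).
rewrite (_ : corner lo hi (h *m x) = corner lo m h *m corner lo hi x).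
  exact: mxrankM_maxr.
apply/matrixP=> a b; rewrite !mxE; case: (leqP lo a) => la /=; last first.
  by rewrite big1 // => e _; rewrite !mxE leqNgt la mul0r.
case: ltnP => bh; last first.
  by rewrite big1 // => e _; rewrite !mxE [(b < hi)%N]ltnNge bh andbF mulr0.
apply: eq_bigr => e _; rewrite !mxE la bh ltn_ord /= andbT.
have [->|/hw ae] := eqVneq (h a e) 0; first by rewrite !mul0r.
suff -> : (lo <= e)%N by [].
by case: ae => [<-//|/ltnW]; apply: leq_trans.
Qed.

Lemma rook_bounded_mulr (F : fieldType) (g x : 'M[F]_m) :
  uppertri g -> rook_bounded x -> rook_bounded (x *m g).
Proof.
move=> [_ hw] bx lo hi; apply: leq_trans (bx lo hi).
rewrite (_ : corner lo hi (x *m g) = corner lo hi x *m corner 0 hi g).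
  exact: mxrankM_maxl.
apply/matrixP=> a b; rewrite !mxE; case: (leqP lo a) => la /=; last first.
  by rewrite big1 // => e _; rewrite !mxE leqNgt la mul0r.
case: ltnP => bh; last first.
  by rewrite big1 // => e _; rewrite !mxE [(b < hi)%N]ltnNge bh mulr0.
apply: eq_bigr => e _; rewrite !mxE la bh /=.
have [->|/hw ae] := eqVneq (g e b) 0; first by rewrite !mulr0.
suff -> : (e < hi)%N by [].
by case: ae => [->//|/ltn_trans]; apply.
Qed.

(** The rows and columns of the rooks weakly below and to the left of the rook
    [(p, u)], with the last column moved from [u] to [c].  Listing both rook by
    rook makes the matrix diagonal when [c = u] and the support is [T]; compared
    with the increasing order this changes the determinant by a sign only. *)
Definition rookmx (R : nzRingType) (x : 'M[R]_m) (p u c : 'I_m) :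
    'M[R]_(#|rooks p u.+1|) :=
  \matrix_(i, j) x (enum_val i).1
                   (if (enum_val j).2 == u then c else (enum_val j).2).

Definition rookdet (R : comNzRingType) (x : 'M[R]_m) (p u c : 'I_m) : R :=
  \det (rookmx x p u c).

Hypothesis Tcol : forall i k j, (i, j) \in T -> (k, j) \in T -> i = k.

Lemma mem_rooks p u (i : 'I_#|rooks p u|) :
  [/\ enum_val i \in T, (p <= (enum_val i).1)%N & ((enum_val i).2 < u)%N].
Proof. by have := enum_valP i; rewrite inE => /and3P. Qed.

Lemma card_rooks_sub lo hi p u (P : pred ('I_m * 'I_m)) :
  (forall t, t \in rooks lo hi -> (t \in rooks p u) && P t) ->
  (#|rooks lo hi| <= #|[pred i : 'I_#|rooks p u| | P (enum_val i)]|)%N.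
Proof.
move=> sub; apply: leq_trans (leq_imset_card (fun i => enum_val i) _).
apply/subset_leq_card/subsetP=> t /sub /andP[/= tr Pt].
by apply/imsetP; exists (enum_rank_in tr t); rewrite ?inE enum_rankK_in.
Qed.

Section Corner.
Variables (p u : 'I_m).
Hypothesis puT : (p, u) \in T.

Lemma corner_mem : (p, u) \in rooks p u.+1.
Proof. by rewrite inE puT leqnn ltnSn. Qed.

Definition corner_ix : 'I_#|rooks p u.+1| := enum_rank_in corner_mem (p, u).

Lemma corner_ixE : enum_val corner_ix = (p, u).
Proof. by rewrite enum_rankK_in // corner_mem. Qed.

Lemma eq_corner_ix (i : 'I_#|rooks p u.+1|) :
  ((enum_val i).2 == u) = (i == corner_ix).
Proof.
apply/eqP/eqP => [e|->]; last by rewrite corner_ixE.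
apply: enum_val_inj; rewrite corner_ixE.
have [tT _ _] := mem_rooks i; move: tT e; case: (enum_val i) => a b /= aT e.
by rewrite e in aT *; rewrite (Tcol aT puT).
Qed.

(** All columns lie before [u], in a corner with fewer rooks than the minor has
    rows. *)
Lemma rookdet_left (F : fieldType) (x : 'M[F]_m) (c : 'I_m) :
  rook_bounded x -> (c < u)%N -> rookdet x p u c = 0.
Proof.
move=> bx cu; apply/eqP; apply: contraT => d0.
have /mxrank_unit : rookmx x p u c \in unitmx by rewrite unitmxE unitfE.
suff rk : (\rank (rookmx x p u c) <= #|rooks p u|)%N.
  move=> rE; move: rk; rewrite rE leqNgt => /negP[]; apply: proper_card.
  apply/properP; split.
    by apply/subsetP=> t; rewrite !inE => /and3P[-> -> /ltnW].
  by exists (p, u); rewrite ?corner_mem // inE ltnn !andbF.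
apply: leq_trans (bx p u).
pose f (i : 'I_#|rooks p u.+1|) : 'I_m := (enum_val i).1.
pose g (j : 'I_#|rooks p u.+1|) : 'I_m :=
  if (enum_val j).2 == u then c else (enum_val j).2.
apply: leq_trans (mxrank_mxsub f g _);
  rewrite [X in (_ <= \rank X)%N](_ : _ = rookmx x p u c) //.
apply/matrixP=> i j; rewrite !mxE /f /g; have [_ -> _] := mem_rooks i.
have [_ _] := mem_rooks j; case: (eqVneq (enum_val j).2 u) => [_ _|ne].
  by rewrite cu.
by rewrite ltnS leq_eqVlt val_eqE (negPf ne) /= => ->.
Qed.

(** The hypothesis on [T] says that moving the last column to [c] brings no new
    rook below row [p] into play, so the corners still satisfy the rank bound
    that makes the minor insensitive to row operations. *)
Lemma rookdet_mull (F : fieldType) (x h h' : 'M[F]_m) (c : 'I_m) :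
  rook_bounded x -> uppertri h -> uppertri h' -> h' *m h = 1%:M ->
  (u <= c)%N ->
  (forall t, t \in T -> (p < t.1)%N -> (t.2 <= c)%N -> (t.2 <= u)%N) ->
  rookdet (h *m x) p u c = rookdet x p u c.
Proof.
move=> bx hw h'w hh uc mon.
pose f (i : 'I_#|rooks p u.+1|) : 'I_m := (enum_val i).1.
pose g (j : 'I_#|rooks p u.+1|) : 'I_m :=
  if (enum_val j).2 == u then c else (enum_val j).2.
pose y : 'M[F]_(m, _) := colsub g x.
have -> : rookdet (h *m x) p u c = \det (rowsub f (h *m y)).
  by congr (\det _); rewrite mulmx_colsub; apply/matrixP=> i j; rewrite !mxE.
rewrite (det_rowsub_unitri hw h'w hh).
  by congr (\det _); apply/matrixP=> i j; rewrite !mxE.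
move=> r; case: (leqP r p) => rp.
  apply: leq_trans (rank_leq_col _) _; rewrite -[leqLHS]card_ord.
  apply/subset_leq_card/subsetP=> i _; rewrite inE /f.
  by have [_ pi _] := mem_rooks i; apply: leq_trans pi.
apply: (@leq_trans #|rooks r c.+1|).
  apply: leq_trans (bx r c.+1); apply: leq_trans (mxrank_mxsub id g _).
  rewrite [X in (_ <= \rank X)%N](_ : _ = rows_from (@nat_of_ord m) r y) //.
  apply/matrixP=> a j; rewrite !mxE /g ltnS.
  have [_ _] := mem_rooks j; rewrite ltnS; case: eqP => [_ _|_ ju].
    by rewrite leqnn andbT.
  by rewrite (leq_trans ju uc) andbT.
apply: (card_rooks_sub (P := fun t => (r <= t.1)%N)) => t.
rewrite !inE ltnS /= => /and3P[tT rt tc]; rewrite tT rt /= andbT.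
by rewrite (leq_trans (ltnW rp) rt) /= ltnS mon // (leq_trans rp).
Qed.

(** Freeing the column of the corner exhibits the minors [rookdet x p u c], for
    varying [c], as the values of one linear form on the columns of [x]. *)
Definition bordered (F : fieldType) (x : 'M[F]_m)
    (z : 'I_#|rooks p u.+1| -> F) : F :=
  \det (\matrix_(i, j) if (enum_val j).2 == u then z i
                       else x (enum_val i).1 (enum_val j).2).

Lemma bordered_linear (F : fieldType) (x : 'M[F]_m) :
  exists C : 'I_#|rooks p u.+1| -> F,
    forall z, bordered x z = \sum_i z i * C i.
Proof.
exists (fun i => cofactor (\matrix_(i, j) if (enum_val j).2 == u then 0
                       else x (enum_val i).1 (enum_val j).2) i corner_ix) => z.
rewrite /bordered (expand_det_col _ corner_ix); apply: eq_bigr => i _.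
rewrite !mxE eq_corner_ix eqxx; congr (_ * (_ * \det _)).
by apply/matrixP=> a b; rewrite !mxE eq_corner_ix eq_sym (negPf (neq_lift _ _)).
Qed.

(** In the matrix made of the columns of [x] before [u] and of the free column,
    column operations preserve the minor; they also add to the free column a
    combination of the others, on which the form vanishes, as the case [z = 0]
    shows. *)
Lemma bordered_mulr (F : fieldType) (x g g' : 'M[F]_m) z :
  rook_bounded x -> uppertri g -> uppertri g' -> g *m g' = 1%:M ->
  bordered (x *m g) z = bordered x z.
Proof.
move=> bx gw g'w gg.
pose f (i : 'I_#|rooks p u.+1|) : 'I_m := (enum_val i).1.
pose gj (j : 'I_#|rooks p u.+1|) : 'I_m := (enum_val j).2.
(* [s] is what multiplication by [g] adds to the free column. *)
pose s i := \sum_(e : 'I_m | (e < u)%N) x (f i) e * g e u.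
pose y z : 'M[F]_(_, m) :=
  \matrix_(i, e) if (e < u)%N then x (f i) e else if e == u then z i else 0.
have gju j : (gj j <= u)%N by have [_ _] := mem_rooks j; rewrite ltnS.
have colE z' : colsub gj (y z') = \matrix_(i, j)
    if (enum_val j).2 == u then z' i else x (enum_val i).1 (enum_val j).2.
  apply/matrixP=> i j; rewrite !mxE /gj ltn_neqAle gju andbT.
  by case: (eqVneq _ u) => [->|ne]; rewrite ?eqxx // val_eqE ne.
have [g1 gup] := gw.
have colgE z' : colsub gj (y z' *m g) = \matrix_(i, j)
    if (enum_val j).2 == u then z' i + s i
    else (x *m g) (enum_val i).1 (enum_val j).2.
  apply/matrixP=> i j; rewrite !mxE -/(gj j).
  case: (eqVneq (gj j) u) => [->|ne].
    rewrite (bigID (fun e : 'I_m => (e < u)%N)) /= addrC; congr (_ + _); last first.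
      by apply: eq_bigr => e eu; rewrite mxE eu.
    rewrite (bigD1 u) ?ltnn //= mxE ltnn eqxx g1 mulr1 big1 ?addr0 // => e /andP[eu ne].
    by rewrite mxE (negPf eu) (negPf ne) mul0r.
  apply: eq_bigr => e _; rewrite !mxE; case: ltnP => // ue.
  have [->|/gup] := eqVneq (g e (gj j)) 0; first by rewrite !mulr0.
  have ju : (gj j < u)%N by rewrite ltn_neqAle gju andbT val_eqE ne.
  by case=> [ej|ej]; exfalso; move: ue; rewrite leqNgt ?ej ?ju // (ltn_trans ej ju).
have inv z' : bordered (x *m g) (fun i => z' i + s i) = bordered x z'.
  rewrite /bordered -colgE -colE -[LHS]det_tr -[RHS]det_tr.
  pose w (e : 'I_m) : nat := rev_ord e.
  have trE (B : 'M[F]_(_, m)) : (colsub gj B)^T = rowsub gj B^T.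
    by apply/matrixP=> i j; rewrite !mxE.
  have wP h : uppertri h -> unitri w h^T.
    move=> [h1 hup]; split=> [i|i j]; rewrite mxE // => /hup [->|ij]; first by left.
    by right; rewrite /w /=; have := ltn_ord i; have := ltn_ord j; lia.
  rewrite !trE trmx_mul; apply: (det_rowsub_unitri (wP _ _ gw) (wP _ _ g'w)).
    by rewrite -trmx_mul gg trmx1.
  move=> r; case: (ltnP u (m - r)) => ur.
    apply: leq_trans (rank_leq_col _) _; rewrite -[leqLHS]card_ord.
    apply/subset_leq_card/subsetP=> i _; rewrite inE /w /=.
    by have := gju i; have := ltn_ord u; lia.
  apply: (@leq_trans #|rooks p (m - r)|).
    apply: leq_trans (bx p (m - r)%N); rewrite -mxrank_tr.
    apply: leq_trans (mxrank_mxsub f id _).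
    rewrite [X in (_ <= \rank X)%N](_ : _ = (rows_from w r (y z')^T)^T) //.
    apply/matrixP=> i e; rewrite !mxE /f; have [_ -> _] := mem_rooks i.
    have -> : (e < m - r)%N = (r <= w e)%N by rewrite /w /=; have := ltn_ord e; lia.
    case: (boolP (r <= w e)%N) => // re; rewrite (_ : (e < u)%N) //.
    by move: re ur; rewrite /w /=; have := ltn_ord e; lia.
  apply: (card_rooks_sub (P := fun t => (r <= w t.2)%N)) => t.
  rewrite !inE => /and3P[tT pt tr]; rewrite tT pt /= /w /=.
  move: tr ur; have := ltn_ord t.2; move: (nat_of_ord t.2) => e em er ru; apply/andP;
    split; lia.
have [C CE] := bordered_linear (x *m g).
have := inv (fun=> 0); have [C' CE'] := bordered_linear x.
rewrite CE' big1 => [|i _]; last by rewrite mul0r.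
rewrite CE => s0; rewrite -inv !CE.
under [RHS]eq_bigr => i _ do rewrite mulrDl.
rewrite big_split /= (_ : \sum_i s i * C i = 0) ?addr0 //.
by apply: etrans s0; apply: eq_bigr => i _; rewrite add0r.
Qed.

Lemma rookdet_bordered (F : fieldType) (x : 'M[F]_m) c :
  rookdet x p u c = bordered x (fun i => x (enum_val i).1 c).
Proof. by congr (\det _); apply/matrixP=> i j; rewrite !mxE; case: eqP. Qed.

(** The linear form being unchanged, the minors transform like the entries of
    a row vector. *)
Lemma rookdet_mulr (F : fieldType) (x g g' : 'M[F]_m) (c : 'I_m) :
  rook_bounded x -> uppertri g -> uppertri g' -> g *m g' = 1%:M ->
  rookdet (x *m g) p u c = \sum_e rookdet x p u e * g e c.
Proof.
move=> bx gw g'w gg; rewrite rookdet_bordered (bordered_mulr _ bx gw g'w gg).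
have [C CE] := bordered_linear x; rewrite CE.
under [RHS]eq_bigr => e _ do rewrite rookdet_bordered CE big_distrl /=.
rewrite exchange_big /=; apply: eq_bigr => i _.
rewrite mxE big_distrl /=; apply: eq_bigr => e _.
by rewrite -!mulrA [g _ _ * _]mulrC.
Qed.

Lemma rookdet_invariant (F : fieldType) (x h g : 'M[F]_m) :
  rook_bounded x -> uppertri h -> uppertri g -> h *m g = 1%:M ->
  rookdet (h *m x *m g) p u u = rookdet x p u u.
Proof.
move=> bx hw gw hg; have gh := mulmx1C hg.
have bhx := rook_bounded_mull hw bx.
rewrite (rookdet_mulr _ bhx gw hw gh) (bigD1 u) //= (proj1 gw) mulr1.
rewrite (rookdet_mull bx hw gw gh) // big1 ?addr0 // => e eu.
have [->|/(proj2 gw)] := eqVneq (g e u) 0; first by rewrite mulr0.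
case=> [e'|lt]; first by rewrite e' eqxx in eu.
by rewrite rookdet_left // mul0r.
Qed.

End Corner.

Hypothesis Tsym : forall i j, (i, j) \in T -> (rev_ord j, rev_ord i) \in T.

Lemma card_rooks_rev lo hi : (#|rooks (m - hi) (m - lo)| <= #|rooks lo hi|)%N.
Proof.
pose s (t : 'I_m * 'I_m) := (rev_ord t.2, rev_ord t.1).
have sK : injective s.
  by move=> [a b] [c d] /= [e1 e2]; congr (_, _); apply: rev_ord_inj; apply: val_inj.
rewrite -(card_imset _ sK); apply/subset_leq_card/subsetP=> _ /imsetP[[a b] + ->].
rewrite !inE /= => /and3P[/Tsym -> la bh] /=.
by have := ltn_ord a; have := ltn_ord b; lia.
Qed.

Lemma rook_bounded_antitr (F : fieldType) (x : 'M[F]_m) :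
  rook_bounded x -> rook_bounded (antitr x).
Proof.
move=> bx lo hi; apply: leq_trans (card_rooks_rev lo hi).
apply: leq_trans (bx _ _); rewrite -[leqRHS]mxrank_tr.
apply: leq_trans (mxrank_mxsub (@rev_ord m) (@rev_ord m) _).
rewrite [X in (_ <= \rank X)%N](_ : _ = corner lo hi (antitr x)) //.
apply/matrixP=> a b; rewrite !mxE /=.
have -> : (m - hi <= m - b.+1)%N = (b < hi)%N by have := ltn_ord b; lia.
have -> : (m - a.+1 < m - lo)%N = (lo <= a)%N by have := ltn_ord a; lia.
by rewrite andbC.
Qed.

(** Both factors of the sum transform like a row and a column vector under
    conjugation, which cancels in the pairing; the hypotheses confine the
    pairing to the indices from [u] to [v]. *)
Lemma rookpair_invariant (F : fieldType) (x h g : 'M[F]_m) (p u v q : 'I_m) :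
  rook_bounded x -> uppertri h -> uppertri g -> h *m g = 1%:M ->
  (p, u) \in T -> (v, q) \in T ->
  (forall t, t \in T -> (p < t.1)%N -> (t.2 <= v)%N -> (t.2 <= u)%N) ->
  (forall t, t \in T -> (t.2 < q)%N -> (u <= t.1)%N -> (v <= t.1)%N) ->
  let pairing y := \sum_(c : 'I_m | (u <= c <= v)%N)
    rookdet y p u c * rookdet (antitr y) (rev_ord q) (rev_ord v) (rev_ord c) in
  pairing (h *m x *m g) = pairing x.
Proof.
move=> bx hw gw hg puT vqT monc monr pairing; have gh := mulmx1C hg.
pose V (y : 'M[F]_m) c := rookdet y p u c.
pose W (y : 'M[F]_m) c := rookdet (antitr y) (rev_ord q) (rev_ord v) (rev_ord c).
have qvT := Tsym vqT.
have bt (y : 'M[F]_m) : rook_bounded y -> rook_bounded (antitr y) by apply: rook_bounded_antitr.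
have th := uppertri_antitr hw; have tg := uppertri_antitr gw.
have thg : antitr g *m antitr h = 1%:M by rewrite -antitrM hg antitr1.
have tgh : antitr h *m antitr g = 1%:M by rewrite -antitrM gh antitr1.
have bhx := rook_bounded_mull hw bx; have bxg := rook_bounded_mulr gw bx.
have V0 y (c : 'I_m) : rook_bounded y -> (c < u)%N -> V y c = 0.
  exact: rookdet_left.
have W0 y (c : 'I_m) : rook_bounded y -> (v < c)%N -> W y c = 0.
  move=> by' vc; apply: rookdet_left => //; first exact: bt.
  by rewrite /=; have := ltn_ord c; have := ltn_ord v; lia.
(* Minors with [e < u] vanish, and those with [e <= v] do not see [h]. *)
have VE (c : 'I_m) : (u <= c <= v)%N -> V (h *m x *m g) c = \sum_(e : 'I_m | (u <= e)%N) V x e * g e c.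
  move=> /andP[uc cv]; rewrite /V (rookdet_mulr puT _ bhx gw hw gh).
  rewrite (bigID (fun e : 'I_m => (u <= e)%N)) /= addrC big1 ?add0r => [|e]; last first.
    by rewrite -ltnNge => eu; rewrite rookdet_left // mul0r.
  apply: eq_bigr => e ue; have [->|/(proj2 gw) ec] := eqVneq (g e c) 0;
    first by rewrite !mulr0.
  have {}ec : (e <= c)%N by case: ec => [->|/ltnW].
  rewrite (rookdet_mull bx hw gw gh ue) // => t tT pt te.
  by apply: monc => //; rewrite (leq_trans te) // (leq_trans ec).
have WE (c : 'I_m) : (u <= c <= v)%N -> W (h *m x *m g) c = \sum_(e : 'I_m | (e <= v)%N) h c e * W x e.
  move=> /andP[uc cv]; rewrite /W antitrM antitrM.
  have bgx : rook_bounded (antitr g *m antitr x) by apply: rook_bounded_mull => //;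
    apply: bt.
  rewrite mulmxA (rookdet_mulr qvT _ bgx th tg tgh).
  rewrite (reindex_inj rev_ord_inj) /=.
  rewrite (bigID (fun e : 'I_m => (e <= v)%N)) /= addrC big1 ?add0r => [|e]; last first.
    rewrite -ltnNge => ve; rewrite rookdet_left ?mul0r //=.
    by have := ltn_ord e; have := ltn_ord v; lia.
  apply: eq_bigr => e ev; rewrite mulrC mxE !rev_ordK.
  have [->|/(proj2 hw) ce] := eqVneq (h c e) 0; first by rewrite !mul0r.
  have {}ce : (c <= e)%N by case: ce => [<-|/ltnW].
  rewrite (rookdet_mull _ tg th tgh) //=.
  - exact: bt.
  - by have := ltn_ord e; have := ltn_ord v; lia.
  move=> [a b] /Tsym /= tT qa be.
  have := monr _ tT; rewrite /= => H; have := ltn_ord a; have := ltn_ord b.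
  have := ltn_ord q; have := ltn_ord v; have := ltn_ord e; lia.
transitivity (\sum_(c : 'I_m | (u <= c <= v)%N) V (h *m x *m g) c * W (h *m x *m g) c) => //.
transitivity (\sum_(c : 'I_m | (u <= c <= v)%N) \sum_(e : 'I_m | (u <= e)%N) \sum_(d : 'I_m | (d <= v)%N)
    V x e * (g e c * h c d) * W x d).
  apply: eq_bigr => c ucv; rewrite VE // WE // big_distrl /=; apply: eq_bigr => e _.
  by rewrite big_distrr /=; apply: eq_bigr => d _; rewrite !mulrA.
rewrite exchange_big /=.
transitivity (\sum_(e : 'I_m | (u <= e)%N) \sum_(d : 'I_m | (d <= v)%N) V x e * (e == d)%:R * W x d).
  apply: eq_bigr => e ue; rewrite exchange_big /=; apply: eq_bigr => d dv.
  rewrite -big_distrl -big_distrr /=; congr (_ * _ * _).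
  move/matrixP/(_ e d): gh; rewrite !mxE => <-.
  rewrite [RHS](bigID (fun c : 'I_m => (u <= c <= v)%N)) /= [X in _ + X]big1 ?addr0 // => c.
  have [->|/(proj2 gw) ec] := eqVneq (g e c) 0; first by rewrite mul0r.
  have [->|/(proj2 hw) cd] := eqVneq (h c d) 0; first by rewrite mulr0.
  have {}ec : (e <= c)%N by case: ec => [->|/ltnW].
  have {}cd : (c <= d)%N by case: cd => [->|/ltnW].
  by rewrite (leq_trans ue ec) (leq_trans cd dv).
rewrite (bigID (fun e : 'I_m => (e <= v)%N)) /= [X in _ + X]big1 ?addr0; last first.
  move=> e /andP[_ ev]; rewrite big1 // => d dv; case: eqP => [ed|_];
    last by rewrite mulr0 mul0r.
  by rewrite ed dv in ev.
apply: eq_bigr => e /andP[ue ev];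
  rewrite (bigD1 e) //= eqxx mulr1 big1 ?addr0 // => d /andP[_ de].
by rewrite eq_sym (negPf de) mulr0 mul0r.
Qed.

End Rooks.


(** * The rank bound for the nilradical *)

Section RankBound.
Variables (F : fieldType) (m : nat) (T : {set 'I_m * 'I_m}).
Variables (shape : rel 'I_m) (skew : bool) (x : 'M[F]_m).

Lemma corner_row lo hi (i : 'I_m) : i = lo :> nat ->
  (\rank (corner lo hi x) <= (\rank (corner lo.+1 hi x)).+1)%N.
Proof.
move=> il; rewrite (_ : corner lo hi x =
    corner lo.+1 hi x + delta_mx i i *m corner lo hi x).
  apply: leq_trans (mxrank_add _ _) _; rewrite -[leqRHS]addn1 leq_add2l.
  by apply: leq_trans (mxrankM_maxl _ _) _; rewrite mxrank_delta.
apply/matrixP=> a b; rewrite [RHS]mxE [X in _ + X]mxE (bigD1 i) //= big1 => [|e ei].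
  rewrite !mxE eqxx andbT addr0; case: (eqVneq a i) => [->|ai].
    by rewrite il leqnn ltnn mul1r add0r.
  by rewrite mul0r addr0 [in RHS]ltn_neqAle -il eq_sym val_eqE ai.
by rewrite mxE (negPf ei) andbF mul0r.
Qed.

Lemma corner_col lo hi (j : 'I_m) : j = hi :> nat ->
  (\rank (corner lo hi.+1 x) <= (\rank (corner lo hi x)).+1)%N.
Proof.
move=> jh; rewrite (_ : corner lo hi.+1 x =
    corner lo hi x + corner lo hi.+1 x *m delta_mx j j).
  apply: leq_trans (mxrank_add _ _) _; rewrite -[leqRHS]addn1 leq_add2l.
  by apply: leq_trans (mxrankM_maxr _ _) _; rewrite mxrank_delta.
apply/matrixP=> a b; rewrite [RHS]mxE [X in _ + X]mxE (bigD1 j) //= big1 => [|e ej].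
  rewrite !mxE eqxx /= addr0 ltnS; case: (eqVneq b j) => [->|bj].
    by rewrite /= jh !leqnn ltnn andbF mulr1 add0r.
  by rewrite /= mulr0 addr0 [(b <= hi)%N]leq_eqVlt -jh val_eqE (negPf bj).
by rewrite !mxE (negPf ej) mulr0.
Qed.

Lemma rooks_sub lo hi lo' hi' : (lo' <= lo)%N -> (hi <= hi')%N ->
  (#|rooks T lo hi| <= #|rooks T lo' hi'|)%N.
Proof.
move=> ll hh; apply/subset_leq_card/subsetP=> t; rewrite !inE => /and3P[-> a b].
by rewrite (leq_trans ll a) (leq_trans b hh).
Qed.

Lemma rooks_proper lo hi lo' hi' t : (lo' <= lo)%N -> (hi <= hi')%N ->
  t \in rooks T lo' hi' -> t \notin rooks T lo hi ->
  (#|rooks T lo hi| < #|rooks T lo' hi'|)%N.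
Proof.
move=> ll hh t1 t2; apply/proper_card/properP; split; last by exists t.
apply/subsetP=> s; rewrite !inE => /and3P[-> a b].
by rewrite (leq_trans ll a) (leq_trans b hh).
Qed.

Hypothesis Tsym : forall i j, (i, j) \in T -> (rev_ord j, rev_ord i) \in T.
Hypothesis shape_mono : forall i j i' j' : 'I_m,
  shape i j -> (i' <= i)%N -> (j <= j')%N -> shape i' j'.
Hypothesis Tbase : forall i j : 'I_m, shape i j -> ~~ (skew && (j == rev_ord i)) ->
  (i, j) \notin T ->
  (exists2 k : 'I_m, (k <= j)%N & (i, k) \in T) \/
  (exists2 k : 'I_m, (i <= k)%N & (k, j) \in T).
Hypothesis Tskew : skew -> forall i, (i, rev_ord i) \notin T.
Hypothesis x_shape : forall i j, x i j != 0 -> shape i j.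
Hypothesis x_skew : skew -> forall i j, x (rev_ord j) (rev_ord i) = - x i j.
Hypothesis F2 : 2%:R != 0 :> F.

(** The reflection in the antidiagonal pairs the rooks, none being fixed. *)
Lemma rooks_even lo : skew -> ~~ odd #|rooks T lo (m - lo)|.
Proof.
move=> sk; pose s (t : 'I_m * 'I_m) := (rev_ord t.2, rev_ord t.1).
have sK : involutive s by move=> [a b]; rewrite /s /= !rev_ordK.
pose A := [set t in rooks T lo (m - lo) | (t.1 < rev_ord t.2)%N].
have AE : rooks T lo (m - lo) :\: A = s @: A.
  apply/setP=> t; apply/setDP/imsetP => [[tr tA]|[t' t'A ->]].
    exists (s t); last by rewrite sK.
    have tne : t.1 != rev_ord t.2.
      apply: contraTneq tr => e; rewrite inE; case: t e {tA} => a b /= ->.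
      by rewrite -{2}[b]rev_ordK (negPf (Tskew sk _)).
    move: tr tA; rewrite !inE /= => /and3P[tT la bh]; rewrite tT la bh /=.
    case: t tT la bh tne => a b /= /Tsym -> la bh; rewrite -val_eqE /= => ne.
    by have := ltn_ord a; have := ltn_ord b; lia.
  move: t'A; rewrite !inE /=; case: t' => a b /= /andP[/and3P[/Tsym -> la bh] ab].
  by have := ltn_ord a; have := ltn_ord b; split; lia.
have AS : A \subset rooks T lo (m - lo) by apply/subsetP=> t; rewrite inE => /andP[].
rewrite -(cardsID A) AE (card_imset _ (inv_inj sK)) (setIidPr AS) addnn.
by rewrite odd_double.
Qed.

Lemma corner_even lo : skew -> ~~ odd (\rank (corner lo (m - lo) x)).
Proof.
move=> sk; pose B : 'M[F]_m := \matrix_(i, j) corner lo (m - lo) x i (rev_ord j).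
suff -> : \rank (corner lo (m - lo) x) = \rank B.
  apply: antisym_rank_even => //; apply/matrixP=> i j; rewrite !mxE /=.
  have -> : (m - j.+1 < m - lo)%N = (lo <= j)%N by have := ltn_ord j; lia.
  have -> : (m - i.+1 < m - lo)%N = (lo <= i)%N by have := ltn_ord i; lia.
  rewrite andbC; case: ifP => _; last by rewrite oppr0.
  by rewrite -[X in x X _]rev_ordK x_skew.
apply/eqP; rewrite eqn_leq; apply/andP; split; last exact: (mxrank_mxsub id (@rev_ord m)).
apply: leq_trans (mxrank_mxsub id (@rev_ord m) B).
by rewrite [X in (_ <= \rank X)%N](_ : _ = corner lo (m - lo) x) //;
   apply/matrixP=> i j; rewrite !mxE rev_ordK.
Qed.

(** The bound is proved corner by corner, dropping the bottom row or the right
    column when it contains a rook; otherwise the bottom right entry lies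
    outside the shape, or on the antidiagonal of a skew matrix, whose rank is
    even. *)
Lemma nilradical_rook_bounded : rook_bounded T x.
Proof.
move=> lo hi; elim: {lo hi}(m - lo + hi)%N {-2}lo {-2}hi (leqnn (m - lo + hi)%N).
  by move=> lo hi H; rewrite (_ : corner _ _ _ = 0) ?mxrank0 //;
     apply/matrixP=> a b; rewrite !mxE; case: ifP => // /andP[_ bh]; lia.
move=> s IH lo [|d] le_s.
  by rewrite (_ : corner _ _ _ = 0) ?mxrank0 //; apply/matrixP=> a b; rewrite !mxE andbF.
case: (leqP m d) => [md|dm].
  rewrite (_ : corner _ _ _ = corner lo d x); last first.
    by apply/matrixP=> a b; rewrite !mxE; have := ltn_ord b; rewrite ltnS => bm;
       rewrite (leq_trans bm md) (leq_trans (ltnW bm) md).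
  by apply: leq_trans (IH lo d _) _; [lia|exact: rooks_sub].
case: (leqP m lo) => [ml|lm].
  rewrite (_ : corner _ _ _ = 0) ?mxrank0 //; apply/matrixP=> a b; rewrite !mxE.
  by rewrite leqNgt (leq_trans (ltn_ord a) ml).
pose i := Ordinal lm; pose j := Ordinal dm.
have IHr : (\rank (corner lo.+1 d.+1 x) <= #|rooks T lo.+1 d.+1|)%N by apply: IH; lia.
case: (pickP (fun k : 'I_m => (k <= j)%N && ((i, k) \in T))) => [k /andP[kj ikT]|norow].
  apply: leq_trans (@corner_row lo d.+1 i _) _ => //.
  apply: leq_ltn_trans IHr _; apply: (@rooks_proper _ _ _ _ (i, k)) => //.
    by rewrite inE ikT /= leqnn.
  by rewrite inE /= ltnn andbF.
case: (pickP (fun k : 'I_m => (i <= k)%N && ((k, j) \in T))) => [k /andP[ik kjT]|nocol].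
  apply: leq_trans (@corner_col lo d j _) _ => //.
  apply: (leq_ltn_trans (IH lo d _)); first by lia.
  apply: (@rooks_proper _ _ _ _ (k, j)) => //.
    by rewrite inE kjT /= ik leqnn.
  by rewrite inE /= ltnn !andbF.
case: (boolP (shape i j)) => [sij|nsij]; last first.
  rewrite (_ : corner lo d.+1 x = corner lo.+1 d.+1 x).
    by apply: leq_trans IHr (rooks_sub _ _).
  apply/matrixP=> a b; rewrite !mxE; case: (ltngtP lo a) => //= la.
  case: ifP => // bd; apply/eqP; apply: contraNT nsij => /x_shape sab.
  by apply: shape_mono sab _ _; rewrite /= ?la.
case: (boolP (skew && (j == rev_ord i))) => [/andP[sk /eqP ji]|nsk].
  (* The extra row adds at most one to the rank; as the rank and the number of
     rooks are both even here, it cannot exceed the latter. *)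
  have dE : d.+1 = (m - lo)%N by move/(congr1 val): ji => /=; lia.
  have := corner_even lo sk; have := rooks_even lo sk; rewrite -dE => ev1 ev2.
  have : (\rank (corner lo d.+1 x) <= #|rooks T lo d.+1|.+1)%N.
    apply: leq_trans (@corner_row lo d.+1 i _) _ => //; rewrite ltnS.
    exact: leq_trans IHr (rooks_sub _ _).
  by rewrite leq_eqVlt => /orP[/eqP e|//]; rewrite e /= ev1 in ev2.
case: (boolP ((i, j) \in T)) => [ijT|ijT]; first by have := norow j; rewrite leqnn ijT.
case: (Tbase sij nsk ijT) => [[k kj kT]|[k ik kT]].
  by have := norow k; rewrite kj kT.
by have := nocol k; rewrite ik kT.
Qed.

End RankBound.

(** * Minors of matrices supported on a rook placement *)

Section Supported.
Variables (F : fieldType) (m : nat) (T : {set 'I_m * 'I_m}).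
Hypothesis Tcol : forall i k j, (i, j) \in T -> (k, j) \in T -> i = k.
Hypothesis Trow : forall i j k, (i, j) \in T -> (i, k) \in T -> j = k.

Definition rook_supported (z : 'M[F]_m) : Prop :=
  forall i j, (z i j != 0) = ((i, j) \in T).

(** The derivative of [rookdet] at [z] in the direction [y], column by column. *)
Definition rookder (z y : 'M[F]_m) (p u c : 'I_m) : F :=
  \sum_j \det (\matrix_(a, b < #|rooks T p u.+1|)
     (if b == j then y else z) (enum_val a).1
       (if (enum_val b).2 == u then c else (enum_val b).2)).

Variables (p u : 'I_m) (z : 'M[F]_m).
Hypothesis puT : (p, u) \in T.
Hypothesis zT : rook_supported z.

Let l := corner_ix puT.
Let lE := eq_corner_ix Tcol puT.

Lemma supported_entry (a b : 'I_#|rooks T p u.+1|) (c : 'I_m) : (u <= c)%N ->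
  z (enum_val a).1 (if (enum_val b).2 == u then c else (enum_val b).2) != 0 ->
  a = b /\ (b = l -> c = u).
Proof.
move=> uc; rewrite zT; have [aT _ au] := mem_rooks a; have [bT _ bu] := mem_rooks b.
case: ifP => [bu'|/negbT bl] tT.
  have e : (enum_val a).2 = c by apply: Trow tT; case: (enum_val a) aT.
  have cu : c = u.
    by apply: val_inj; apply/eqP; rewrite eqn_leq uc andbT -e -ltnS.
  split=> //; move: bu'; rewrite lE => /eqP->; apply/eqP.
  by rewrite -lE e cu.
have e : (enum_val a).2 = (enum_val b).2 by apply: Trow tT; case: (enum_val a) aT.
split; last by move=> bl'; rewrite lE bl' eqxx in bl.
apply: enum_val_inj; move: aT bT e; case: (enum_val a) => a1 a2 /=.
by case: (enum_val b) => b1 b2 /= aT bT e; rewrite e in aT *; rewrite (Tcol aT bT).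
Qed.

Lemma rookdet_supported0 (c : 'I_m) : (u < c)%N -> rookdet T z p u c = 0.
Proof.
move=> uc; rewrite /rookdet (det_keyed (key := fun=> 0%N)); last first.
  by move=> a b; rewrite mxE => /(supported_entry (ltnW uc)) [-> _]; left.
rewrite (bigD1 l) //= mxE; set e := z _ _.
case: (eqVneq e 0) => [->|]; first by rewrite mul0r.
by move=> H; have [_ H'] := supported_entry (ltnW uc) H; rewrite (H' erefl) ltnn in uc.
Qed.

Lemma rookdet_supported_neq0 : rookdet T z p u u != 0.
Proof.
rewrite /rookdet (det_keyed (key := fun=> 0%N)); last first.
  by move=> a b; rewrite mxE => /(supported_entry (leqnn u)) [-> _]; left.
apply/prodf_neq0 => a _; rewrite mxE zT.
have -> : (if (enum_val a).2 == u then u else (enum_val a).2) = (enum_val a).2.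
  by case: eqP.
by have [+ _ _] := mem_rooks a; case: (enum_val a).
Qed.

(** Up to the column of the corner, the matrix at [z] is diagonal and each of its
    columns is that of a rook.  Differentiating another column leaves a zero on
    the diagonal: that of the corner if it was moved, the derived one otherwise. *)
Lemma rookder_supported : exists2 C : F, C != 0 &
  forall (y : 'M[F]_m) (c : 'I_m),
    (u < c)%N \/ c = u /\ (forall t, t \in rooks T p u.+1 -> t != (p, u) ->
                              y t.1 t.2 = 0) ->
    rookder z y p u c = y p c * C.
Proof.
exists (\prod_(a | a != l) z (enum_val a).1 (enum_val a).2).
  apply/prodf_neq0 => a _; rewrite zT.
  by have [+ _ _] := mem_rooks a; case: (enum_val a).
move=> y c ucy; have uc : (u <= c)%N by case: ucy => [/ltnW|[->]].
have detE j : \det (\matrix_(a, b < #|rooks T p u.+1|)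
     (if b == j then y else z) (enum_val a).1
       (if (enum_val b).2 == u then c else (enum_val b).2)) =
   \prod_(a : 'I_#|rooks T p u.+1|) (if a == j then y else z) (enum_val a).1
       (if (enum_val a).2 == u then c else (enum_val a).2).
  rewrite (det_keyed (key := fun b => nat_of_bool (b == j))); last first.
    move=> a b; rewrite mxE; case: (eqVneq b j) => [->|_].
      by case: (eqVneq a j) => [->|_]; [left|right].
    by move/(supported_entry uc) => [-> _]; left.
  by apply: eq_bigr => a _; rewrite mxE.
rewrite /rookder (bigD1 l) //= [X in _ + X]big1 ?addr0; last first.
  move=> j jl; rewrite detE; case: ucy => [ltuc|[cu y0]].
    rewrite (bigD1 l) //= eq_sym (negPf jl); set e := z _ _.
    case: (eqVneq e 0) => [->|]; first by rewrite mul0r.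
    by move=> H; have [_ H'] := supported_entry uc H; rewrite (H' erefl) ltnn in ltuc.
  rewrite (bigD1 j) //= eqxx lE (negPf jl) y0 ?mul0r ?enum_valP //.
  by apply: contraNneq jl => e; rewrite -lE e.
rewrite detE (bigD1 l) //= eqxx lE eqxx corner_ixE; congr (_ * _).
by apply: eq_bigr => a al; rewrite lE (negPf al).
Qed.

End Supported.


(** * Minors given by sets of rows and columns *)

Lemma sorted_enum_ord m (A : {set 'I_m}) : sorted ltn (map val (enum A)).
Proof.
rewrite {1}/enum_mem sorted_map; apply: sorted_filter.
  by move=> x y z; apply: ltn_trans.
by rewrite -enumT -sorted_map val_enum_ord iota_ltn_sorted.
Qed.

Lemma eq_enum_ord m (A : {set 'I_m}) (s : seq 'I_m) :
  sorted ltn (map val s) -> s =i A -> enum A = s.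
Proof.
move=> ss sA; apply: (inj_map val_inj).
apply: (irr_sorted_eq ltn_trans ltnn (sorted_enum_ord A) ss) => i.
apply/mapP/mapP => [[x xA ->]|[x xs ->]]; exists x => //; move: xA || move: xs.
  by rewrite mem_enum sA.
by rewrite mem_enum -sA.
Qed.

Lemma enum_setU1_max m (A : {set 'I_m}) (c : 'I_m) :
  (forall a, a \in A -> (a < c)%N) -> enum (c |: A) = rcons (enum A) c.
Proof.
move=> Ac; apply: eq_enum_ord => [|x]; last by rewrite mem_rcons !inE mem_enum.
rewrite map_rcons; have := sorted_enum_ord A.
have : all (fun a => a < c)%N (map val (enum A)).
  by apply/allP=> _ /mapP[a aA ->]; rewrite /= Ac // -mem_enum.
case: (map val (enum A)) => //= a s /andP[ac sc]; rewrite rcons_path => -> /=.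
by have := mem_last a s; rewrite inE => /orP[/eqP->//|/(allP sc)].
Qed.

Lemma enum_rev_ord m (A : {set 'I_m}) :
  enum [set rev_ord a | a in A] = rev (map (@rev_ord m) (enum A)).
Proof.
apply: eq_enum_ord => [|x].
  rewrite map_rev rev_sorted -map_comp !sorted_map.
  have := sorted_enum_ord A; rewrite sorted_map; apply: sub_sorted => a b /=.
  by rewrite /relpre /=; have := ltn_ord a; have := ltn_ord b; lia.
rewrite mem_rev; apply/mapP/imsetP => [[a aA ->]|[a aA ->]]; exists a => //.
  by rewrite mem_enum in aA.
by rewrite mem_enum.
Qed.

(** The expression in the definition of [minor], over any ring, so that it can
    be evaluated and reflected. *)
Definition setminor (R : comNzRingType) m (x : 'M[R]_m) (I J : {set 'I_m}) : R :=
  \det (\matrix_(i < #|I|, j < #|I|)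
          x (enum_val i) (nth (enum_val i) (enum J) j)).

Lemma setminorE (R : comNzRingType) m (x : 'M[R]_m) (I J : {set 'I_m}) k d :
  #|I| = k -> #|J| = k ->
  setminor x I J =
  \det (\matrix_(i < k, j < k) x (nth d (enum I) i) (nth d (enum J) j)).
Proof.
move=> Ik Jk; case: k / Ik Jk => JI; congr (\det _); apply/matrixP=> i j.
by rewrite !mxE (enum_val_nth d); congr (x _ _); apply: set_nth_default; rewrite -cardE JI.
Qed.

Lemma det_perms (R : comNzRingType) k (A : 'M[R]_k) (s t : 'S_k) :
  \det (\matrix_(i, j) A (s i) (t j)) = (-1) ^+ (s (+) t) * \det A.
Proof.
have -> : \matrix_(i, j) A (s i) (t j) = row_perm s (col_perm t A).
  by apply/matrixP=> i j; rewrite !mxE.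
rewrite row_permE col_permE !det_mulmx !det_perm odd_permV signr_addb.
by rewrite [\det A * _]mulrC mulrA.
Qed.

(** Transposition reverses the order of both rows and columns, and the two
    signs cancel. *)
Lemma setminor_antitr (R : comNzRingType) m (x : 'M[R]_m) (I J : {set 'I_m}) :
  #|I| = #|J| ->
  setminor (antitr x) I J
  = setminor x [set rev_ord j | j in J] [set rev_ord i | i in I].
Proof.
move=> IJ; have cI (A : {set 'I_m}) : #|[set rev_ord i | i in A]| = #|A|.
  by rewrite card_imset //; apply: rev_ord_inj.
case: (posnP #|I|) => [I0|/card_gt0P[d _]].
  have det0 k (A : 'M[R]_k) : k = 0%N -> \det A = 1 by move=> k0; move: A;
    rewrite k0 => A; apply: det_mx00.
  by rewrite /setminor !det0 // cI -IJ.
rewrite (@setminorE _ _ _ _ _ #|I| d) // (@setminorE _ _ _ _ _ #|I| d) ?cI // -det_tr.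
pose rv : 'S_#|I| := perm rev_ord_inj.
set M := (\matrix_(i, j) _)^T; set M' := \matrix_(i, j) _.
have -> : M = \matrix_(i, j) M' (rv i) (rv j).
  apply/matrixP=> i j; rewrite !mxE !permE !enum_rev_ord.
  rewrite !nth_rev ?size_map -?cardE -?IJ ?ltn_ord //=.
  have e (a : 'I_#|I|) : (#|I| - (#|I| - a.+1).+1)%N = a by have := ltn_ord a; lia.
  by rewrite !e !(nth_map d) // -cardE -?IJ ltn_ord.
by rewrite det_perms addbb mul1r.
Qed.

Lemma perm_of_seq (A : eqType) k (f : 'I_k -> A) (s : seq A) d :
  uniq s -> size s = k -> (forall a, a \in s -> exists i, a = f i) ->
  exists t : 'S_k, forall i : 'I_k, nth d s i = f (t i).
Proof.
move=> us sk sf.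
have ex (i : 'I_k) : exists j, nth d s i == f j.
  by have [|j ->] := sf (nth d s i); [rewrite mem_nth ?sk|exists j].
pose g i := xchoose (ex i);
  have gP (i : 'I_k) : nth d s i = f (g i) by apply/eqP/(xchooseP (ex i)).
have ginj : injective g.
  move=> i j /(congr1 f); rewrite -!gP => /eqP; rewrite nth_uniq ?sk // => /eqP.
  exact: val_inj.
by exists (perm ginj) => i; rewrite permE.
Qed.

Section RookMinors.
Variables (m : nat) (T : {set 'I_m * 'I_m}).
Hypothesis Tcol : forall i k j, (i, j) \in T -> (k, j) \in T -> i = k.
Hypothesis Trow : forall i j k, (i, j) \in T -> (i, k) \in T -> j = k.

Definition rowset (p c : 'I_m) : {set 'I_m} :=
  p |: [set t.1 | t in T & (p < t.1)%N && (t.2 < c)%N].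
Definition colset (p c : 'I_m) : {set 'I_m} :=
  c |: [set t.2 | t in T & (p < t.1)%N && (t.2 < c)%N].

(** The minor with lower left part [T] and upper right corner [(p, c)]. *)
Definition hookminor (R : comNzRingType) (x : 'M[R]_m) (p c : 'I_m) : R :=
  setminor x (rowset p c) (colset p c).

Lemma Tinj1 : {in T &, injective (fun t : 'I_m * 'I_m => t.1)}.
Proof. by move=> [a b] [c d] /= aT cT e; rewrite -e in cT *; rewrite (Trow aT cT). Qed.
Lemma Tinj2 : {in T &, injective (fun t : 'I_m * 'I_m => t.2)}.
Proof. by move=> [a b] [c d] /= aT cT e; rewrite -e in cT *; rewrite (Tcol aT cT). Qed.

Lemma card_rowset_colset p c : #|rowset p c| = #|colset p c|.
Proof.
set A := [set t in T | (p < t.1)%N && (t.2 < c)%N].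
have AT t : t \in A -> t \in T by rewrite inE => /andP[].
have rE : rowset p c = p |: [set t.1 | t in A].
  by congr (_ |: _); apply/setP=> i; apply/imsetP/imsetP => -[t tA ->]; exists t;
     rewrite ?inE // in tA *.
have cE : colset p c = c |: [set t.2 | t in A].
  by congr (_ |: _); apply/setP=> i; apply/imsetP/imsetP => -[t tA ->]; exists t;
     rewrite ?inE // in tA *.
have pA : p \notin [set t.1 | t in A].
  by apply/imsetP=> -[t]; rewrite inE => /and3P[_ + _] e; rewrite e ltnn.
have cA : c \notin [set t.2 | t in A].
  by apply/imsetP=> -[t]; rewrite inE => /and3P[_ _ +] e; rewrite e ltnn.
rewrite rE cE (cardsU1 p) (cardsU1 c) pA cA; congr (1 + _)%N.
transitivity #|A|; last apply/esym; apply: card_in_imset => s t /AT sT /AT tT.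
  exact: Tinj1.
exact: Tinj2.
Qed.

Lemma hookminor_antitr (R : comNzRingType) (x : 'M[R]_m) p c :
  (forall i j, (i, j) \in T -> (rev_ord j, rev_ord i) \in T) ->
  hookminor (antitr x) p c = hookminor x (rev_ord c) (rev_ord p).
Proof.
move=> Tsym; rewrite /hookminor setminor_antitr ?card_rowset_colset //.
congr setminor; rewrite imsetU1; congr (_ |: _); apply/setP=> i.
  apply/imsetP/imsetP => [[j /imsetP[[a b]]]|[[a b]]]; rewrite inE /=.
    move=> /and3P[/Tsym abT pa bc] -> ->; exists (rev_ord b, rev_ord a) => //.
    by rewrite inE abT /=; have := ltn_ord a; have := ltn_ord b; have := ltn_ord c; lia.
  move=> /and3P[/Tsym abT pa bc] ->; exists (rev_ord a); last by rewrite rev_ordK.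
  apply/imsetP; exists (rev_ord b, rev_ord a) => //; rewrite inE abT /=.
  by move: pa bc => /=; have := ltn_ord a; have := ltn_ord b; have := ltn_ord p;
    have := ltn_ord c; lia.
apply/imsetP/imsetP => [[j /imsetP[[a b]]]|[[a b]]]; rewrite inE /=.
  move=> /and3P[/Tsym abT pa bc] -> ->; exists (rev_ord b, rev_ord a) => //.
  by rewrite inE abT /=; have := ltn_ord a; have := ltn_ord b; have := ltn_ord c; lia.
move=> /and3P[/Tsym abT pa bc] ->; exists (rev_ord b); last by rewrite rev_ordK.
apply/imsetP; exists (rev_ord b, rev_ord a) => //; rewrite inE abT /=.
by move: pa bc => /=; have := ltn_ord a; have := ltn_ord b; have := ltn_ord p;
  have := ltn_ord c; lia.
Qed.

(** The sign comes from listing the rooks in arbitrary order in [rookdet]; what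
    matters is that it does not depend on the last column. *)
Lemma hookminor_rookdet (p u v : 'I_m) :
  (p, u) \in T ->
  (forall t, t \in T -> (p < t.1)%N -> (t.2 <= v)%N -> (t.2 <= u)%N) ->
  exists b : bool, forall (R : comNzRingType) (x : 'M[R]_m) (c : 'I_m),
    (u <= c <= v)%N -> hookminor x p c = (-1) ^+ b * rookdet T x p u c.
Proof.
move=> puT mon; pose k := #|rooks T p u.+1|.
pose I := [set t.1 | t in rooks T p u.+1].
pose J0 := [set t.2 | t in rooks T p u.+1 & t.2 != u].
have RT t : t \in rooks T p u.+1 -> t \in T by rewrite inE => /andP[].
have cI : #|I| = k.
  by rewrite card_in_imset // => s t /RT sT /RT tT; apply: Tinj1.
have J0u a : a \in J0 -> (a < u)%N.
  move=> /imsetP[t]; rewrite !inE ltnS => /andP[/and3P[_ _ tu] tne] ->.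
  by rewrite ltn_neqAle tu andbT.
have uR : (p, u) \in rooks T p u.+1 by rewrite inE puT leqnn ltnSn.
have cJ0 : (#|J0|.+1 = k)%N.
  have -> : k = #|[set t.2 | t in rooks T p u.+1]|.
    by rewrite card_in_imset // => s t /RT sT /RT tT; apply: Tinj2.
  rewrite -(_ : u |: J0 = [set t.2 | t in rooks T p u.+1]).
    by rewrite cardsU1; case: (boolP (u \in J0)) => // /J0u; rewrite ltnn.
  apply/setP=> a; apply/setU1P/imsetP => [[->|/imsetP[t]]|[t tR ->]].
  - by exists (p, u).
  - by rewrite inE => /andP[tR _] ->; exists t.
  by case: (eqVneq t.2 u) => [|tu]; [left|right; apply/imsetP; exists t; rewrite // inE tR].
have rE (c : 'I_m) : (u <= c <= v)%N -> rowset p c = I.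
  move=> /andP[uc cv]; apply/setP=> a; apply/setU1P/imsetP => [[->|/imsetP[t]]|[t tR ->]].
  - by exists (p, u).
  - rewrite inE => /and3P[tT pt tc] ->; exists t => //.
    by rewrite inE tT (ltnW pt) ltnS mon // (leq_trans (ltnW tc)).
  move: (tR); rewrite inE ltnS => /and3P[tT pt tu]; case: (eqVneq t.1 p) => [|ne];
    [by left|right].
  apply/imsetP; exists t => //; rewrite inE tT ltn_neqAle eq_sym ne pt /=.
  rewrite (leq_trans _ uc) // ltn_neqAle tu andbT; apply: contraNneq ne => e.
  have e2 : t.2 = u by apply: val_inj.
  by apply/eqP; apply: (@Tcol _ _ u) => //; rewrite -e2; case: (t) tT.
have cE (c : 'I_m) : (u <= c <= v)%N -> colset p c = c |: J0.
  move=> /andP[uc cv]; congr (_ |: _); apply/setP=> a.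
  apply/imsetP/imsetP => -[t]; rewrite !inE => H ->; exists t => //; move: H; rewrite !inE.
    move=> /and3P[tT pt tc]; rewrite tT (ltnW pt) ltnS mon // ?(leq_trans (ltnW tc)) //=.
    apply: contraTneq pt => tu; rewrite -leqNgt (_ : t.1 = p) //.
    by apply: (@Tcol _ _ u) => //; rewrite -tu; case: (t) tT.
  rewrite ltnS => /andP[/and3P[tT pt tu] tne]; rewrite tT /=.
  have ltu : (t.2 < u)%N by rewrite ltn_neqAle tu andbT.
  rewrite (leq_trans ltu uc) andbT ltn_neqAle pt andbT; apply: contraNneq tne => e.
  apply/eqP; apply: (@Trow p) => //.
  by rewrite (_ : p = t.1) //; [case: (t) tT|apply: val_inj].
pose ev (i : 'I_k) : 'I_m * 'I_m := enum_val i.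
have [s sE] : exists s : 'S_k, forall i : 'I_k, nth p (enum I) i = (ev (s i)).1.
  apply: (@perm_of_seq _ k (fun i => (ev i).1)); rewrite ?enum_uniq -?cardE // => a.
  rewrite mem_enum => /imsetP[t tR ->]; exists (enum_rank_in tR t).
  by rewrite /ev enum_rankK_in.
have [s' s'E] : exists s : 'S_k, forall i : 'I_k,
    nth p (rcons (enum J0) u) i = (ev (s i)).2.
  apply: (@perm_of_seq _ k (fun i => (ev i).2)).
  - by rewrite rcons_uniq enum_uniq andbT mem_enum; apply/negP=> /J0u; rewrite ltnn.
  - by rewrite size_rcons -cardE.
  move=> a; rewrite mem_rcons inE mem_enum => /orP[/eqP->|/imsetP[t]].
    by exists (enum_rank_in uR (p, u)); rewrite /ev enum_rankK_in.
  by rewrite inE => /andP[tR _] ->; exists (enum_rank_in tR t); rewrite /ev enum_rankK_in.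
exists (s (+) s') => R x c ucv.
have Jc : enum (c |: J0) = rcons (enum J0) c.
  apply: enum_setU1_max => a /J0u au; apply: leq_trans au _.
  by case/andP: ucv.
rewrite /hookminor (@setminorE _ _ _ _ _ k p) ?rE ?cE //; last first.
  by rewrite cardE Jc size_rcons -cardE.
rewrite -det_perms; congr (\det _); apply/matrixP=> i j; rewrite !mxE Jc.
rewrite sE -/(ev _) -/(ev _) -s'E; congr (x _ _); rewrite !nth_rcons -!cardE.
have := ltn_ord j; rewrite -[X in (_ < X)%N]cJ0 ltnS => jk.
case: ltngtP jk => // [jlt|_] _; last by rewrite eqxx.
have /J0u : nth p (enum J0) j \in J0 by rewrite -mem_enum mem_nth -?cardE.
by rewrite ltn_neqAle => /andP[/negPf ne _]; rewrite -val_eqE /= ne.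
Qed.

End RookMinors.


(** * Indices and roots *)

Section Indices.
Variables (c : classical) (n : nat).
Notation ix := (idx c n).
Implicit Types (a b i j k l s t : idx c n).

Lemma negK : involutive (@neg c n). Proof. exact: rev_ordK. Qed.
Lemma neg_inj : injective (@neg c n). Proof. exact: rev_ord_inj. Qed.
Lemma val_neg a : neg a = (dimG c n - a.+1)%N :> nat. Proof. by []. Qed.
Lemma dimGE : dimG c n = (n + n + is_odd c)%N. Proof. by rewrite /dimG addnn. Qed.

Lemma leq_neg a b : (neg a <= neg b)%N = (b <= a)%N.
Proof. by rewrite !val_neg; have := ltn_ord a; have := ltn_ord b; lia. Qed.
Lemma ltn_neg a b : (neg a < neg b)%N = (b < a)%N.
Proof. by rewrite !val_neg; have := ltn_ord a; have := ltn_ord b; lia. Qed.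

(** The character of the diagonal torus given by the entry at [a]. *)
Definition evec a : 'rV[int]_n :=
  \row_t ((a == t :> nat)%:R - (neg a == t :> nat)%:R).

Lemma evec_neg a : evec (neg a) = - evec a.
Proof. by apply/rowP=> t; rewrite !mxE negK opprB. Qed.

Variant ix_spec a : Type :=
  | IxPos (t : 'I_n) of a = posidx c t
  | IxNeg (t : 'I_n) of a = neg (posidx c t)
  | IxMid of neg a = a.

Lemma ixP a : ix_spec a.
Proof.
case: (ltnP a n) => [an|na]; first by apply: (@IxPos _ (Ordinal an)); apply: val_inj.
case: (ltnP (neg a) n) => [an|na'].
  by apply: (@IxNeg _ (Ordinal an)); apply: neg_inj; rewrite negK; apply: val_inj.
apply: IxMid; apply: val_inj; move: na'; rewrite /= ?val_neg.
by have := ltn_ord a; have := dimGE; case: (is_odd c) => /=; lia.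
Qed.

Lemma evec_sum_count (X : seq ix) (t : 'I_n) :
  (\sum_(x <- X) evec x) 0 t
  = (count_mem (posidx c t) X)%:R - (count_mem (neg (posidx c t)) X)%:R.
Proof.
elim: X => [|x X IH]; first by rewrite big_nil mxE subrr.
rewrite big_cons mxE IH mxE /= !natrD.
have -> : (x == posidx c t) = (x == t :> nat) by rewrite -val_eqE.
have -> : (x == neg (posidx c t)) = (neg x == t :> nat).
  by rewrite -(inj_eq neg_inj) negK -val_eqE.
by rewrite opprD addrACA.
Qed.

Lemma evec_sum_eq (X Y : seq ix) a :
  \sum_(x <- X) evec x = \sum_(y <- Y) evec y ->
  (count_mem a X + count_mem (neg a) Y = count_mem a Y + count_mem (neg a) X)%N.
Proof.
move=> XY; have H (t : 'I_n) := congr1 (fun v : 'rV_n => v 0 t) XY.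
have gen (p q s t : nat) : p%:Z - q%:Z = s%:Z - t%:Z -> (p + t = s + q)%N by lia.
case: (ixP a) => [t ->|t ->|->]; last by rewrite addnC.
- by have := H t; rewrite /= !evec_sum_count !natz => /gen.
by rewrite negK; have := H t; rewrite /= !evec_sum_count !natz => /gen E;
  rewrite addnC -E addnC.
Qed.

(** No two terms of the sum of [evec] over such a sequence cancel. *)
Definition reduced (X : seq ix) := forall x, x \in X -> neg x \notin X.

Lemma reduced_perm_eq (X Y : seq ix) : reduced X -> reduced Y ->
  \sum_(x <- X) evec x = \sum_(y <- Y) evec y -> perm_eq X Y.
Proof.
move=> rX rY XY; apply/allP=> a _; apply/eqP; have := evec_sum_eq a XY.
have cX : a \in X -> count_mem (neg a) X = 0%N by move/rX/count_memPn.
have cY : a \in Y -> count_mem (neg a) Y = 0%N by move/rY/count_memPn.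
have nX : neg a \in X -> count_mem a X = 0%N by move/rX; rewrite negK => /count_memPn.
have nY : neg a \in Y -> count_mem a Y = 0%N by move/rY; rewrite negK => /count_memPn.
move: cX cY nX nY; rewrite -!has_pred1 !has_count /=; lia.
Qed.

Definition mid a := neg a == a.

Lemma evec_mid a : mid a -> evec a = 0.
Proof. by move/eqP=> e; apply/rowP=> t; rewrite !mxE e subrr. Qed.

Lemma mid_uniq a b : mid a -> mid b -> a = b.
Proof.
move=> /eqP/(congr1 val) /= ea /eqP/(congr1 val) /= eb; apply: val_inj => /=.
by have := ltn_ord a; have := ltn_ord b; lia.
Qed.

Lemma mid_neg a : mid (neg a) = mid a.
Proof. by rewrite /mid negK eq_sym. Qed.

Lemma evec_sum_filter (X : seq ix) :
  \sum_(x <- X) evec x = \sum_(x <- [seq x <- X | ~~ mid x]) evec x.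
Proof.
rewrite big_filter (bigID (@mid)) /= big1 ?add0r // => x; exact: evec_mid.
Qed.

Lemma perm_eq2 (T : eqType) (x1 x2 y1 y2 : T) : perm_eq [:: x1; x2] [:: y1; y2] ->
  (x1 = y1 /\ x2 = y2) \/ (x1 = y2 /\ x2 = y1).
Proof.
move=> P; have : x1 \in [:: y1; y2] by rewrite -(perm_mem P) mem_head.
rewrite !inE => /orP[] /eqP e; subst.
  by left; split=> //; move: P; rewrite perm_cons => /perm_small_eq -/(_ isT) [].
right; split=> //; have : perm_eq [:: y2; x2] [:: y2; y1].
  by apply: perm_trans P _; rewrite (perm_catC [:: y1] [:: y2]).
by rewrite perm_cons => /perm_small_eq -/(_ isT) [].
Qed.

Lemma evec_inj : injective evec.
Proof.
move=> a b ab; case: (boolP (mid a)) => am; case: (boolP (mid b)) => bm.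
- exact: mid_uniq.
- have : perm_eq [::] [:: b].
    apply: reduced_perm_eq => [//|x|]; first by rewrite !inE => /eqP->.
    by rewrite big_nil big_seq1 -ab evec_mid.
  by move/perm_size.
- have : perm_eq [:: a] [::].
    apply: reduced_perm_eq => [x|//|]; first by rewrite !inE => /eqP->.
    by rewrite big_nil big_seq1 ab evec_mid.
  by move/perm_size.
have /perm_small_eq -/(_ isT) [] // : perm_eq [:: a] [:: b].
apply: reduced_perm_eq => [x|x|]; try by rewrite !inE => /eqP->.
by rewrite !big_seq1.
Qed.

(** Only the middle index has a zero character, and it is unique; the other
    terms form reduced sums, which have the same terms. *)
Lemma evec_sum2 x1 x2 y1 y2 : x1 != neg x2 ->
  evec x1 + evec x2 = evec y1 + evec y2 ->
  (x1 = y1 /\ x2 = y2) \/ (x1 = y2 /\ x2 = y1).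
Proof.
move=> x12 E; have y12 : y1 != neg y2.
  apply: contraNneq x12 => y12; apply/eqP/evec_inj; rewrite evec_neg.
  by apply/eqP; rewrite -subr_eq0 opprK E y12 evec_neg addNr.
have red (u v : ix) : u != neg v -> reduced [seq x <- [:: u; v] | ~~ mid x].
  move=> uv x; rewrite !mem_filter !inE => /andP[xm /orP[]/eqP e]; subst x.
    by rewrite (negPf (xm : neg u != u)) /= mid_neg xm /= eq_sym -(inj_eq neg_inj) negK eq_sym in uv *.
  by rewrite (negPf (xm : neg v != v)) orbF mid_neg xm /= eq_sym.
have P : perm_eq [seq x <- [:: x1; x2] | ~~ mid x] [seq x <- [:: y1; y2] | ~~ mid x].
  by apply: reduced_perm_eq; rewrite -?evec_sum_filter ?big_cons ?big_nil ?addr0 //;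
    apply: red.
have nomid (u v : ix) : u != neg v -> mid u -> mid v = false.
  move=> uv um; apply: contraNF uv => vm; rewrite (mid_uniq um vm) eq_sym; exact: vm.
move: P => /=; case x1m: (mid x1); case x2m: (mid x2); case y1m: (mid y1);
  case y2m: (mid y2) => //= P;
  rewrite ?(nomid _ _ x12 x1m) ?(nomid _ _ y12 y1m) // in x2m y2m;
  try by have := perm_size P.
- by left; split; [apply: mid_uniq|have /perm_small_eq -/(_ isT) [] := P].
- by right; split; [apply: mid_uniq|have /perm_small_eq -/(_ isT) [] := P].
- by right; split; [have /perm_small_eq -/(_ isT) [] := P|apply: mid_uniq].
- by left; split; [have /perm_small_eq -/(_ isT) [] := P|apply: mid_uniq].
exact: perm_eq2.
Qed.

(** Without cancellation between the two pairs the four terms would form a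
    reduced sum with at least three nonzero terms, since a pair contains the
    middle index at most once. *)
Lemma evec_sum4 x1 x2 y1 y2 y3 y4 : x1 != neg x2 -> y1 != neg y2 -> y3 != neg y4 ->
  evec x1 + evec x2 = evec y1 + evec y2 + (evec y3 + evec y4) ->
  [\/ y1 = neg y3, y1 = neg y4, y2 = neg y3 | y2 = neg y4].
Proof.
move=> x12 y12 y34 E.
have nomid (u v : ix) : u != neg v -> mid u -> mid v -> False.
  by move=> uv um vm; move: uv; rewrite (mid_uniq um vm) eq_sym => /negP; apply.
case: (eqVneq y1 (neg y3)) => [|y13]; first by constructor.
case: (eqVneq y1 (neg y4)) => [|y14]; first by constructor.
case: (eqVneq y2 (neg y3)) => [|y23]; first by constructor.
case: (eqVneq y2 (neg y4)) => [|y24]; first by constructor.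
have red (X : seq ix) : (forall x y, x \in X -> y \in X -> ~~ mid x -> x != neg y) ->
    reduced [seq x <- X | ~~ mid x].
  move=> HX x; rewrite !mem_filter => /andP[xm xX].
  by apply/negP=> /andP[_ nxX]; have := HX _ _ nxX xX; rewrite mid_neg eqxx => /(_ xm).
have symn (u v : ix) : u != neg v -> v != neg u.
  by apply: contraNneq => ->; rewrite negK.
have P : perm_eq [seq x <- [:: x1; x2] | ~~ mid x] [seq x <- [:: y1; y2; y3;
  y4] | ~~ mid x].
  apply: reduced_perm_eq; rewrite -?evec_sum_filter ?big_cons ?big_nil ?addr0 //.
  - apply: red => x y; rewrite !inE => /orP[]/eqP-> /orP[]/eqP-> m;
      rewrite ?(symn _ _ x12) //;
      by rewrite eq_sym.
  - apply: red => x y; rewrite !inE => /or4P[]/eqP-> /or4P[]/eqP-> m //; rewrite 1?symn //;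
      by rewrite eq_sym.
  by rewrite E !addrA.
have := perm_size P; rewrite /=.
have M12 := nomid _ _ y12; have M34 := nomid _ _ y34; have M13 := nomid _ _ y13.
have M14 := nomid _ _ y14; have M23 := nomid _ _ y23; have M24 := nomid _ _ y24.
case: (mid x1); case: (mid x2); case: (mid y1) M12 M13 M14; case: (mid y2) M23 M24;
  case: (mid y3) M34; case: (mid y4) => //=; do ?[by move=> H; case: H]; by move=> *;
    exfalso; auto.
Qed.

(** Positions up to the reflection in the antidiagonal. *)
Definition refl (p : ix * ix) : ix * ix := (neg p.2, neg p.1).
Definition poseq (p q : ix * ix) : bool := (p == q) || (p == refl q).

Lemma reflK : involutive refl. Proof. by case=> a b; rewrite /refl /= !negK. Qed.

Lemma poseqP p q : reflect (p = q \/ p = refl q) (poseq p q).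
Proof. by apply: (iffP orP) => -[/eqP|/eqP]; auto. Qed.

Lemma poseq_refl p : poseq p p. Proof. by rewrite /poseq eqxx. Qed.
Lemma poseq_sym p q : poseq p q = poseq q p.
Proof. by rewrite /poseq eq_sym; congr (_ || _);
  rewrite -(inj_eq (inv_inj reflK)) reflK eq_sym. Qed.

Lemma poseq_trans q p (s : ix * ix) : poseq p q -> poseq q s -> poseq p s.
Proof.
by case/poseqP => -> /poseqP[] ->; rewrite ?reflK ?poseq_refl // /poseq eqxx orbT.
Qed.

Lemma evec_poseq p q : poseq p q -> evec p.1 - evec p.2 = evec q.1 - evec q.2.
Proof. by case/poseqP => -> //=; rewrite !evec_neg opprK addrC. Qed.

Lemma evec_diff2 i j k l : i != j ->
  evec i - evec j = evec k - evec l -> poseq (i, j) (k, l).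
Proof.
move=> ij; rewrite -!evec_neg => /evec_sum2;
  rewrite negK => /(_ ij) [[-> /neg_inj->]|[-> <-]].
  exact: poseq_refl.
by apply/poseqP; right; rewrite /refl /= !negK.
Qed.

(** A root that is a sum of two roots is obtained by chaining two positions at
    a common index, after reflecting one of them if necessary. *)
Lemma evec_diff4 i j k l s t : i != j -> k != l -> s != t ->
  evec i - evec j = evec k - evec l + (evec s - evec t) ->
  exists s' t', [/\ poseq (s', t') (s, t) &
    l = s' /\ poseq (i, j) (k, t') \/ k = t' /\ poseq (i, j) (s', l)].
Proof.
move=> ij kl st; rewrite -3!evec_neg => E.
have E' := E; move/evec_sum4: E' => /=; rewrite !negK => /(_ ij kl st).
have fin s' t' : poseq (s', t') (s, t) -> l = s' \/ k = t' ->
  exists s' t', [/\ poseq (s', t') (s, t) &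
    l = s' /\ poseq (i, j) (k, t') \/ k = t' /\ poseq (i, j) (s', l)].
  move=> st' lk; exists s', t'; split=> //.
  have Es := evec_poseq st'; rewrite /= in Es; rewrite !evec_neg -Es in E.
  case: lk => e; [left|right]; split=> //; apply: evec_diff2 => //; rewrite E e.
    by rewrite addrA subrK.
  by rewrite addrC addrA subrK.
case=> e.
- by apply: (fin (neg t) (neg s));
    [rewrite poseq_sym /poseq /refl /= !negK eqxx orbT|right].
- by apply: (fin s t); [exact: poseq_refl|right].
- by apply: (fin s t); [exact: poseq_refl|left; apply: neg_inj].
by apply: (fin (neg t) (neg s));
  [rewrite poseq_sym /poseq /refl /= !negK eqxx orbT|left; apply: neg_inj; rewrite negK].
Qed.

(** Roots, together with the formal elements [2 eps_i]. *)
Definition rootlike (g : rsym n) : bool :=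
  pos_root c g || [exists i : 'I_n, g == Dbl i].

(** The half of the positions in which [Epos] takes its values. *)
Definition normal (p : ix * ix) : bool := (neg p.2 <= p.1)%N && (p.1 < p.2)%N.

Lemma normalE a b : normal (a, b) = (neg b <= a)%N && (a < b)%N.
Proof. by []. Qed.
Lemma reflE a b : refl (a, b) = (neg b, neg a).
Proof. by []. Qed.

Lemma normal_refl p : normal p -> normal (refl p) -> refl p = p.
Proof.
case: p => a b; rewrite reflE !normalE negK => /andP[h1 _] /andP[h2 _].
have ab : a = neg b by apply/val_inj/eqP; rewrite eqn_leq h1 h2.
by rewrite ab negK.
Qed.

Lemma normal_poseq p q : normal p -> normal q -> poseq p q -> p = q.
Proof. by move=> np nq /poseqP[//|e]; rewrite e in np *; apply: normal_refl. Qed.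

Lemma rootlikeE g : rootlike g = match g with
  | Diff i j | Sum i j => (i < j)%N | Dbl _ => true | Sht _ => is_odd c end.
Proof.
rewrite /rootlike; case: g => [i j|i j|i|i] /=; rewrite ?orbF //.
- by case: existsP => [[? /eqP]|_]; rewrite ?orbF.
- by case: existsP => [[? /eqP]|_]; rewrite ?orbF.
- by apply/orP; right; apply/existsP; exists i.
by case: existsP => [[? /eqP]|_]; rewrite ?orbF.
Qed.

Lemma val_center (i : 'I_n) : is_odd c -> insubd (posidx c i) n = n :> nat.
Proof.
move=> co; rewrite val_insubd; have -> // : (n < dimG c n)%N.
by rewrite dimGE co; have := ltn_ord i; lia.
Qed.

Lemma Epos_normal g : rootlike g -> normal (Epos c g).
Proof.
rewrite rootlikeE /normal; have D := dimGE; case: g => [i j|i j|i|i] /=;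
  rewrite ?val_neg /=.
- by have := ltn_ord i; have := ltn_ord j; lia.
- by have := ltn_ord i; have := ltn_ord j; lia.
- by have := ltn_ord i; lia.
move=> co; rewrite val_center //.
by have := ltn_ord i; rewrite D co; lia.
Qed.

Lemma Epos_exists p : normal p -> exists2 g, rootlike g & Epos c g = p.
Proof.
case: p => a b; rewrite normalE => /andP[ba ab].
have [i bE] : exists i : 'I_n, b = neg (posidx c i).
  case: (ixP b) => [t e|t e|e]; [|by exists t|].
    move: ba ab; rewrite e val_neg /=; have := ltn_ord t; have := dimGE; lia.
  by move: ba ab; rewrite e; lia.
case: (ixP a) => [t aE|t aE|am].
- case: (eqVneq t i) => [e|ti].
    by exists (Dbl i); rewrite ?rootlikeE //= bE aE e.
  exists (Sum i t); last by rewrite /= aE bE.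
  rewrite rootlikeE ltn_neqAle eq_sym ti; move: ba.
  by rewrite bE negK aE.
- exists (Diff i t); last by rewrite /= aE bE.
  by rewrite rootlikeE; move: ab; rewrite aE bE ltn_neg.
have ea : (a = n :> nat) /\ is_odd c.
  by move/(congr1 val): am; rewrite /= ?val_neg; have := ltn_ord a; have := dimGE;
    case: (is_odd c) => /=; lia.
exists (Sht i); first by rewrite rootlikeE ea.2.
rewrite /= bE; congr (_, _); apply: val_inj; rewrite [LHS](val_center i ea.2);
  exact: esym ea.1.
Qed.

Lemma rvecE g : rootlike g -> rvec g = evec (Epos c g).1 - evec (Epos c g).2.
Proof.
have pE (i : 'I_n) : evec (posidx c i) = eps i.
  apply/rowP=> t; rewrite !mxE eqxx [t == i]eq_sym /=.
  rewrite [X in _ - X](_ : _ = 0) ?subr0 //; case: eqP => //.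
  by have := ltn_ord i; have := ltn_ord t; have := dimGE; lia.
rewrite rootlikeE; case: g => [i j|i j|i|i] /=; rewrite ?evec_neg ?pE ?opprK ?mulr2n //.
- by move=> _; rewrite addrC.
- by move=> _; rewrite addrC.
move=> co; rewrite evec_mid ?add0r //; apply/eqP/val_inj.
by rewrite /= val_center // dimGE co; lia.
Qed.

Lemma Epos_inj g g' : rootlike g -> rootlike g' -> Epos c g = Epos c g' -> g = g'.
Proof.
have D := dimGE; rewrite !rootlikeE.
case: g => [i j|i j|i|i] gr; case: g' => [i' j'|i' j'|i'|i'] gr' E;
  have e1 := congr1 (fun p : ix * ix => nat_of_ord p.1) E;
  have e2 := congr1 (fun p : ix * ix => nat_of_ord p.2) E;
    rewrite /= ?val_center // in e1 e2;
  (have {}e2 : i = i' by apply: val_inj; have := ltn_ord i; have := ltn_ord i';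
    move: e2 => /=; lia); subst i';
  have i_lt := ltn_ord i; try have j_lt := ltn_ord j; try have j'_lt := ltn_ord j';
    try by lia.
- by rewrite (_ : j = j') //; apply: val_inj => /=; lia.
- by rewrite (_ : j = j') //; apply: val_inj => /=; lia.
- by [].
by [].
Qed.

Lemma rvec_inj g g' : rootlike g -> rootlike g' -> rvec g = rvec g' -> g = g'.
Proof.
move=> gr gr' E; apply: Epos_inj => //; apply: normal_poseq; try exact: Epos_normal.
move: E; rewrite !rvecE //; case: (Epos c g) (Epos_normal gr) => a b.
case: (Epos c g') => a' b' /andP[_ /= ab] /evec_diff2; apply.
by apply: contraTneq ab => ->; rewrite ltnn.
Qed.

Lemma root_at i j : (i < j)%N -> exists2 g, rootlike g & poseq (Epos c g) (i, j).
Proof.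
move=> ij; case: (leqP (neg j) i) => ji.
  have [g gr gE] : exists2 g, rootlike g & Epos c g = (i, j) by apply: Epos_exists;
    rewrite normalE ji.
  by exists g; rewrite // gE poseq_refl.
have [g gr gE] : exists2 g, rootlike g & Epos c g = (neg j, neg i).
  by apply: Epos_exists; rewrite normalE negK ltn_neg ij andbT ltnW.
by exists g; rewrite // gE /poseq reflE eqxx orbT.
Qed.

Lemma pos_root_at g : pos_root c g =
  rootlike g && (is_symp c || ((Epos c g).1 != neg (Epos c g).2)).
Proof.
rewrite rootlikeE; have D := dimGE; case: g => [i j|i j|i|i] /=; rewrite ?negK.
- case: ltnP => //= ij; rewrite orbC -val_eqE /=; apply/esym/orP; left; apply/eqP.
  by have := ltn_ord i; have := ltn_ord j; lia.
- case: ltnP => //= ij; rewrite orbC -val_eqE /=; apply/esym/orP; left; apply/eqP; lia.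
- by rewrite eqxx orbF.
case co: (is_odd c) => //=; rewrite orbC -val_eqE /= val_center //.
by apply/esym/orP; left; apply/eqP; have := ltn_ord i; lia.
Qed.

Lemma antidiagonal_root (d : rsym n) a : rootlike d -> Epos c d = (a, neg a) ->
  exists2 i : 'I_n, d = Dbl i & a = posidx c i.
Proof.
move=> dr dE; have /andP[_] := Epos_normal dr; rewrite dE => an0;
  have an : (a < neg a)%N := an0.
case: (ixP a) => [i aE|i aE|e]; last by move: an; rewrite e ltnn.
  by exists i => //; apply: Epos_inj => //; rewrite ?rootlikeE // dE aE.
exfalso; move: an; rewrite aE negK val_neg /=.
by have := ltn_ord i; have := dimGE; lia.
Qed.

Lemma pos_rootlike g : pos_root c g -> rootlike g.
Proof. by rewrite /rootlike => ->. Qed.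

End Indices.


(** * The parabolic subalgebra *)

Lemma sumn_take_leq s t (sh : seq nat) : (s <= t)%N ->
  (sumn (take s sh) <= sumn (take t sh))%N.
Proof.
move=> st; rewrite -(cat_take_drop s (take t sh)) take_takel // sumn_cat.
exact: leq_addr.
Qed.

Lemma leq_reshape_index t sh i : (i < sumn sh)%N -> (t <= size sh)%N ->
  (t <= reshape_index sh i)%N = (sumn (take t sh) <= i)%N.
Proof.
move=> ish ts; set b := reshape_index sh i.
have bs : (b < size sh)%N by apply: reshape_indexP.
have iE : i = (sumn (take b sh) + reshape_offset sh i)%N.
  by rewrite -{1}(reshape_indexK sh i).
have off := reshape_offsetP ish.
apply/idP/idP => [tb|].
  by rewrite iE (leq_trans (sumn_take_leq sh tb)) // leq_addr.
apply: contraTT; rewrite -!ltnNge => bt.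
apply: leq_trans (sumn_take_leq sh bt); rewrite (take_nth 0%N) //.
by rewrite -cats1 sumn_cat /= addn0 {1}iE ltn_add2l.
Qed.

Section Blocks.
Variables (c : classical) (n : nat) (r : seq nat).
Hypothesis r_le : (sumn r <= n)%N.
Notation ix := (idx c n).
Notation sh := (block_sizes c n r).
Implicit Types (i j a b : ix).

Definition shape i j : bool := (block r i < block r j)%N.

Lemma sumn_block_sizes : sumn sh = dimG c n.
Proof.
rewrite /block_sizes sumn_cat /= sumn_rev addnCA addnn subnK //.
by rewrite -addnn /dimG -addnn; lia.
Qed.

(** A block starts at each partial sum of the block sizes; the set of these sums
    is symmetric, which gives the symmetry of the shape. *)
Lemma shapeP i j :
  reflect (exists2 t, (t <= size sh)%N & (i < sumn (take t sh) <= j)%N) (shape i j).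
Proof.
have iS : (i < sumn sh)%N by rewrite sumn_block_sizes.
have jS : (j < sumn sh)%N by rewrite sumn_block_sizes.
rewrite /shape; apply: (iffP idP) => [ij|[t ts /andP[it tj]]].
  exists (block r j); first by rewrite ltnW // reshape_indexP.
  have js : (block r j <= size sh)%N by rewrite ltnW // reshape_indexP.
  by rewrite ltnNge -(leq_reshape_index iS js) -ltnNge ij /= -leq_reshape_index.
move: it tj; rewrite ltnNge -!leq_reshape_index // -ltnNge; exact: leq_trans.
Qed.

Lemma block_leq i j : (i <= j)%N -> (block r i <= block r j)%N.
Proof.
move=> ij; have iS : (i < sumn sh)%N by rewrite sumn_block_sizes.
have jS : (j < sumn sh)%N by rewrite sumn_block_sizes.
have bs : (block r i <= size sh)%N by rewrite ltnW // reshape_indexP.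
by rewrite /block leq_reshape_index // (leq_trans _ ij) // -leq_reshape_index.
Qed.

Lemma shape_mono i j i' j' : shape i j -> (i' <= i)%N -> (j <= j')%N -> shape i' j'.
Proof.
by move=> ij ii jj; apply: leq_ltn_trans (block_leq ii) (leq_trans ij (block_leq jj)).
Qed.

Lemma shape_lt i j : shape i j -> (i < j)%N.
Proof. by rewrite /shape !ltnNge; apply: contra; apply: block_leq. Qed.

Lemma rev_block_sizes : rev sh = sh.
Proof. by rewrite /block_sizes rev_cat rev_cons revK -cats1 -catA. Qed.

Lemma shape_neg i j : shape i j -> shape (neg j) (neg i).
Proof.
case/shapeP => t ts /andP[it tj]; apply/shapeP; exists (size sh - t)%N;
  first exact: leq_subr.
have E : (sumn (take t sh) + sumn (take (size sh - t) sh) = dimG c n)%N.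
  rewrite -{3}rev_block_sizes take_rev subKn // sumn_rev -sumn_cat cat_take_drop.
  exact: sumn_block_sizes.
by rewrite !val_neg; have := ltn_ord i; have := ltn_ord j; lia.
Qed.

Lemma shape_negE i j : shape (neg j) (neg i) = shape i j.
Proof. by apply/idP/idP => /shape_neg; rewrite ?negK. Qed.

Definition central a : bool := (Rsum r <= a < dimG c n - Rsum r)%N.

Lemma central_neg a : central (neg a) = central a.
Proof.
rewrite /central /Rsum val_neg; have := ltn_ord a; have := dimGE c n.
by move=> D la; apply/idP/idP => /andP[h1 h2]; apply/andP; split; lia.
Qed.

Lemma central_shape i j : central i -> central j -> ~~ shape i j.
Proof.
move=> /andP[Ri _] /andP[_ jR]; apply/shapeP => -[t ts /andP[it tj]].
have RE : sumn (take (size r) sh) = sumn r by rewrite /block_sizes take_size_cat.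
case: (leqP t (size r)) => tr.
  by have := sumn_take_leq sh tr; rewrite RE; move: Ri; rewrite /Rsum; lia.
have := sumn_take_leq sh tr; have -> : sumn (take (size r).+1 sh) = (dimG c n - sumn r)%N.
  rewrite /block_sizes -cat_rcons take_size_cat ?size_rcons // sumn_rcons.
  by have := dimGE c n; lia.
by move: jR; rewrite /Rsum; lia.
Qed.

Lemma shape_central i j : shape i j -> central i -> (dimG c n - Rsum r <= j)%N.
Proof.
move=> sij ci; rewrite leqNgt; apply/negP=> jR.
have cj : central j.
  by rewrite /central jR andbT; have := shape_lt sij; case/andP: ci => h _; move: h; lia.
by have := central_shape ci cj; rewrite sij.
Qed.

Lemma leq_Rsum_dimG : (Rsum r <= dimG c n - Rsum r)%N.
Proof. by have := dimGE c n; move: r_le; rewrite /Rsum; lia. Qed.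

Lemma neg_lt_Rsum a : (neg a < Rsum r)%N = (dimG c n - Rsum r <= a)%N.
Proof. by rewrite val_neg; have := ltn_ord a; have := leq_Rsum_dimG; lia. Qed.

Lemma leave_nonpos a : (dimG c n - Rsum r <= a)%N -> (neg a < a)%N.
Proof.
by rewrite -neg_lt_Rsum => na; have := leq_Rsum_dimG; move: na; rewrite val_neg; lia.
Qed.

End Blocks.

Section LieAlgebra.
Variables (K : fieldType) (c : classical) (n : nat).
Hypothesis K2 : 2%:R != 0 :> K.
Notation ix := (idx c n).
Implicit Types (i j a b p q : ix) (x g : 'M[K]_(dimG c n)).

(** The sign of the nonzero entry of the Gram matrix in row [a]. *)
Definition gsign a : K := if is_symp c && ~~ is_pos a then -1 else 1.

Lemma gsign_sqr a : gsign a * gsign a = 1.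
Proof. by rewrite /gsign; case: ifP => _; rewrite ?mulrNN mulr1. Qed.

Lemma gsign_orth a : ~~ is_symp c -> gsign a = 1.
Proof. by rewrite /gsign => /negPf->. Qed.

Lemma is_pos_neg a : is_symp c -> is_pos (neg a) = ~~ is_pos a.
Proof.
move=> cS; rewrite /is_pos val_neg; have := ltn_ord a; have := dimGE c n.
have -> : is_odd c = false by case: (c) cS.
by move=> D la; apply/idP/idP; lia.
Qed.

Lemma gsign_neg a : gsign (neg a) = if is_symp c then - gsign a else gsign a.
Proof.
rewrite /gsign; case cS: (is_symp c) => //=; rewrite is_pos_neg //.
by case: is_pos => //=; rewrite opprK.
Qed.

Lemma gramE i j : gram K c n i j = if j == neg i then gsign i else 0.
Proof. by rewrite mxE. Qed.

Lemma mul_gram x i j : (gram K c n *m x) i j = gsign i * x (neg i) j.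
Proof.
rewrite mxE (bigD1 (neg i)) //= gramE eqxx big1 ?addr0 // => k ki.
by rewrite gramE (negPf ki) mul0r.
Qed.

Lemma mulmx_gram x i j : (x *m gram K c n) i j = x i (neg j) * gsign (neg j).
Proof.
rewrite mxE (bigD1 (neg j)) //= gramE negK eqxx big1 ?addr0 // => k ki.
by rewrite gramE eq_sym -(inj_eq (@neg_inj c n)) negK (negPf ki) mulr0.
Qed.

Lemma in_lieGP x : reflect
  (forall p q, x (neg q) (neg p) = - (gsign p * gsign q * x p q)) (in_lieG x).
Proof.
apply: (iffP eqP) => [E p q|H].
  move/matrixP/(_ q (neg p)): E; rewrite mxE mulmx_gram mul_gram !mxE !negK.
  move=> /(congr1 (fun y => gsign q * y)); rewrite mulr0 mulrDr mulrA [X in _ + X]mulrA.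
  rewrite gsign_sqr mul1r => /eqP; rewrite addrC addr_eq0 => /eqP ->.
  by rewrite [gsign q * _ * _]mulrAC [gsign p * _]mulrC.
apply/matrixP=> q p; rewrite mxE mulmx_gram mul_gram !mxE.
have := H (neg p) q; rewrite negK => ->.
rewrite mulrN !mulrA [gsign q * gsign (neg p)]mulrC -[X in _ - X * _]mulrA gsign_sqr mulr1.
by rewrite mulrC subrr.
Qed.

Lemma root_mxE (w : rsym n) i j : rootlike c w ->
  root_mx K c w i j =
    (if (i, j) == refl (Epos c w) then 1 else 0) +
    (if (i, j) == Epos c w then
       (if refl (Epos c w) == Epos c w then 0
        else if is_symp c && is_pos (Epos c w).1 then 1 else -1) else 0).
Proof.
move=> wr; rewrite /root_mx; case E: (Epos c w) => [a b] /=; rewrite -!/(neg _) reflE.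
rewrite !mxE !xpair_eqE !negK; congr (_ + _); first by case: (_ && _).
case: ifP => _; first by rewrite mxE if_same.
by rewrite !mxE; case: ifP => _; case: (_ && _); rewrite ?mulr1 ?mulr0.
Qed.

Lemma root_mx_neq0 (w : rsym n) i j : rootlike c w ->
  (root_mx K c w i j != 0) = poseq (i, j) (Epos c w).
Proof.
move=> wr; rewrite root_mxE // /poseq; set p := (i, j).
case: (eqVneq p (refl (Epos c w))) => [->|]; case: (eqVneq _ (Epos c w)) => //=;
  rewrite ?addr0 ?add0r ?oner_eq0 ?eqxx //=.
move=> -> /negPf; rewrite eq_sym => ->.
by case: ifP; rewrite ?oppr_eq0 oner_eq0.
Qed.

Lemma root_mx_lie (w : rsym n) : pos_root c w -> in_lieG (root_mx K c w).
Proof.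
rewrite pos_root_at => /andP[wr orth]; apply/in_lieGP => p q.
rewrite !root_mxE //; have nE := Epos_normal wr;
  case E: (Epos c w) nE orth => [a b] nE orth /=.
move: nE; rewrite normalE => /andP[ba ab]; rewrite !reflE.
rewrite !xpair_eqE !(inj_eq (@neg_inj c n)).
rewrite -[neg q == a](inj_eq (@neg_inj c n)) -[neg p == b](inj_eq (@neg_inj c n)) !negK.
rewrite [(q == b) && _]andbC [(q == neg a) && _]andbC.
have bp : is_symp c -> is_pos (neg b).
  move=> cS; have D := dimGE c n; have co : is_odd c = false by case: (c) cS.
  by rewrite co in D; move: ba ab; rewrite /is_pos val_neg; have := ltn_ord b; lia.
have sab : is_symp c -> gsign a * gsign b = if is_pos a then -1 else 1.
  move=> cS; have bN : is_pos b = false by apply: negbTE; rewrite -is_pos_neg // bp.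
  rewrite /gsign cS bN /=; by case: is_pos; rewrite ?mulrNN ?mul1r ?mulr1.
case: (boolP ((p == neg b) && (q == neg a))) => [/andP[/eqP pb /eqP qa]|pq1].
  case: (boolP ((p == a) && (q == b))) => [/andP[/eqP pa /eqP qb]|pq2].
    rewrite pa qb in pb qa *; rewrite -pb -qa !eqxx /= addr0 mulr1.
    have cS : is_symp c by move: orth; rewrite /= -pb eqxx orbF.
    by rewrite sab // {1}pb bp // opprK.
  have ne : (neg b == a) && (neg a == b) = false.
    by apply: contraNF pq2 => /andP[/eqP nb /eqP na]; rewrite pb qa nb na !eqxx.
  rewrite ne add0r addr0 pb qa !gsign_neg; case cS: (is_symp c) => /=.
    by rewrite mulrNN mulr1 mulrC sab //; case: is_pos; rewrite ?opprK.
  by rewrite !gsign_orth ?cS // !mulr1.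
case: (boolP ((p == a) && (q == b))) => [/andP[/eqP pa /eqP qb]|pq2]; last first.
  by rewrite !addr0 mulr0 oppr0.
have ne : (neg b == a) && (neg a == b) = false.
  by apply: contraNF pq1 => /andP[/eqP nb /eqP na]; rewrite pa qb -nb -na !negK !eqxx.
rewrite ne addr0 add0r pa qb; case cS: (is_symp c) => /=.
  by rewrite sab //; case: is_pos; rewrite ?mulr1 ?mul1r ?opprK.
by rewrite !gsign_orth ?cS // !mul1r opprK.
Qed.

Section Roots.
Variables (r : seq nat).
Hypothesis r_le : (sumn r <= n)%N.

Lemma in_rootsM (w : rsym n) :
  (w \in rootsM K c n r) = pos_root c w && shape r (Epos c w).1 (Epos c w).2.
Proof.
rewrite inE /in_m; case: (boolP (pos_root c w)) => //= wp; rewrite root_mx_lie //=.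
have wr := pos_rootlike wp; apply/'forall_forallP/idP => [H|H i j].
  by have := implyP (H (Epos c w).1 (Epos c w).2); apply;
    rewrite root_mx_neq0 // -surjective_pairing poseq_refl.
apply/implyP; rewrite root_mx_neq0 // => /poseqP[e|e]; first by move: H; rewrite -e.
by rewrite -/(shape r i j) -shape_negE //; move: H; rewrite -[Epos c w]reflK -e.
Qed.

Lemma in_rootsR (w : rsym n) :
  (w \in rootsR K c n r) = pos_root c w && (block r (Epos c w).1 == block r (Epos c w).2).
Proof.
rewrite inE /in_r; case: (boolP (pos_root c w)) => //= wp; rewrite root_mx_lie //=.
have wr := pos_rootlike wp; apply/'forall_forallP/idP => [H|H i j].
  by have := implyP (H (Epos c w).1 (Epos c w).2); apply;
    rewrite root_mx_neq0 // -surjective_pairing poseq_refl.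
apply/implyP; rewrite root_mx_neq0 // => /poseqP[e|e]; first by move: H; rewrite -e.
have b1 (a b : ix) : (block r a == block r b) = ~~ shape r a b && ~~ shape r b a.
  by rewrite /shape -!leqNgt eqn_leq andbC.
move: H; rewrite b1 b1 -[Epos c w]reflK -e /= !shape_negE // andbC; exact: id.
Qed.

Lemma in_m_skew x : in_m r x ->
  forall p q, x (neg q) (neg p) = - (gsign p * gsign q * x p q).
Proof. by case/andP => /in_lieGP. Qed.

Lemma in_m_shape x i j : in_m r x -> x i j != 0 -> shape r i j.
Proof. by case/andP => _ /'forall_forallP /(_ i j) /implyP. Qed.

End Roots.

(** * The unipotent group *)

Lemma in_N_upper g : in_N g -> uppertri g.
Proof.
case/and3P => _ /forallP g1 /'forall_forallP gl; split=> [i|i j]; first exact/eqP.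
case: (ltngtP i j) => ij; [by right| |by left; apply: val_inj].
by have := gl i j; rewrite ij /= => ->.
Qed.

(** The inverse of an isometry, read off from the form. *)
Definition adjoint g : 'M[K]_(dimG c n) :=
  \matrix_(p, q) (gsign (neg p) * gsign (neg q) * g (neg q) (neg p)).

Lemma adjointE g : in_G g -> adjoint g *m g = 1%:M.
Proof.
move/eqP=> gG; apply/matrixP=> p j; rewrite !mxE.
have := congr1 (fun A : 'M[K]_(dimG c n) => A (neg p) j) gG; rewrite -mulmxA mxE.
under eq_bigr => k _ do rewrite mxE mul_gram.
rewrite (reindex_inj (@neg_inj c n)) gramE negK => E.
transitivity (gsign (neg p) * (if j == p then gsign (neg p) else 0)); last first.
  by rewrite eq_sym; case: eqP; rewrite ?gsign_sqr ?mulr0.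
rewrite -E big_distrr /=; apply: eq_bigr => k _; rewrite mxE negK -!mulrA; congr (_ * _).
exact: mulrCA.
Qed.

Lemma adjoint_upper g : in_N g -> uppertri (adjoint g).
Proof.
move=> gN; have [g1 gup] := in_N_upper gN; split=> [p|p q].
  by rewrite mxE g1 gsign_sqr mulr1.
rewrite mxE !mulf_eq0 !negb_or => /andP[_ /gup [/neg_inj->|]]; first by left.
by rewrite ltn_neg; right.
Qed.

Lemma in_N_G g : in_N g -> in_G g. Proof. by case/and3P. Qed.

Lemma invmx_adjoint g : in_G g -> invmx g = adjoint g.
Proof.
move/adjointE=> E; have [_ gu] := mulmx1_unit E.
by rewrite -[LHS]mul1mx -E -mulmxA mulmxV // mulmx1.
Qed.

Section Conj.
Variable r : seq nat.
Hypothesis r_le : (sumn r <= n)%N.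

Lemma in_m_conj g x : in_N g -> in_m r x -> in_m r (adjoint g *m x *m g).
Proof.
move=> gN xm; have gG := in_N_G gN; apply/andP; split.
  have gE : g^T *m gram K c n = gram K c n *m adjoint g.
    by rewrite -[LHS]mulmx1 -(mulmx1C (adjointE gG)) mulmxA (eqP gG).
  have gE' : (adjoint g)^T *m gram K c n = gram K c n *m g.
    have := congr1 trmx gE; rewrite !trmx_mul trmxK.
    have -> : (gram K c n)^T = (if is_symp c then -1 else 1) *: gram K c n.
      apply/matrixP=> i j; rewrite mxE [RHS]mxE !gramE.
      case: (eqVneq j (neg i)) => [->|ji].
        by rewrite negK eqxx gsign_neg; case: is_symp; rewrite ?mulN1r ?mul1r.
      by rewrite mulr0 eq_sym -(inj_eq (@neg_inj c n)) negK (negPf ji).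
    rewrite -scalemxAl -scalemxAr => /(congr1 (fun A => (if is_symp c then -1 else 1) *: A)).
    by rewrite !scalerA; case: is_symp; rewrite ?mulrNN !mulr1 !scale1r => ->.
  apply/eqP; rewrite !trmx_mul -!mulmxA gE'.
  rewrite !mulmxA -gE -!mulmxA -mulmxDr !mulmxA -mulmxDl.
  by case/andP: xm => /eqP ->; rewrite mul0mx mulmx0.
have [_ gup] := in_N_upper gN; have [_ hup] := adjoint_upper gN.
apply/'forall_forallP => i j; apply/implyP; apply: contraNT => nij.
rewrite mxE big1 // => l _; have [->|/gup lj] := eqVneq (g l j) 0; first by rewrite mulr0.
rewrite mxE big1 ?mul0r // => k _; have [->|/hup ik] := eqVneq (adjoint g i k) 0;
  first by rewrite mul0r.
have [->|/(in_m_shape xm) kl] := eqVneq (x k l) 0; first by rewrite mulr0.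
case/negP: nij; apply: (shape_mono r_le kl); first by case: ik => [<-|/ltnW].
by case: lj => [->|/ltnW].
Qed.

End Conj.

(** * The rook placement of a base *)

Section Base.
Variables (r : seq nat) (S : {set rsym n}).
Hypothesis r_le : (sumn r <= n)%N.
Hypothesis S_base : is_base K c r S.

Definition rookset : {set ix * ix} := [set t | [exists w in S, poseq t (Epos c w)]].
Notation T := rookset.

Lemma rooksetP t : reflect (exists2 w, w \in S & poseq t (Epos c w)) (t \in T).
Proof. by rewrite inE; apply: exists_inP. Qed.

Lemma base_rootsM w : w \in S -> w \in rootsM K c n r.
Proof. by case/and3P: S_base => /subsetP sS _ _; apply: sS. Qed.

Lemma base_rootlike w : w \in S -> rootlike c w.
Proof. by move/base_rootsM; rewrite in_rootsM // => /andP[/pos_rootlike]. Qed.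

Lemma Epos_rookset w : w \in S -> Epos c w \in T.
Proof. by move=> wS; apply/rooksetP; exists w => //; apply: poseq_refl. Qed.

Lemma rookset_sym i j : (i, j) \in T -> (neg j, neg i) \in T.
Proof.
case/rooksetP => x xS E; apply/rooksetP; exists x => //; move: E.
by rewrite ![poseq _ (Epos c x)]poseq_sym /poseq !reflE !negK orbC.
Qed.

Lemma poseq_shape (p q : ix * ix) : poseq p q -> shape r p.1 p.2 = shape r q.1 q.2.
Proof. by case/poseqP => -> //=; rewrite shape_negE. Qed.

Lemma rookset_shape i j : (i, j) \in T -> shape r i j.
Proof.
case/rooksetP => x /base_rootsM; rewrite in_rootsM // => /andP[_ sx] /poseq_shape /= -> //.
Qed.

(** Two rooks in one row would differ by a root, or by a formal element, hence be
    comparable. *)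
Lemma rookset_row i j k : (i, j) \in T -> (i, k) \in T -> j = k.
Proof.
wlog jk : j k / (j < k)%N.
  move=> W ij ik; case: (ltngtP j k) => jk; [exact: W|by apply/esym;
    apply: W|exact: val_inj].
move=> /rooksetP[x xS ex] /rooksetP[y yS ey]; exfalso.
case/and3P: S_base => _ /forall_inP /(_ _ xS) /forall_inP /(_ _ yS) + _.
rewrite negb_or => /andP[/negP + _]; apply.
have [d dr dE] := root_at jk; apply/existsP; exists d; rewrite -/(rootlike c d) dr /=.
rewrite (rvecE (base_rootlike yS)) (rvecE (base_rootlike xS)) (rvecE dr) -(evec_poseq ex) -(evec_poseq ey) (evec_poseq dE) /=.
by apply/eqP; rewrite opprB addrC addrA subrK.
Qed.

Lemma rookset_col i k j : (i, j) \in T -> (k, j) \in T -> i = k.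
Proof. by move=> /rookset_sym ij /rookset_sym kj; apply/neg_inj/(rookset_row ij kj). Qed.

Lemma rookset_skew : ~~ is_symp c -> forall i, (i, neg i) \notin T.
Proof.
move=> orth i; apply/rooksetP => -[x /base_rootsM];
  rewrite in_rootsM // pos_root_at (negPf orth) /=.
by move=> /andP[/andP[_ ne] _] /poseqP[e|];
  [|rewrite -[refl _ in X in _ = X]/(refl _) => /(congr1 (@refl c n));
    rewrite reflK reflE negK => e];
   move: ne; rewrite -e /= negK eqxx.
Qed.

(** The element of the base below a root arises from it by shortening its
    position from the right or from above, up to reflection. *)
Lemma rookset_base i j : shape r i j -> ~~ (~~ is_symp c && (j == neg i)) ->
  (i, j) \notin T ->
  (exists2 k : ix, (k <= j)%N & (i, k) \in T) \/
  (exists2 k : ix, (i <= k)%N & (k, j) \in T).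
Proof.
move=> sij nsk ijT; have [g gr gE] := root_at (shape_lt r_le sij).
have gM : g \in rootsM K c n r.
  rewrite in_rootsM // (poseq_shape gE) sij andbT pos_root_at gr /=.
  case cS: (is_symp c) nsk => //=; apply: contra => /eqP e.
  case/poseqP: gE e => -> e; first by rewrite (e : i = neg j) negK.
  by rewrite (neg_inj (e : neg j = neg (neg i))).
have gS : g \notin S.
  by apply: contra ijT => gS; apply/rooksetP; exists g; rewrite // poseq_sym.
case/and3P: S_base => _ _ /forall_inP /(_ g);
  rewrite inE gS gM => /(_ isT) /exists_inP[x xS].
case/existsP => d /andP[dr /eqP E]; rewrite -/(rootlike c d) in dr.
move/eqP: E; rewrite subr_eq addrC => /eqP E.
move: E; rewrite (rvecE gr) (rvecE (base_rootlike xS)) (rvecE dr) (evec_poseq gE) /=.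
have xT := Epos_rookset xS.
have /andP[_ xlt] := Epos_normal (base_rootlike xS); have /andP[_ dlt] := Epos_normal dr.
case: (Epos c x) xT xlt => k l klT /= kl; case: (Epos c d) dlt => s t /= st.
have ne (a b : ix) : (a < b)%N -> a != b by move=> ab; apply: contraTneq ab => ->;
  rewrite ltnn.
move/evec_diff4 => /(_ (ne _ _ (shape_lt r_le sij)) (ne _ _ kl) (ne _ _ st)) [s' [t' [st']]].
have {}st' : (s' < t')%N.
  by case/poseqP: st' => [[-> ->]//|]; rewrite reflE => -[-> ->]; rewrite ltn_neg.
case=> -[e /poseqP[]]; rewrite ?reflE => -[-> ->]; subst.
- by left; exists s'; rewrite // ltnW.
- by right; exists (neg s'); [rewrite leq_neg ltnW|apply: rookset_sym].
- by right; exists t'; rewrite // ltnW.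
by left; exists (neg t'); [rewrite leq_neg ltnW|apply: rookset_sym].
Qed.

Lemma in_m_rook_bounded x : in_m r x -> rook_bounded T x.
Proof.
move=> xm; apply: (@nilradical_rook_bounded _ _ _ (shape r) (~~ is_symp c)).
- exact: rookset_sym.
- exact: shape_mono.
- exact: rookset_base.
- exact: rookset_skew.
- by move=> i j; apply: in_m_shape.
- by move=> orth i j; rewrite -!/(neg _) (in_m_skew xm) !gsign_orth // !mul1r.
exact: K2.
Qed.

(** Within one block of columns the rooks climb from left to right, except
    across the antidiagonal of an orthogonal group. *)
Lemma rookset_block_col (p u v : ix) : (p, u) \in T -> ~~ shape r u v ->
  ~~ shape r (neg u) u || (neg u <= p)%N ->
  forall t, t \in T -> (p < t.1)%N -> (t.2 <= v)%N -> (t.2 <= u)%N.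
Proof.
move=> puT uv side [a b] abT /= pa bv; rewrite leqNgt; apply/negP=> ub.
have bu : (block r b <= block r u)%N.
  by apply: leq_trans (block_leq r_le bv) _; rewrite leqNgt.
(* The position [(a, u)] lies in the nilradical, but a rook to its left would
   share the row of [(a, b)], and one below it the column of [(p, u)]. *)
have sau : shape r a u by apply: leq_trans (rookset_shape abT) bu.
have auT : (a, u) \notin T.
  by apply/negP=> auT; move: ub; rewrite (rookset_row abT auT) ltnn.
have nsk : ~~ (~~ is_symp c && (u == neg a)).
  apply: contraL pa => /andP[_ /eqP e]; rewrite -leqNgt.
  by move: side; rewrite e negK -e sau.
case: (rookset_base sau nsk auT) => -[k ku kT].
  by have := rookset_row kT abT; move=> e; move: ub; rewrite -e ltnNge ku.
by have := rookset_col kT puT => e; move: ku; rewrite e leqNgt pa.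
Qed.

Lemma rookset_block_row (u v q : ix) : (v, q) \in T -> ~~ shape r u v ->
  ~~ shape r v (neg v) || (v <= neg q)%N ->
  forall t, t \in T -> (t.2 < q)%N -> (u <= t.1)%N -> (v <= t.1)%N.
Proof.
move=> vqT uv side [a b] /rookset_sym abT /= bq ua.
have := @rookset_block_col _ _ (neg u) (rookset_sym vqT).
rewrite negK shape_negE // => /(_ uv side _ abT) /=; rewrite ltn_neg !leq_neg.
by apply.
Qed.

End Base.

End LieAlgebra.


(** * The minors of the generic matrix *)

Lemma setminor_map (R R' : comNzRingType) (f : {rmorphism R -> R'}) m
    (x : 'M[R]_m) (I J : {set 'I_m}) :
  setminor (map_mx f x) I J = f (setminor x I J).
Proof.
by rewrite /setminor -det_map_mx; congr (\det _); apply/matrixP=> i j; rewrite !mxE.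
Qed.

Lemma antitr_map (R R' : nzRingType) (f : R -> R') m (x : 'M[R]_m) :
  antitr (map_mx f x) = map_mx f (antitr x).
Proof. by apply/matrixP=> i j; rewrite !mxE. Qed.

Section Generic.
Variables (K : fieldType) (c : classical) (n : nat) (r : seq nat) (S : {set rsym n}).
Hypothesis K2 : 2%:R != 0 :> K.
Hypothesis r_le : (sumn r <= n)%N.
Hypothesis S_base : is_base K c r S.
Notation ix := (idx c n).
Notation T := (rookset c S).
Notation polM := {mpoly K[#|rootsM K c n r|]}.
Notation X := (bbX K c n r).
Implicit Types (i j a b : ix) (w g : rsym n).


Let T_row := rookset_row K2 r_le S_base.
Let T_col := rookset_col K2 r_le S_base.

(** The rooks inside the corner of [g] come from the base elements below [g]; the
    reflected ones are those listed with the extra condition in [setA]. *)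
Lemma rooks_below g t : rootlike c g ->
  (t \in T) && ((Ea c g < t.1)%N && (t.2 < (Epos c g).2)%N) =
  [exists x in below c S g, (t == Epos c x) || ((Ea c g < Eb c x)%N && (t == refl (Epos c x)))].
Proof.
move=> gr; have /andP[g1 g2] := Epos_normal gr.
apply/andP/exists_inP => [[/rooksetP[x xS /poseqP[tE|tE]] /andP[l1 l2]]|[x]].
- by exists x; rewrite -?tE ?eqxx // inE xS {2}/Ea -tE l1 l2.
- have /andP[x1 _] := Epos_normal (base_rootlike K2 r_le S_base xS).
  rewrite tE /refl in l1 l2.
  have l3 : (Ea c g < Eb c x)%N := l1; exists x; last by rewrite tE eqxx l3 orbT.
  rewrite inE xS /= (leq_trans l3 x1) /= -ltn_neg.
  exact: leq_ltn_trans g1 l3.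
rewrite inE => /and3P[xS l1 l2] /orP[/eqP->|/andP[l3 /eqP->]].
  by rewrite Epos_rookset // l1 l2.
have xT : refl (Epos c x) \in T by apply: rookset_sym;
  rewrite -surjective_pairing Epos_rookset.
split=> //; apply/andP; split=> //.
by rewrite /refl [X in (nat_of_ord X < _)%N]/= -ltn_neg negK; apply: leq_ltn_trans g1 l1.
Qed.

Lemma setA_rowset g : rootlike c g -> setA c S g = rowset T (Epos c g).1 (Epos c g).2.
Proof.
move=> gr; apply/setP=> i; rewrite /setA -setUA in_setU in_setU in_setU1 in_set1;
  congr (_ || _).
apply/orP/imsetP => [[]/imsetP[x]|[t]].
- move=> xb ->; exists (Epos c x) => //; rewrite inE rooks_below //.
  by apply/exists_inP; exists x; rewrite ?eqxx.
- rewrite inE => /andP[xb l3] ->; exists (refl (Epos c x)) => //;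
    rewrite inE rooks_below //.
  by apply/exists_inP; exists x; rewrite ?eqxx ?l3 ?orbT.
rewrite inE rooks_below // => /exists_inP[x xb /orP[/eqP->|/andP[l3 /eqP->]]] ->;
  [left|right].
  by apply/imsetP; exists x.
by apply/imsetP; exists x; rewrite // inE xb l3.
Qed.

Lemma setB_colset g : rootlike c g ->
  [set neg b | b in setB c S g] = colset T (Epos c g).1 (Epos c g).2.
Proof.
move=> gr; apply/setP=> i; rewrite /setB -setUA setUCA -[i in LHS]negK mem_imset;
  last exact: neg_inj.
rewrite in_setU in_setU in_setU1 in_set1; congr (_ || _).
  by rewrite /Eb (inj_eq (@neg_inj c n)).
apply/orP/imsetP => [[]/imsetP[x]|[t]].
- move=> xb /neg_inj->; exists (Epos c x) => //; rewrite inE rooks_below //.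
  by apply/exists_inP; exists x; rewrite ?eqxx.
- rewrite inE => /andP[xb l3] E; exists (refl (Epos c x)) => //.
    rewrite inE rooks_below //.
    by apply/exists_inP; exists x; rewrite ?eqxx ?l3 ?orbT.
  by apply: neg_inj; rewrite E negK.
rewrite inE rooks_below // => /exists_inP[x xb /orP[/eqP->|/andP[l3 /eqP->]]] ->;
  [left|right].
  by apply/imsetP; exists x.
by apply/imsetP; exists x; rewrite ?negK // inE xb l3.
Qed.

Lemma Mbar_hookminor g : rootlike c g ->
  Mbar K c r S g = hookminor T X (Epos c g).1 (Epos c g).2.
Proof. by move=> gr; rewrite /Mbar setB_colset // setA_rowset. Qed.

(** The two minors of a root are reflections of each other, so [Mminor] is a
    minor of the reflected generic matrix at the position of the root. *)
Lemma Mminor_hookminor g : rootlike c g ->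
  Mminor K c r S g = hookminor T (antitr X) (Epos c g).1 (Epos c g).2.
Proof.
move=> gr; rewrite /hookminor setminor_antitr; last first.
  exact: (card_rowset_colset T_col T_row).
rewrite -setA_rowset // -setB_colset // -[@rev_ord (dimG c n)]/(@neg c n).
have -> : [set neg j | j in [set neg b | b in setB c S g]] = setB c S g.
  by rewrite -imset_comp (eq_imset _ (@negK c n)) imset_id.
by [].
Qed.

Lemma hookminor_map (R R' : comNzRingType) (f : {rmorphism R -> R'})
    (x : 'M[R]_(dimG c n)) p s :
  hookminor T (map_mx f x) p s = f (hookminor T x p s).
Proof. exact: setminor_map. Qed.

Lemma rootsM_rootlike g : g \in rootsM K c n r -> rootlike c g.
Proof. by rewrite in_rootsM // => /andP[/pos_rootlike]. Qed.

Lemma bbX_antitr : ~~ is_symp c -> antitr X = - X.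
Proof.
move=> orth; apply/matrixP=> i j; rewrite !mxE -sumrN; apply: eq_bigr => v _.
have := enum_valP v; rewrite in_rootsM // => /andP[/(root_mx_lie K2) /in_lieGP H _].
by rewrite -!/(neg _) H !gsign_orth // !mul1r scaleNr.
Qed.

Lemma bbX_eval (y : 'M[K]_(dimG c n)) : in_m r y ->
  map_mx (meval (fun v : 'I_#|rootsM K c n r| =>
     y (neg (Epos c (enum_val v)).2) (neg (Epos c (enum_val v)).1))) X = y.
Proof.
move=> ym; apply/matrixP=> i j; rewrite !mxE rmorph_sum /=.
under eq_bigr => v _ do rewrite mevalZ mevalXU.
have skew := in_m_skew ym.
case: (pickP (fun w => (w \in rootsM K c n r) && poseq (i, j) (Epos c w))) => [w /andP[wM wE]|now].
  have wr := rootsM_rootlike wM.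
  rewrite (bigD1 (enum_rank_in wM w)) //= enum_rankK_in // big1 ?addr0 => [|v vw];
    last first.
    have vr := rootsM_rootlike (enum_valP v).
    case: (eqVneq (root_mx K c (enum_val v) i j) 0) => [->|]; first by rewrite mul0r.
    rewrite root_mx_neq0 // => vE; case/negP: vw.
    rewrite -(inj_eq enum_val_inj) enum_rankK_in //; apply/eqP/(Epos_inj vr wr).
    apply: normal_poseq; try exact: Epos_normal.
    by apply: poseq_trans wE; rewrite poseq_sym.
  have one : root_mx K c w (neg (Epos c w).2) (neg (Epos c w).1) = 1.
    rewrite root_mxE // -reflE -surjective_pairing eqxx.
    by case: (eqVneq (refl (Epos c w)) (Epos c w)) => _; rewrite ?addr0.
  case/poseqP: wE => [e|]; last first.
    by rewrite {1}[Epos c w]surjective_pairing reflE => -[-> ->]; rewrite one mul1r.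
  have wl : in_lieG (root_mx K c w) by apply: root_mx_lie => //; move: wM;
    rewrite in_rootsM // => /andP[].
  have := in_lieGP _ wl i j; have := skew i j.
  move: one; rewrite -e /= => -> -> /esym/eqP; rewrite eqr_oppLR => /eqP s1.
  by rewrite mulrN mulrA [root_mx _ _ _ _ _ * _]mulrC s1 mulN1r opprK.
rewrite big1 => [|v _]; last first.
  case: (eqVneq (root_mx K c (enum_val v) i j) 0) => [->|]; first by rewrite mul0r.
  rewrite root_mx_neq0 ?rootsM_rootlike ?enum_valP // => vE.
  by have := now (enum_val v); rewrite enum_valP vE.
apply/esym/eqP; apply: contraT => yij; have sij := in_m_shape ym yij.
have [g gr gE] := root_at (shape_lt r_le sij); have := now g.
rewrite poseq_sym gE andbT in_rootsM // (poseq_shape r_le gE) sij andbT pos_root_at gr /=.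
case cS: (is_symp c) => //= /negbT; rewrite negbK => /eqP e.
have ij : i = neg j by case/poseqP: gE e => -> e;
  [exact: e|rewrite (e : neg j = neg (neg i)) negK].
have := skew i j; rewrite ij negK !gsign_orth ?cS // !mul1r => /eqP.
rewrite -subr_eq0 opprK -mulr2n -mulr_natl mulf_eq0 (negPf K2) /=.
by rewrite -ij (negPf yij).
Qed.

End Generic.


(** * The polynomials of admissible pairs *)

Section Pairs.
Variables (K : fieldType) (c : classical) (n : nat) (r : seq nat) (S : {set rsym n}).
Hypothesis K2 : 2%:R != 0 :> K.
Hypothesis r_le : (sumn r <= n)%N.
Hypothesis S_base : is_base K c r S.
Notation ix := (idx c n).
Notation T := (rookset c S).
Notation polM := {mpoly K[#|rootsM K c n r|]}.
Notation X := (bbX K c n r).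
Implicit Types (i j a b : ix) (w g : rsym n) (q : rsym n * rsym n).

Definition both_right q := right_of_center c r q.1 && right_of_center c r q.2.

(** The left rook of a pair, placed so that its column lies in the block of
    the row of the right rook. *)
Definition left_rook q : ix * ix :=
  if both_right q then refl (Epos c q.1) else Epos c q.1.
Definition left_row q := (left_rook q).1.
Definition left_col q := (left_rook q).2.
Definition right_row q : ix := (Epos c q.2).1.
Definition right_col q : ix := (Epos c q.2).2.

Lemma central_Epos w : w \in S -> central r (Epos c w).1 ->
  (dimG c n - Rsum r <= (Epos c w).2)%N.
Proof.
move=> wS; apply: shape_central => //.
by apply: (rookset_shape K2 r_le S_base); rewrite -surjective_pairing Epos_rookset.
Qed.

(** The sum of two consecutive characters of the central block is a root of the
    reductive part; so [tail_doubles] contains all elements [2 eps_i] of the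
    central block. *)
Lemma kmax_le : (kmax K c n r <= Rsum r)%N.
Proof.
clear S_base.
apply/bigmax_leqP => i /existsP[j /andP[/eqP ji]]; rewrite in_rootsM // => /andP[_ /= sh].
rewrite ltnNge; apply/negP=> Ri; move: sh; apply/negP/central_shape => //.
- rewrite /central /= ji (leq_trans Ri) //=.
  by have := ltn_ord j; have := dimGE c n; move: r_le; rewrite /Rsum; lia.
rewrite central_neg // /central /= Ri /=.
by have := ltn_ord i; have := dimGE c n; move: r_le; rewrite /Rsum; lia.
Qed.

Lemma GammaR_rootlike d : d \in GammaR K c n r :|: rootsR K c n r -> rootlike c d.
Proof.
have tail : d \in tail_doubles K c n r -> rootlike c d.
  by case/imsetP => i _ ->; rewrite rootlikeE.
have rr : d \in rootsR K c n r -> rootlike c d.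
  by rewrite in_rootsR // => /andP[/pos_rootlike].
rewrite in_setU => /orP[|/rr//]; rewrite /GammaR; case: is_symp.
  by rewrite in_setD => /andP[_ /rr].
by rewrite in_setU => /orP[/rr|/tail].
Qed.

(** What is used of an admissible pair: two rooks [(p, u)] and [(v, s)] with [u]
    before [v] in one block, which is central exactly when both roots lie to the
    right of the central block. *)
Record admissible_spec q (d : rsym n) : Prop := AdmissibleSpec {
  adm_left : (left_row q, left_col q) \in T;
  adm_right : (right_row q, right_col q) \in T;
  adm_alpha : alpha K c r q = Some d;
  adm_left_root : rootlike c q.1;
  adm_right_root : rootlike c q.2;
  adm_root : rootlike c d;
  adm_pos : Epos c d = (left_col q, right_row q);
  adm_lt : (left_col q < right_row q)%N;
  adm_order : both_right q -> (neg (left_col q) <= right_row q)%N;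
  adm_block : ~~ shape r (left_col q) (right_row q);
  adm_cases :
    if both_right q then
      [/\ central r (left_col q), central r (right_row q), (left_row q < Rsum r)%N,
          (dimG c n - Rsum r <= right_col q)%N &
          is_symp c -> right_row q != neg (left_col q)]
    else (neg (left_col q) <= left_row q)%N && (dimG c n - Rsum r <= left_col q)%N }.

Lemma admissible q : q \in pairsQ K c r S -> exists d, admissible_spec q d.
Proof.
rewrite inE => /and4P[xS x'S le_aa]; have xr := base_rootlike K2 r_le S_base xS.
have x'r := base_rootlike K2 r_le S_base x'S.
have xT := Epos_rookset c xS; have x'T := Epos_rookset c x'S.
have x'T' : (right_row q, right_col q) \in T by rewrite -surjective_pairing.
have /andP[xn1 xn2] := Epos_normal xr; have /andP[x'n1 x'n2] := Epos_normal x'r.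
case E: (alpha K c r q) => [d|] // _; exists d; move: E.
rewrite /alpha -/(both_right q); case qr: (both_right q);
  case: pickP => // d' /andP[dG /eqP dE] [dd];
  rewrite {d'}dd in dG dE.
- have dr : rootlike c d by apply: GammaR_rootlike; rewrite in_setU dG.
  have lr : left_rook q = refl (Epos c q.1) by rewrite /left_rook qr.
  have lc : left_col q = neg (Ea c q.1) by rewrite /left_col lr.
  have lw : left_row q = neg (Epos c q.1).2 by rewrite /left_row lr.
  case/andP: (qr) => ca ca'; have cu : central r (left_col q) by rewrite lc central_neg.
  have lt : (left_col q < right_row q)%N.
    by have /andP[_] := Epos_normal dr; rewrite dE lc.
  constructor => //.
  + by rewrite -surjective_pairing lr; apply: rookset_sym; rewrite -surjective_pairing.
  + rewrite /alpha -/(both_right q) qr; case: pickP => [d'' /andP[d''G /eqP d''E]|/(_ d)].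
      congr Some; apply: (@Epos_inj c) => //; last by rewrite d''E dE.
      by apply: GammaR_rootlike; rewrite in_setU d''G.
    by rewrite dG dE eqxx.
  + by rewrite dE lc.
  + by rewrite lc negK.
  + exact: central_shape.
  rewrite qr; split=> //.
  + by rewrite lw (neg_lt_Rsum r_le); apply: central_Epos.
  + exact: central_Epos.
  move=> cS; apply/negP=> /eqP e; move: dG;
    rewrite /GammaR cS in_setD => /andP[/negP tl _]; apply: tl.
  have [i dD uE] : exists2 i : 'I_n, d = Dbl i & neg (Ea c q.1) = posidx c i.
    apply: antidiagonal_root => //; rewrite dE -lc; congr (_, _); exact: e.
  apply/imsetP; exists i => //; rewrite inE ltnS (leq_trans kmax_le) //.
  by case/andP: cu; rewrite lc uE.
have lr : left_rook q = Epos c q.1 by rewrite /left_rook qr.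
have lc : left_col q = (Epos c q.1).2 by rewrite /left_col lr.
have lw : left_row q = (Epos c q.1).1 by rewrite /left_row lr.
have {}dE : Epos c d = (left_col q, right_row q) by rewrite dE lc negK.
move: (dG); rewrite in_rootsR // => /andP[/pos_rootlike dr]; rewrite dE /= => db.
have lt : (left_col q < right_row q)%N by have /andP[_] := Epos_normal dr; rewrite dE.
constructor => //.
- by rewrite lc lw -surjective_pairing.
- rewrite /alpha -/(both_right q) qr; case: pickP => [d'' /andP[d''G /eqP d''E]|/(_ d)].
    congr Some; apply: (@Epos_inj c) => //; first by apply: GammaR_rootlike;
      rewrite in_setU d''G orbT.
    by rewrite d''E dE lc negK.
  by rewrite dG dE lc negK eqxx.
- by rewrite qr.
- by rewrite /shape (eqP db) ltnn.
rewrite qr lc lw xn1 /= leqNgt; apply/negP=> bR.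
have sx : shape r (Epos c q.1).1 (Epos c q.1).2.
  by apply: (rookset_shape K2 r_le S_base); rewrite -surjective_pairing.
have xlt := shape_lt r_le sx.
have cb : central r (Epos c q.1).2.
  rewrite -central_neg // /central leqNgt (neg_lt_Rsum r_le) -ltnNge bR /=.
  exact: leq_ltn_trans xn1 (ltn_trans xn2 bR).
have ca : central r (Epos c q.1).1.
  by move: cb; rewrite -central_neg // => /andP[Rb _];
    rewrite /central (leq_trans Rb xn1) (ltn_trans xn2 bR).
by move: sx; apply/negP/central_shape.
Qed.

End Pairs.


Section PairSum.
Variables (K : fieldType) (c : classical) (n : nat) (r : seq nat) (S : {set rsym n}).
Hypothesis K2 : 2%:R != 0 :> K.
Hypothesis r_le : (sumn r <= n)%N.
Hypothesis S_base : is_base K c r S.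
Notation ix := (idx c n).
Notation T := (rookset c S).
Notation X := (bbX K c n r).
Implicit Types (i j a b e : ix) (w g d : rsym n) (q : rsym n * rsym n).

(** On the diagonal, [None] stands for the summand 0 of a decomposition. *)
Definition link i j : option (rsym n) :=
  [pick g | rootlike c g && poseq (Epos c g) (i, j)].

Lemma rootlike_uniq g g' : rootlike c g -> rootlike c g' ->
  poseq (Epos c g) (Epos c g') -> g = g'.
Proof.
by move=> gr g'r /evec_poseq E; apply: (@rvec_inj c) => //; rewrite !(@rvecE c) //.
Qed.

Lemma linkE g i j : rootlike c g -> poseq (Epos c g) (i, j) -> link i j = Some g.
Proof.
move=> gr gE; rewrite /link; case: pickP => [g' /andP[g'r g'E]|/(_ g)];
  last by rewrite gr gE.
by congr Some; apply: rootlike_uniq => //; apply: poseq_trans g'E _; rewrite poseq_sym.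
Qed.

Lemma link_self i : link i i = None.
Proof.
rewrite /link; case: pickP => // g /andP[gr /poseqP gE].
by have /andP[_] := Epos_normal gr; case: gE => ->; rewrite ?reflE /= ltnn.
Qed.

Lemma link_some i j : (i < j)%N ->
  exists g, [/\ rootlike c g, poseq (Epos c g) (i, j) & link i j = Some g].
Proof. by move=> ij; have [g gr gE] := root_at ij; exists g; split=> //; apply: linkE. Qed.

Lemma ovec_link i j : (i <= j)%N -> ovec (link i j) = evec i - evec j.
Proof.
rewrite leq_eqVlt => /orP[/eqP/val_inj->|/link_some[g [gr gE ->]]].
  by rewrite link_self /= subrr.
by rewrite /= (rvecE gr) (evec_poseq gE).
Qed.

(** Two indices of one block are joined by a root of the reductive part, except in
    opposite positions of the central block of an orthogonal group, where a
    formal element joins them. *)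
Lemma link_Gamma0 i j : (i <= j)%N -> ~~ shape r i j ->
  (central r i && central r j) || (dimG c n - Rsum r <= i)%N ->
  link i j \in Gamma0 K c n r.
Proof.
rewrite leq_eqVlt => /orP[/eqP/val_inj->|ij] sij cen.
  by rewrite link_self in_setU1 eqxx.
have [g [gr gE ->]] := link_some ij; rewrite in_setU1 /= mem_imset; last by move=> ? ? [].
have bE : block r (Epos c g).1 == block r (Epos c g).2.
  have /andP[_ glt] := Epos_normal gr; rewrite eqn_leq; apply/andP; split.
    by apply: block_leq => //; apply: ltnW.
  by rewrite leqNgt; move: sij; rewrite -(poseq_shape r_le gE).
rewrite in_setU in_rootsR // bE andbT; case: (boolP (pos_root c g)) => gp;
  first by rewrite orbT.
rewrite orbF /GammaR; move: gp; rewrite pos_root_at gr /=.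
case cS: (is_symp c) => //=; rewrite negbK => /eqP ge.
have [k gD kE] : exists2 k : 'I_n, g = Dbl k & (Epos c g).1 = posidx c k.
  have gE2 : Epos c g = ((Epos c g).1, neg (Epos c g).1).
    by rewrite {1}[Epos c g]surjective_pairing; congr (_, _); rewrite ge negK.
  exact: antidiagonal_root gr gE2.
rewrite in_setU; apply/orP; right; apply/imsetP; exists k => //.
have ki : i = posidx c k.
  rewrite -kE; case/poseqP: gE ge => -> // e; rewrite [RHS]e; exact: esym (negK _).
rewrite inE ltnS (leq_trans (kmax_le c K2 r_le)) //.
case/orP: cen => [/andP[/andP[+ _] _]|]; first by rewrite ki.
move/(leave_nonpos r_le); rewrite ki val_neg /=; have := ltn_ord k; have := dimGE c n.
by move=> D kn l; exfalso; lia.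
Qed.

Lemma Gamma0_rootlike d : Some d \in Gamma0 K c n r -> rootlike c d.
Proof.
by rewrite in_setU1 /= mem_imset; [apply: GammaR_rootlike|move=> ? ? []].
Qed.

Section Pair.
Variables (q : rsym n * rsym n) (d : rsym n).
Hypothesis ad : admissible_spec K c r S q d.
Notation p := (left_row c r q : ix).
Notation u := (left_col c r q : ix).
Notation v := (right_row c q : ix).
Notation s := (right_col c q : ix).

Let uv : (u < v)%N := adm_lt ad.

Lemma pu_lt : (p < u)%N.
Proof. exact: (shape_lt r_le (rookset_shape K2 r_le S_base (adm_left ad))). Qed.
Lemma vs_lt : (v < s)%N.
Proof. exact: (shape_lt r_le (rookset_shape K2 r_le S_base (adm_right ad))). Qed.

(** The default [d] is used on and below the diagonal only. *)
Definition rootat i j := odflt d (link i j).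

Lemma rootatP i j : (i < j)%N -> rootlike c (rootat i j) /\ poseq (Epos c (rootat i j)) (i, j).
Proof. by case/link_some => g [gr gE lE]; rewrite /rootat lE. Qed.

Lemma rootat_M i j : shape r i j -> (~~ is_symp c -> j != neg i) ->
  rootat i j \in rootsM K c n r.
Proof.
move=> sij orth; have [gr gE] := rootatP (shape_lt r_le sij).
rewrite in_rootsM // (poseq_shape r_le gE) sij andbT pos_root_at gr /=.
case: (is_symp c) orth => //= /(_ isT); apply: contra => /eqP e.
by apply/eqP; case/poseqP: gE e => -> e; [rewrite (e : i = neg j) negK|apply: neg_inj].
Qed.

Lemma pair_side : ~~ shape r (neg u) u || (neg u <= p)%N.
Proof.
have := adm_cases ad; case: both_right => [[cu _ _ _ _]|/andP[-> _]]; last by rewrite orbT.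
by rewrite central_shape // central_neg.
Qed.

Lemma pair_side' : ~~ shape r v (neg v) || (v <= neg s)%N.
Proof.
have := adm_cases ad; case: both_right => [[_ cv _ _ _]|/andP[_ Ru]].
  by rewrite central_shape // central_neg.
apply/orP; left; apply/negP => /(shape_lt r_le); apply/negP; rewrite -leqNgt ltnW //.
by apply: leave_nonpos r_le _ _; apply: leq_trans Ru (ltnW uv).
Qed.

Lemma left_pos e : (u <= e <= v)%N -> shape r p e /\ (~~ is_symp c -> e != neg p).
Proof.
move=> /andP[ue ev].
have spu := rookset_shape K2 r_le S_base (adm_left ad).
split=> [|orth]; first exact: (shape_mono r_le spu).
apply/negP=> /eqP ep; have := adm_cases ad;
  case: both_right => [[cu cv pR _ _]|/andP[up _]].
  move: pR; rewrite -[p]negK -ep neg_lt_Rsum // leqNgt => /negP; apply.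
  by apply: leq_ltn_trans ev _; case/andP: cv.
have eu : e = u.
  by apply/val_inj/eqP; rewrite eqn_leq ue andbT ep -leq_neg negK.
have := rookset_skew K2 r_le S_base orth p; rewrite -ep eu => /negP; apply.
exact: adm_left ad.
Qed.

Lemma right_pos e : (u <= e <= v)%N -> shape r e s /\ (~~ is_symp c -> s != neg e).
Proof.
move=> /andP[ue ev].
have svs := rookset_shape K2 r_le S_base (adm_right ad).
have ses : shape r e s by apply: (shape_mono r_le svs).
split=> [//|orth]; apply/negP=> /eqP se; have := adm_cases ad.
case: both_right => [[cu cv _ sR _]|/andP[_ Ru]].
  move: sR; rewrite -neg_lt_Rsum // se negK ltnNge (leq_trans _ ue) //.
  by case/andP: cu.
have := shape_lt r_le ses; rewrite se ltnNge ltnW //.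
by apply: leave_nonpos r_le _ _; apply: leq_trans Ru ue.
Qed.

(** The first summand [a1] can be chained to the left rook either after its
    column or before its row.  The second way is incompatible with the sign of
    [a2], unless the rook lies on the antidiagonal, where both ways agree. *)
Lemma pair_first_summand (a1 a2 : option (rsym n)) g1 :
  a1 \in Gamma0 K c n r -> a2 \in Gamma0 K c n r ->
  ovec a1 + ovec a2 = evec u - evec v ->
  rootlike c g1 -> rvec g1 = evec p - evec u + ovec a1 ->
  exists2 e : ix, (u <= e <= v)%N & ovec a1 = evec u - evec e.
Proof.
move=> a1G a2G a12 g1r g1E.
have ne (a b : ix) : (a < b)%N -> a != b by move=> ab; apply: contraTneq ab => ->;
  rewrite ltnn.
have up (e : ix) : ovec a1 = evec u - evec e -> (u <= e)%N -> (u <= e <= v)%N.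
  move=> a1E ue; rewrite ue /=; have a2E : ovec a2 = evec e - evec v.
    by apply: (addrI (ovec a1)); rewrite a12 a1E addrA subrK.
  case: a2 a2G a2E {a12} => [d2|] a2G a2E; last first.
    by rewrite (@evec_inj c n e v) //; apply/eqP; rewrite -subr_eq0 -a2E.
  have d2r := Gamma0_rootlike a2G; have /andP[_ d2lt] := Epos_normal d2r.
  move: a2E; rewrite /= (rvecE d2r) => /(evec_diff2 (ne _ _ d2lt)).
  move: d2lt; case: (Epos c d2) => k l kl /poseqP[[ke lv]|].
    by move: kl; rewrite /= ke lv; apply: ltnW.
  by rewrite reflE => -[ke lv]; move: kl; rewrite /= ke lv ltn_neg; apply: ltnW.
case: a1 a1G a12 g1E up => [d1|] a1G a12 g1E up; last first.
  by exists u; rewrite ?leqnn ?(ltnW uv) // subrr.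
have d1r := Gamma0_rootlike a1G; have /andP[_ d1lt] := Epos_normal d1r.
have fin (e : ix) : poseq (Epos c d1) (u, e) -> exists2 e : ix, (u <= e <= v)%N & ovec (Some d1) = evec u - evec e.
  move=> d1E; have E : ovec (Some d1) = evec u - evec e by rewrite /= (rvecE d1r) (evec_poseq d1E).
  exists e => //; apply: up => //; move: d1lt; case/poseqP: d1E => ->;
    rewrite ?reflE /= ?ltn_neg; exact: ltnW.
have /andP[_ g1lt] := Epos_normal g1r.
rewrite /= (rvecE g1r) (rvecE d1r) in g1E.
have := evec_diff4 (ne _ _ g1lt) (ne _ _ pu_lt) (ne _ _ d1lt) g1E.
move=> [s' [t' [st' [[us' _]|[pt' _]]]]].
  by subst s'; rewrite -surjective_pairing in st'; apply: (fin t'); rewrite poseq_sym.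
(* Chaining [a1] before the row of the left rook: [a1] leads from [s'] to [p]. *)
subst t'; rewrite -surjective_pairing in st'.
have s'p : (s' < p)%N.
  by move: d1lt; rewrite poseq_sym in st'; case/poseqP: st' => ->;
    rewrite ?reflE /= ?ltn_neg.
have a1E : ovec (Some d1) = evec s' - evec p by rewrite /= (rvecE d1r) -(evec_poseq st').
have bad1 : u <> s' by move=> e; move: pu_lt; rewrite e ltnNge ltnW.
have pv : (p < v)%N := ltn_trans pu_lt uv.
rewrite a1E in a12; case: a2 a2G a12 {up} => [d2|] a2G a12; last first.
  move: a12; rewrite /= addr0 => /(evec_diff2 (ne _ _ s'p)) /poseqP[[e]|].
    by case: bad1.
  rewrite reflE => -[e1 e2]; apply: (fin v); rewrite poseq_sym.
  by apply: poseq_trans st'; rewrite e1 e2 /poseq reflE !negK eqxx orbT.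
have d2r := Gamma0_rootlike a2G; have /andP[_ d2lt] := Epos_normal d2r.
have d2E : evec (Epos c d2).1 - evec (Epos c d2).2 = evec u - evec v + (evec p - evec s').
  by rewrite -(rvecE d2r) -a12 /= [_ + rvec d2]addrC -addrA subrKA subrr addr0.
have := evec_diff4 (ne _ _ d2lt) (ne _ _ uv) _ d2E; rewrite eq_sym => /(_ (ne _ _ s'p)).
move=> [s2 [t2 [st2 H]]]; rewrite -surjective_pairing in H.
have goodu : u = neg p -> exists2 e : ix, (u <= e <= v)%N & ovec (Some d1) = evec u - evec e.
  move=> e; apply: (fin (neg s')); rewrite poseq_sym; apply: poseq_trans st'.
  by rewrite e /poseq reflE eqxx orbT.
case/poseqP: st2; rewrite ?reflE => -[es et]; subst s2 t2.
  case: H => -[e _]; last by case: bad1.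
  by move: pv; rewrite e ltnn.
case: H => -[e H]; last exact: goodu.
have := adm_cases ad; case: both_right => [[_ cv pR _ _]|/andP[up _]].
  exfalso; have : (s' < Rsum r)%N := ltn_trans s'p pR.
  rewrite -[s']negK -e neg_lt_Rsum // leqNgt => /negP; apply.
  by case/andP: cv.
apply: goodu; apply/val_inj/eqP; rewrite eqn_leq; apply/andP; split; last first.
  by rewrite -leq_neg negK.
apply: ltnW; case/poseqP: H => E; rewrite E in d2lt; first exact: d2lt.
by rewrite -ltn_neg; exact: d2lt.
Qed.

(** The decompositions of the root of the pair correspond to the intermediate
    indices [e]; both summands, and the roots [g1] and [g2], are determined by
    [e]. *)
Lemma Lpair_sum : Lpair K c r S q =
  \sum_(e : ix | (u <= e <= v)%N) Mminor K c r S (rootat p e) * Mbar K c r S (rootat e s).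
Proof.
pose h e := ((link u e, link e v), (rootat p e, rootat e s)).
pose E := [set e : ix | (u <= e <= v)%N].
have aE : ovec (alpha K c r q) = evec u - evec v.
  by rewrite (adm_alpha ad) /= (rvecE (adm_root ad)) (adm_pos ad).
have q1E : rvec q.1 = evec p - evec u.
  rewrite (rvecE (adm_left_root ad)) /left_row /left_col; apply: evec_poseq.
  rewrite /left_rook; case: both_right; last exact: poseq_refl.
  by rewrite /poseq reflK eqxx orbT.
have q2E : rvec q.2 = evec v - evec s by rewrite (rvecE (adm_right_root ad)).
rewrite /Lpair pair_big_dep /=.
under eq_bigr => a _ do rewrite pair_big_dep /=.
rewrite pair_big_dep /=.
transitivity (\sum_(t in h @: E) Mminor K c r S t.2.1 * Mbar K c r S t.2.2); last first.
  rewrite big_imset /=; last first.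
    move=> e e'; rewrite !inE => /andP[ue ev] /andP[ue' ev'] [+ _ _ _].
    move/(congr1 (@ovec n)); rewrite !ovec_link // => /addrI/oppr_inj; exact: evec_inj.
  by apply: eq_bigl => e; rewrite inE.
apply: eq_bigl => -[[a1 a2] [g1 g2]] /=.
rewrite aE q1E q2E; apply/idP/imsetP => [|[e]].
  case/andP=> /andP[a1G /andP[a2G /eqP a12]] /andP[/andP[g1M /eqP g1E] /andP[g2M /eqP g2E]].
  have g1r := rootsM_rootlike K2 r_le g1M; have g2r := rootsM_rootlike K2 r_le g2M.
  have [e uev a1E] := pair_first_summand a1G a2G a12 g1r g1E.
  have [ue ev] := andP uev.
  have a2E : ovec a2 = evec e - evec v.
    by apply: (addrI (ovec a1)); rewrite a12 a1E addrA subrK.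
  have pe : (p < e)%N := leq_trans pu_lt ue; have es : (e < s)%N := leq_ltn_trans ev vs_lt.
  have opt (a : option (rsym n)) (i j : ix) : a \in Gamma0 K c n r -> (i <= j)%N -> ovec a = evec i - evec j -> a = link i j.
    move=> aG ij; case: a aG => [w|] aG /= wE; last first.
      by rewrite (@evec_inj c n i j) ?link_self //; apply/eqP; rewrite -subr_eq0 -wE.
    have wr := Gamma0_rootlike aG; move: ij.
    rewrite leq_eqVlt => /orP[/eqP/val_inj ij|/link_some[w' [w'r w'E ->]]].
      have /andP[_] := Epos_normal wr.
      move: wE; rewrite ij subrr (rvecE wr) => /eqP; rewrite subr_eq0 => /eqP/evec_inj ->.
      by rewrite ltnn.
    congr Some; apply: (@rvec_inj c) => //.
    by rewrite wE (rvecE w'r) (evec_poseq w'E).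
  have rt w (i j : ix) : rootlike c w -> (i < j)%N -> rvec w = evec i - evec j -> w = rootat i j.
    move=> wr ij wE; have [w'r w'E] := rootatP ij.
    by apply: (@rvec_inj c) => //; rewrite wE (rvecE w'r) (evec_poseq w'E).
  exists e; first by rewrite inE.
  rewrite /h -(opt a1 u e) // -(opt a2 e v) // -(rt g1 p e) // -?(rt g2 e s) //.
    by rewrite g2E a2E addrA subrK.
  by rewrite g1E a1E addrA subrK.
rewrite inE => uev [-> -> -> ->]; have [ue ev] := andP uev.
have [spe pne] := left_pos uev; have [ses sne] := right_pos uev.
have pe := shape_lt r_le spe; have es := shape_lt r_le ses.
have [[g1r g1E] [g2r g2E]] := (rootatP pe, rootatP es).
rewrite !ovec_link // rootat_M // rootat_M // (rvecE g1r) (rvecE g2r) (evec_poseq g1E) (evec_poseq g2E) /=.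
rewrite !addrA !subrK !eqxx !andbT.
have cen : central r u && central r v || (dimG c n - Rsum r <= u)%N.
  by have := adm_cases ad; case: both_right => [[-> ->]|/andP[_ ->]]; rewrite ?orbT.
have blk (i j : ix) : (u <= i)%N -> (j <= v)%N -> ~~ shape r i j.
  by move=> ui jv; apply: contra (adm_block ad) => ij; apply: (shape_mono r_le ij).
have cene : central r e || (dimG c n - Rsum r <= e)%N.
  case/orP: cen => [/andP[/andP[l1 l2] /andP[l3 l4]]|Ru];
    last by rewrite (leq_trans Ru ue) orbT.
  by rewrite /central (leq_trans l1 ue) (leq_ltn_trans ev l4).
apply/andP; split; apply: link_Gamma0 => //; try exact: blk.
  case/orP: cen => [/andP[cu cv]|->]; last by rewrite orbT.
  rewrite cu /central (leq_trans _ ue) /= ?(leq_ltn_trans ev) //;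
    [by case/andP: cv|by case/andP: cu].
case/orP: cen => [/andP[cu cv]|Ru]; last by rewrite (leq_trans Ru ue) orbT.
rewrite cv andbT /central (leq_trans _ ue) /= ?(leq_ltn_trans ev) //;
  [by case/andP: cv|by case/andP: cu].
Qed.

End Pair.

End PairSum.


(** * Invariance *)

Lemma rookdet_scale (R : comNzRingType) m (T : {set 'I_m * 'I_m}) (x y : 'M[R]_m)
    (a b : 'I_m -> R) (p u e : 'I_m) :
  (forall i j, x i j = a i * b j * y i j) -> b e = b u ->
  rookdet T x p u e =
  (\prod_(i < #|rooks T p u.+1|) a (enum_val i).1) *
  (\prod_(j < #|rooks T p u.+1|) b (enum_val j).2) * rookdet T y p u e.
Proof.
move=> xE be.
have E : rookmx T x p u e = diag_mx (\row_(i < #|rooks T p u.+1|) a (enum_val i).1) *m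
   rookmx T y p u e *m diag_mx (\row_(j < #|rooks T p u.+1|) b (enum_val j).2).
  rewrite mul_diag_mx mul_mx_diag; apply/matrixP=> i j; rewrite !mxE xE.
  by case: eqP => [->|_]; rewrite ?be mulrAC.
rewrite /rookdet E !det_mulmx !det_diag mulrAC; congr (_ * _ * _).
  by apply: eq_bigr => i _; rewrite mxE.
by apply: eq_bigr => i _; rewrite mxE.
Qed.

Section Invariance.
Variables (K : fieldType) (c : classical) (n : nat) (r : seq nat) (S : {set rsym n}).
Hypothesis K2 : 2%:R != 0 :> K.
Hypothesis r_le : (sumn r <= n)%N.
Hypothesis S_base : is_base K c r S.
Notation ix := (idx c n).
Notation T := (rookset c S).
Notation X := (bbX K c n r).
Implicit Types (i j a b e : ix) (w g d : rsym n) (q : rsym n * rsym n).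

Let T_sym := @rookset_sym c n S.
Let T_row := rookset_row K2 r_le S_base.
Let T_col := rookset_col K2 r_le S_base.

Lemma eval_hookminor (y : 'M[K]_(dimG c n)) i j : in_m r y ->
  eval_m (hookminor T X i j) y = hookminor T y i j.
Proof. by move=> ym; rewrite /eval_m -hookminor_map bbX_eval. Qed.

Lemma eval_hookminor_antitr (y : 'M[K]_(dimG c n)) i j : in_m r y ->
  eval_m (hookminor T (antitr X) i j) y = hookminor T (antitr y) i j.
Proof. by move=> ym; rewrite /eval_m -hookminor_map -antitr_map bbX_eval. Qed.

Lemma Mminor_invariant w : w \in S -> N_invariant (Mminor K c r S w).
Proof.
move=> wS g x gN xm; have wr := base_rootlike K2 r_le S_base wS.
rewrite invmx_adjoint ?in_N_G //; have xm' := in_m_conj K2 r_le gN xm.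
rewrite Mminor_hookminor // !eval_hookminor_antitr //.
have wT := Epos_rookset c wS; case: (Epos c w) wT => p u puT /=.
have [b H] := hookminor_rookdet T_col T_row (v := u) puT (fun t _ _ tu => tu).
rewrite !H ?leqnn //; congr (_ * _); rewrite !antitrM mulmxA.
apply: (rookdet_invariant T_col puT).
- by apply: rook_bounded_antitr => //; apply: (in_m_rook_bounded K2 r_le).
- exact/uppertri_antitr/in_N_upper.
- exact/uppertri_antitr/adjoint_upper.
by rewrite -antitrM adjointE ?antitr1 ?in_N_G.
Qed.

Section Pair.
Variables (q : rsym n * rsym n) (d : rsym n).
Hypothesis ad : admissible_spec K c r S q d.
Notation p := (left_row c r q : ix).
Notation u := (left_col c r q : ix).
Notation v := (right_row c q : ix).
Notation s := (right_col c q : ix).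

(** Away from the central block the left factors are minors of the reflected
    matrix; the reflected matrix is the same up to signs on the nilradical. *)
Definition left_mx (R : nzRingType) (x : 'M[R]_(dimG c n)) :=
  if both_right c r q then x else antitr x.

Lemma right_normal e : (u <= e <= v)%N -> normal (e, s).
Proof.
move=> uev; have [ue ev] := andP uev; have RR := leq_Rsum_dimG c r_le.
have [ses _] := right_pos K2 r_le S_base ad uev; have es := shape_lt r_le ses.
rewrite normalE es andbT; have := adm_cases ad;
  case: both_right => [[cu _ _ sR _]|/andP[_ Ru]].
  apply: ltnW; apply: leq_trans (_ : Rsum r <= e)%N; first by rewrite neg_lt_Rsum.
  by apply: leq_trans ue; case/andP: cu.
apply: ltnW; apply: leq_trans (_ : Rsum r <= e)%N.
  by rewrite neg_lt_Rsum // (leq_trans (leq_trans Ru ue)) // ltnW.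
by apply: leq_trans RR (leq_trans Ru ue).
Qed.

Lemma left_normal e : (u <= e <= v)%N ->
  normal (if both_right c r q then refl (p, e) else (p, e)).
Proof.
move=> uev; have [ue ev] := andP uev.
have [spe _] := left_pos K2 r_le S_base ad uev; have pe := shape_lt r_le spe.
have := adm_cases ad; case: both_right => [[_ cv pR _ _]|/andP[up _]].
  rewrite reflE normalE negK ltn_neg pe andbT.
  apply: ltnW; apply: leq_trans pR _; rewrite leqNgt neg_lt_Rsum // -ltnNge.
  by apply: leq_ltn_trans ev _; case/andP: cv.
by rewrite normalE pe andbT (leq_trans _ up) // leq_neg.
Qed.

(** Rewriting the terms with respect to the two rooks brings the sum into the
    form of a pairing of a row of minors with a column of minors. *)
Lemma Lpair_hook : Lpair K c r S q =
  \sum_(e : ix | (u <= e <= v)%N)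
    hookminor T (left_mx X) p e * hookminor T X e s.
Proof.
rewrite (Lpair_sum K2 r_le S_base ad); apply: eq_bigr => e uev; have [ue ev] := andP uev.
have [spe _] := left_pos K2 r_le S_base ad uev.
have [ses _] := right_pos K2 r_le S_base ad uev.
have pe := shape_lt r_le spe; have es := shape_lt r_le ses.
have [g1r g1E] := rootatP d pe; have [g2r g2E] := rootatP d es.
rewrite Mminor_hookminor // Mbar_hookminor //.
have es' := right_normal uev.
rewrite (normal_poseq (Epos_normal g2r) es' g2E); congr (_ * _).
rewrite /left_mx; have := left_normal uev; case: both_right => pen; last first.
  by rewrite (normal_poseq (Epos_normal g1r) pen g1E).
rewrite (normal_poseq (Epos_normal g1r) pen) ?reflE; last first.
  by apply: poseq_trans g1E _; rewrite /poseq reflE !negK eqxx orbT.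
by rewrite (hookminor_antitr T_col T_row) //; congr (hookminor _ _ _ _); exact: negK.
Qed.

Lemma left_monotone (t : ix * ix) : t \in T -> (p < t.1)%N -> (t.2 <= v)%N -> (t.2 <= u)%N.
Proof.
exact: (rookset_block_col K2 r_le S_base (adm_left ad) (adm_block ad)
          (pair_side r_le ad)).
Qed.

Lemma right_monotone (t : ix * ix) : t \in T -> (t.2 < s)%N -> (u <= t.1)%N -> (v <= t.1)%N.
Proof.
exact: (rookset_block_row K2 r_le S_base (adm_right ad) (adm_block ad)
          (pair_side' r_le ad)).
Qed.

Lemma right_monotone_neg (t : ix * ix) :
  t \in T -> (neg s < t.1)%N -> (t.2 <= neg u)%N -> (t.2 <= neg v)%N.
Proof.
case: t => a b /(@rookset_sym _ _ _ a b) abT sa bu; have H := right_monotone abT.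
have h1 : (neg a < s)%N by rewrite -ltn_neg negK; exact: sa.
have h2 : (u <= neg b)%N by rewrite -leq_neg negK; exact: bu.
have h3 : (v <= neg b)%N := H h1 h2.
by rewrite -leq_neg negK in h3; exact: h3.
Qed.

Lemma right_hook : exists b : bool, forall (R : comNzRingType) (x : 'M[R]_(dimG c n)) e,
  (u <= e <= v)%N ->
  hookminor T x e s = (-1) ^+ b * rookdet T (antitr x) (neg s) (neg v) (neg e).
Proof.
have vsT : (neg s, neg v) \in T by apply: rookset_sym; exact: (adm_right ad).
have [b H] := hookminor_rookdet T_col T_row (v := neg u) vsT right_monotone_neg.
exists b => R x e /andP[ue ev]; rewrite -H ?leq_neg ?ue ?ev //.
rewrite (hookminor_antitr T_col T_row) //.
by congr (hookminor _ _ _ _); rewrite -[rev_ord _]/(neg _) negK.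
Qed.

Lemma left_hook : exists b : bool, forall (R : comNzRingType) (x : 'M[R]_(dimG c n)) e,
  (u <= e <= v)%N -> hookminor T x p e = (-1) ^+ b * rookdet T x p u e.
Proof. exact: (hookminor_rookdet T_col T_row (adm_left ad) left_monotone). Qed.

(** The symmetry of the nilradical turns the transposed factor into a row
    vector of minors, up to a sign that is constant along a block. *)
Lemma left_hook_nilradical : exists k : K, forall (x : 'M[K]_(dimG c n)) e,
  in_m r x -> (u <= e <= v)%N ->
  hookminor T (left_mx x) p e = k * rookdet T x p u e.
Proof.
have [b H] := left_hook; rewrite /left_mx.
have := adm_cases ad; case: both_right => [_|/andP[_ Ru]].
  by exists ((-1) ^+ b) => x e _; apply: H.
eexists => x e xm uev; rewrite H //.
rewrite (@rookdet_scale _ _ _ _ x (fun i => - gsign K i) (fun j => gsign K j)).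
- by rewrite !mulrA; reflexivity.
- by move=> i j; rewrite mxE (in_m_skew xm) !mulNr.
rewrite /gsign /is_pos; have [ue _] := andP uev.
have nR : (n <= dimG c n - Rsum r)%N by have := dimGE c n; clear -r_le; move: r_le;
  rewrite /Rsum; lia.
by rewrite !ltnNge (leq_trans nR Ru) (leq_trans nR (leq_trans Ru ue)).
Qed.

Lemma Lpair_invariant : N_invariant (Lpair K c r S q).
Proof.
move=> g x gN xm; rewrite invmx_adjoint ?in_N_G //.
have xm' := in_m_conj K2 r_le gN xm.
have [k kE] := left_hook_nilradical; have [b bE] := right_hook.
have ev (y : 'M[K]_(dimG c n)) : in_m r y -> eval_m (Lpair K c r S q) y =
    k * (-1) ^+ b * \sum_(e : ix | (u <= e <= v)%N)
      rookdet T y p u e * rookdet T (antitr y) (rev_ord s) (rev_ord v) (rev_ord e).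
  move=> ym; rewrite Lpair_hook /eval_m rmorph_sum big_distrr /=.
  apply: eq_bigr => e uev; rewrite mevalM -!/(eval_m _ _) eval_hookminor //.
  have -> : eval_m (hookminor T (left_mx X) p e) y = hookminor T (left_mx y) p e.
    by rewrite /left_mx; case: both_right;
      [apply: eval_hookminor|apply: eval_hookminor_antitr].
  by rewrite kE // bE // mulrACA.
rewrite !ev //; congr (_ * _).
apply: (rookpair_invariant T_col T_sym) => //.
- exact: (in_m_rook_bounded K2 r_le S_base xm).
- exact: adjoint_upper.
- exact: in_N_upper.
- exact/adjointE/in_N_G.
- exact: (adm_left ad).
- exact: (adm_right ad).
- exact: left_monotone.
exact: right_monotone.
Qed.

End Pair.

Lemma Lpol_pair f : f \in Phi K c r S ->
  exists q, [/\ q \in pairsQ K c r S, phi K c r q = f & Lpol K c r S f = Lpair K c r S q].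
Proof.
rewrite mem_undup => /mapP[q0 q0Q fE]; rewrite /Lpol; case: pickP => [q /andP[qQ /eqP qf]|].
  by exists q.
by move/(_ q0); rewrite -mem_enum q0Q fE eqxx.
Qed.

Lemma system_invariant f : f \in system K c r S -> N_invariant f.
Proof.
rewrite mem_cat => /orP[/mapP[w + ->]|/mapP[h hP ->]].
  by rewrite mem_enum; apply: Mminor_invariant.
have [q [qQ _ ->]] := Lpol_pair hP; have [d ad] := admissible K2 r_le S_base qQ.
exact: Lpair_invariant ad.
Qed.

End Invariance.


(** * The Jacobian matrix at the base point *)

Lemma rookdetN (R : comNzRingType) m (T : {set 'I_m * 'I_m}) (x : 'M[R]_m) p u e :
  rookdet T (- x) p u e = (-1) ^+ #|rooks T p u.+1| * rookdet T x p u e.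
Proof.
by rewrite -detZ; congr (\det _); apply/matrixP=> i j; rewrite !mxE mulN1r.
Qed.

Lemma sign_cancel (R : comNzRingType) (a b k : nat) (z : R) :
  (-1) ^+ b * ((-1) ^+ k * z) = (-1) ^+ a * (-1) ^+ b * (-1) ^+ k * ((-1) ^+ a * z).
Proof.
rewrite -!mulrA [(-1) ^+ k * (_ * z)]mulrCA [(-1) ^+ b * ((-1) ^+ a * _)]mulrCA.
by rewrite !mulrA -expr2 sqrr_sign mul1r -!mulrA.
Qed.

Lemma ltn_sub_inside p a b u : (p <= a)%N -> (b <= u)%N -> (a < b)%N ->
  (p < a)%N || (b < u)%N -> (b - a < u - p)%N.
Proof. by move=> pa bu ab /orP[]; lia. Qed.

Section Base.
Variables (K : fieldType) (c : classical) (n : nat) (r : seq nat) (S : {set rsym n}).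
Hypothesis K2 : 2%:R != 0 :> K.
Hypothesis r_le : (sumn r <= n)%N.
Hypothesis S_base : is_base K c r S.
Notation ix := (idx c n).
Notation T := (rookset c S).
Notation X := (bbX K c n r).
Notation N := (#|rootsM K c n r|).
Implicit Types (i j a b e : ix) (w g d : rsym n) (q : rsym n * rsym n).

Let T_sym := @rookset_sym c n S.
Let T_row := rookset_row K2 r_le S_base.
Let T_col := rookset_col K2 r_le S_base.

Definition base_coord (v : 'I_N) : K := (enum_val v \in S)%:R.

Definition base_point : 'M[K]_(dimG c n) := map_mx (meval base_coord) X.

Lemma base_pointE i j : base_point i j = \sum_(w in S) root_mx K c w i j.
Proof.
rewrite !mxE rmorph_sum /=.
rewrite (eq_bigr (fun v : 'I_N => if enum_val v \in S then root_mx K c (enum_val v) i j else 0)).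
  rewrite -(big_enum_val (fun w => if w \in S then root_mx K c w i j else 0)) /=.
  rewrite -big_mkcondr /=; apply: eq_bigl => w; rewrite andbC.
  by case: (boolP (w \in S)) => //= /(base_rootsM S_base).
by move=> v _; rewrite mevalZ mevalXU /base_coord; case: ifP; rewrite ?mulr1 ?mulr0.
Qed.

Lemma rootlike_uniq_pos w g t : rootlike c w -> rootlike c g ->
  poseq t (Epos c w) -> poseq t (Epos c g) -> w = g.
Proof.
move=> wr gr tw tg; apply: (@rootlike_uniq c) => //.
by apply: poseq_trans tg; rewrite poseq_sym.
Qed.

Lemma base_point_supported : rook_supported T base_point.
Proof.
move=> i j; rewrite base_pointE; apply/idP/rooksetP => [|[w wS E]].
  case: (pickP (fun w => (w \in S) && poseq (i, j) (Epos c w))) => [w /andP[wS E] _|no].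
    by exists w.
  rewrite big1 ?eqxx // => w wS; apply/eqP; apply: contraT.
  by rewrite root_mx_neq0 ?(base_rootlike K2 r_le S_base) // => E; have := no w;
    rewrite wS E.
have wr := base_rootlike K2 r_le S_base wS.
rewrite (bigD1 w) //= big1 ?addr0 ?root_mx_neq0 // => g /andP[gS gw]; apply/eqP.
have gr := base_rootlike K2 r_le S_base gS.
apply: contraT; rewrite root_mx_neq0 // => E'; case/eqP: gw.
exact: rootlike_uniq_pos E' E.
Qed.

Lemma antitr_supported (z : 'M[K]_(dimG c n)) :
  rook_supported T z -> rook_supported T (antitr z).
Proof.
move=> zT i j; rewrite mxE zT; apply/idP/idP; last exact: T_sym.
by move/T_sym; rewrite -!/(neg _) !negK.
Qed.

Section Direction.
Variable g : rsym n.
Hypothesis gM : g \in rootsM K c n r.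

Definition coord_of : 'I_N := enum_rank_in gM g.
Notation D := (dirder base_coord coord_of).
Notation y := (root_mx K c g).

Lemma dirder_bbX i j : D (X i j) = y i j.
Proof.
rewrite mxE dirder_sum (bigD1 coord_of) //= big1 ?addr0.
  rewrite /dirder mderivZ mderivX mnm1E eqxx scale1r (_ : (U_(coord_of) - U_(coord_of))%MM = 0%MM).
    by rewrite mpolyX0 mevalZ meval1 mulr1 /coord_of enum_rankK_in.
  by apply/mnmP=> k; rewrite mnmBE subnn mnm0E.
move=> v vg; rewrite /dirder mderivZ mderivX mnm1E (negPf vg) scale0r.
by rewrite mevalZ meval0 mulr0.
Qed.

Lemma dirder_rookdet p u e :
  D (rookdet T X p u e) = rookder T base_point y p u e.
Proof.
rewrite /rookdet dirder_det; apply: eq_bigr => j _; congr (\det _).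
apply/matrixP=> a b; rewrite !mxE; case: eqP => _; last by rewrite /base_point mxE !mxE.
by rewrite -dirder_bbX mxE.
Qed.

Lemma dirder_rookdet_antitr p u e :
  D (rookdet T (antitr X) p u e) = rookder T (antitr base_point) (antitr y) p u e.
Proof.
rewrite /rookdet dirder_det; apply: eq_bigr => j _; congr (\det _).
apply/matrixP=> a b; rewrite !mxE; case: eqP => _; last by rewrite /base_point !mxE.
by rewrite mxE -dirder_bbX mxE.
Qed.

End Direction.


Lemma dirder_sign v (b : bool) (f : {mpoly K[N]}) :
  dirder base_coord v ((-1) ^+ b * f) = (-1) ^+ b * dirder base_coord v f.
Proof. by rewrite !mulr_sign; case: b => //; rewrite dirderN. Qed.

Lemma rookdet_map (R R' : comNzRingType) (f : {rmorphism R -> R'})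
    (x : 'M[R]_(dimG c n)) p u e :
  rookdet T (map_mx f x) p u e = f (rookdet T x p u e).
Proof.
by rewrite /rookdet -det_map_mx; congr (\det _); apply/matrixP=> i j; rewrite !mxE.
Qed.

Lemma antitr_root_neq0 g i j : rootlike c g ->
  (antitr (root_mx K c g) i j != 0) = poseq (i, j) (Epos c g).
Proof.
move=> gr; rewrite mxE -!/(neg _) root_mx_neq0 // -reflE.
by rewrite ![poseq _ (Epos c g)]poseq_sym /poseq reflK orbC.
Qed.

Lemma rooks_root g t lo hi : g \in rootsM K c n r -> t \in rooks T lo hi ->
  poseq t (Epos c g) -> g \in S.
Proof.
move=> gM; rewrite inE => /andP[/rooksetP[w wS E] _] E'.
by rewrite -(rootlike_uniq_pos (base_rootlike K2 r_le S_base wS) (rootsM_rootlike K2 r_le gM) E E').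
Qed.

(** Measured by positions, since these are known up to reflection only, and
    reflection preserves the distance from the diagonal. *)
Definition height g : nat := ((Epos c g).2 - (Epos c g).1)%N.

Lemma height_pos g (t : ix * ix) : poseq t (Epos c g) -> height g = (t.2 - t.1)%N.
Proof.
rewrite /height; case/poseqP => -> //=.
by have := ltn_ord (Epos c g).1; have := ltn_ord (Epos c g).2; lia.
Qed.

(** In the direction of [w] only the corner of the minor varies, the reflected
    entry lying outside of the minor unless it is the corner itself; the other
    rooks of the minor have nonzero entries at the base point. *)
Lemma Mminor_dirder_self w (wM : w \in rootsM K c n r) : w \in S ->
  dirder base_coord (coord_of wM) (Mminor K c r S w) != 0.
Proof.
move=> wS; have wr := base_rootlike K2 r_le S_base wS.
rewrite Mminor_hookminor //; have wT := Epos_rookset c wS.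
have wn := Epos_normal wr.
case wE: (Epos c w) wT wn => [p u] puT wn.
have [b H] := hookminor_rookdet T_col T_row (v := u) puT (fun t _ _ tu => tu).
rewrite H ?leqnn // dirder_sign mulf_neq0 ?signr_eq0 // dirder_rookdet_antitr.
have [C C0 ->] := rookder_supported T_col T_row puT (antitr_supported base_point_supported).
  by rewrite mulf_neq0 // antitr_root_neq0 // wE poseq_refl.
right; split=> // -[a e] tr tne; apply/eqP; apply: contraNT tne.
rewrite antitr_root_neq0 // wE => /poseqP[->//|E]; move: tr;
  rewrite E inE => /and3P[_ pu up].
move: wn; rewrite normalE => /andP[up' _].
have pE : p = neg u by apply/val_inj/eqP; rewrite eqn_leq up' andbT; exact: pu.
by rewrite reflE pE negK.
Qed.

Lemma Mminor_dirder w g (gM : g \in rootsM K c n r) : w \in S ->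
  dirder base_coord (coord_of gM) (Mminor K c r S w) != 0 ->
  g \in S /\ (g = w \/ (height g < height w)%N).
Proof.
move=> wS; have wr := base_rootlike K2 r_le S_base wS.
have gr := rootsM_rootlike K2 r_le gM.
rewrite Mminor_hookminor //; have wT := Epos_rookset c wS.
case wE: (Epos c w) wT => [p u] puT.
have [b H] := hookminor_rookdet T_col T_row (v := u) puT (fun t _ _ tu => tu).
rewrite H ?leqnn // dirder_sign mulf_eq0 signr_eq0 /= dirder_rookdet_antitr.
case: (pickP (fun t => (t \in rooks T p u.+1) && poseq t (Epos c g))) => [t /andP[tr tE] _|no].
  split; first exact: rooks_root tr tE.
  rewrite (height_pos tE) /height wE /=; move: (tr); rewrite inE ltnS => /and3P[_ pt tu].
  case: (eqVneq t (p, u)) => [e|tne].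
    left; apply: (rootlike_uniq_pos gr wr tE); rewrite e wE; exact: poseq_refl.
  right; have tlt : (t.1 < t.2)%N.
    apply: (shape_lt r_le); apply: (rookset_shape K2 r_le S_base);
      rewrite -surjective_pairing.
    by move: tr; rewrite inE => /andP[].
  have : (p < t.1)%N || (t.2 < u)%N.
    rewrite !ltnNge -negb_and; apply: contra tne => /andP[h1 h2]; apply/eqP.
    have e1 : t.1 = p by apply/val_inj/eqP; rewrite eqn_leq h1 pt.
    have e2 : t.2 = u by apply/val_inj/eqP; rewrite eqn_leq h2 tu.
    by rewrite [t]surjective_pairing e1 e2.
  exact: ltn_sub_inside pt tu tlt.
have [C C0 ->] := rookder_supported T_col T_row puT (antitr_supported base_point_supported); last first.
  right; split=> // -[a e] tr _; apply/eqP; apply: contraFT (no (a, e)).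
  by rewrite antitr_root_neq0 // tr.
rewrite mulf_eq0 negb_or => /andP[]; rewrite antitr_root_neq0 // => E.
by have := no (p, u); rewrite E (corner_mem puT).
Qed.

Section Pair.
Variables (q : rsym n * rsym n) (d : rsym n).
Hypothesis ad : admissible_spec K c r S q d.
Notation p := (left_row c r q : ix).
Notation u := (left_col c r q : ix).
Notation v := (right_row c q : ix).
Notation s := (right_col c q : ix).
Notation hL e := (hookminor T (left_mx r q X) p e).
Notation hR e := (hookminor T X e s).
Notation val0 f := (f.@[base_coord]).

Let uv := adm_lt ad.
Let uu : (u <= u <= v)%N. Proof. by rewrite leqnn ltnW. Qed.
Let vv : (u <= v <= v)%N. Proof. by rewrite leqnn ltnW. Qed.

Lemma left_mx_map (R R' : nzRingType) (f : R -> R') (x : 'M[R]_(dimG c n)) :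
  left_mx r q (map_mx f x) = map_mx f (left_mx r q x).
Proof. by rewrite /left_mx antitr_map; case: both_right. Qed.

Lemma left_mx_supported (z : 'M[K]_(dimG c n)) :
  rook_supported T z -> rook_supported T (left_mx r q z).
Proof. by rewrite /left_mx; case: both_right => // /antitr_supported. Qed.


Lemma base_left_hook : exists b : bool, forall e, (u <= e <= v)%N ->
  val0 (hL e) = (-1) ^+ b * rookdet T (left_mx r q base_point) p u e.
Proof.
have [b H] := left_hook K2 r_le S_base ad; exists b => e uev.
by rewrite H // rmorphM rmorph_sign /= /base_point left_mx_map rookdet_map.
Qed.

Lemma base_right_hook : exists b : bool, forall e, (u <= e <= v)%N ->
  val0 (hR e) = (-1) ^+ b * rookdet T (antitr base_point) (neg s) (neg v) (neg e).
Proof.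
have [b H] := right_hook K2 r_le S_base ad; exists b => e uev.
by rewrite H // rmorphM rmorph_sign /= /base_point antitr_map rookdet_map.
Qed.

Let base_left_supported := left_mx_supported base_point_supported.
Let base_antitr_supported := antitr_supported base_point_supported.
Let vsT : (neg s, neg v) \in T. Proof. exact: T_sym (adm_right ad). Qed.

Lemma base_left_neq0 : val0 (hL u) != 0.
Proof.
have [b ->//] := base_left_hook; rewrite mulf_neq0 ?signr_eq0 //.
exact: rookdet_supported_neq0 (adm_left ad) base_left_supported.
Qed.

Lemma base_left0 e : (u < e)%N -> (e <= v)%N -> val0 (hL e) = 0.
Proof.
move=> ue ev; have [b ->] := base_left_hook; last by rewrite (ltnW ue).
by rewrite (rookdet_supported0 T_col T_row (adm_left ad) base_left_supported ue) mulr0.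
Qed.

Lemma base_right0 e : (u <= e)%N -> (e < v)%N -> val0 (hR e) = 0.
Proof.
move=> ue ev; have [b ->] := base_right_hook; last by rewrite ue (ltnW ev).
rewrite (rookdet_supported0 T_col T_row vsT base_antitr_supported) ?mulr0 //.
by rewrite ltn_neg.
Qed.

Lemma left_dirder : exists2 C : K, C != 0 &
  forall g (gM : g \in rootsM K c n r),
    dirder base_coord (coord_of gM) (hL v) = left_mx r q (root_mx K c g) p v * C.
Proof.
have [b H] := left_hook K2 r_le S_base ad.
have [C C0 CE] := rookder_supported T_col T_row (adm_left ad) base_left_supported.
exists ((-1) ^+ b * C) => [|g gM]; first by rewrite mulf_neq0 ?signr_eq0.
rewrite H // dirder_sign mulrCA -CE; last by left.
congr (_ * _); rewrite /left_mx; case: both_right; first exact: dirder_rookdet.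
exact: dirder_rookdet_antitr.
Qed.

Lemma right_dirder : exists2 C : K, C != 0 &
  forall g (gM : g \in rootsM K c n r),
    dirder base_coord (coord_of gM) (hR u) = root_mx K c g u s * C.
Proof.
have [b H] := right_hook K2 r_le S_base ad.
have [C C0 CE] := rookder_supported T_col T_row vsT base_antitr_supported.
exists ((-1) ^+ b * C) => [|g gM]; first by rewrite mulf_neq0 ?signr_eq0.
rewrite H // dirder_sign dirder_rookdet_antitr CE; last by left; rewrite ltn_neg.
by rewrite mulrCA mxE -!/(neg _) !negK.
Qed.

(** All but the two extreme terms of the sum vanish to second order at the
    base point. *)
Lemma Lpair_dirder g (gM : g \in rootsM K c n r) :
  dirder base_coord (coord_of gM) (Lpair K c r S q) =
  val0 (hL u) * dirder base_coord (coord_of gM) (hR u)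
  + dirder base_coord (coord_of gM) (hL v) * val0 (hR v).
Proof.
rewrite (Lpair_hook K2 r_le S_base ad) dirder_sum.
have vu : v != u by apply: contraTneq uv => ->; rewrite ltnn.
rewrite (bigD1 u) ?uu //= (bigD1 v) ?vv //= big1 ?addr0 => [|e /andP[/andP[/andP[ue ev] eu] ev']].
  by rewrite !dirderM base_right0 // (base_left0 uv) // mulr0 mul0r add0r addr0.
have ltue : (u < e)%N by rewrite ltn_neqAle eq_sym val_eqE eu.
have ltev : (e < v)%N by rewrite ltn_neqAle val_eqE ev'.
by rewrite dirderM base_right0 // base_left0 // mulr0 mul0r addr0.
Qed.

Lemma us_root : exists g, [/\ g \in rootsM K c n r, Epos c g = (u, s) & rvec g = phi K c r q].
Proof.
have [sus orth] := right_pos K2 r_le S_base ad uu.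
have gM := rootat_M K2 r_le d sus orth; exists (rootat d u s).
have [gr gE] := rootatP d (shape_lt r_le sus).
split=> //; first exact: normal_poseq (Epos_normal gr) (right_normal K2 r_le S_base ad uu) gE.
rewrite (rvecE gr) (evec_poseq gE) /phi (adm_alpha ad) /= (rvecE (adm_root ad)) (adm_pos ad).
by rewrite (rvecE (adm_right_root ad)) -/v -/s addrA subrK.
Qed.

(** For a pair of equal roots both extreme terms involve the same coordinate.
    Such a pair occurs in the orthogonal case only, where the generic matrix is
    skew about the antidiagonal and the two derivatives add up. *)
Lemma Lpair_dirder_self g (gM : g \in rootsM K c n r) : Epos c g = (u, s) ->
  dirder base_coord (coord_of gM) (Lpair K c r S q) != 0.
Proof.
move=> gE; rewrite Lpair_dirder; have gr := rootsM_rootlike K2 r_le gM.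
have [C C0 rE] := right_dirder.
have yus : root_mx K c g u s != 0 by rewrite root_mx_neq0 // gE poseq_refl.
(* If the second extreme term involves another coordinate, only the first one
   contributes; otherwise the two rooks are reflections of each other. *)
case: (eqVneq (left_mx r q (root_mx K c g) p v) 0) => [y0|ypv].
  have [C' _ ->] := left_dirder; rewrite y0 !mul0r addr0.
  by rewrite rE !mulf_neq0 // base_left_neq0.
have br : both_right c r q.
  move: ypv; rewrite /left_mx; case br: both_right => //; rewrite antitr_root_neq0 // gE.
  have pvn : normal (p, v) by have := left_normal K2 r_le S_base ad vv; rewrite br.
  have usn := right_normal K2 r_le S_base ad uu.
  by move/(normal_poseq pvn usn) => -[e _]; have := pu_lt K2 r_le S_base ad; rewrite e ltnn.
rewrite /left_mx br root_mx_neq0 // gE in ypv.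
have [pE vE] : p = neg s /\ v = neg u.
  case/poseqP: ypv => [[e _]|]; last by rewrite reflE => -[-> ->].
  by have := pu_lt K2 r_le S_base ad; rewrite e ltnn.
have orth : ~~ is_symp c.
  by apply/negP=> cS; have := adm_cases ad; rewrite br => -[_ _ _ _ /(_ cS)];
    rewrite vE eqxx.
have [b1 H1] := left_hook K2 r_le S_base ad; have [b2 H2] := right_hook K2 r_le S_base ad.
(* Each right minor is then the reflection of a left one, up to a common sign,
   so that the two derivatives are equal. *)
have [eps eps0 E] : exists2 eps : {mpoly K[N]}, eps = 1 \/ eps = -1 &
    forall e, (u <= e <= v)%N -> hR e = eps * hL (neg e).
  exists ((-1) ^+ b1 * (-1) ^+ b2 * (-1) ^+ #|rooks T p u.+1|).
    by rewrite -!exprD; rewrite -signr_odd; case: odd; [right|left]; rewrite ?expr1 ?expr0.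
  move=> e /andP[ue ev]; have e' : (u <= neg e <= v)%N.
    by rewrite vE leq_neg ue -[u]negK -vE leq_neg ev.
  rewrite H2 ?ue // H1 // /left_mx br bbX_antitr // -pE.
  rewrite (_ : neg v = u); last by rewrite vE negK.
  by rewrite rookdetN; exact: sign_cancel.
have uvE : neg v = u by rewrite vE negK.
have hv : val0 (hR v) = val0 eps * val0 (hL u) by rewrite E // mevalM uvE.
have hu : dirder base_coord (coord_of gM) (hR u) = val0 eps * dirder base_coord (coord_of gM) (hL v).
  rewrite E // -vE; case: eps0 => ->; first by rewrite mul1r meval1 mul1r.
  by rewrite mulN1r dirderN mevalN meval1 mulN1r.
have [C1 C10 lE] := left_dirder.
rewrite hu hv lE; set Z := left_mx _ _ _ _ _ * C1; set A := val0 (hL u).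
have e0 : val0 eps != 0 by case: eps0 => ->; rewrite ?mevalN meval1 ?oppr_eq0 oner_eq0.
rewrite [A * _]mulrCA [Z * _]mulrCA [Z * A]mulrC -mulr2n -mulr_natl !mulf_neq0 //.
  exact: base_left_neq0.
by rewrite /left_mx br root_mx_neq0 // gE.
Qed.

(** An order on the roots of the pairs that makes the Jacobian matrix
    triangular. *)
Definition pair_key g : nat :=
  if central r (Epos c g).1 then (dimG c n - (Epos c g).2)%N
  else (dimG c n).+1 + (Epos c g).2.

(** The first extreme term sees the entry above the right rook, the second one
    the entry to the right of the left rook.  In the central block the second
    entry is reflected, and the order of the rooks in a block compares the two. *)
Lemma Lpair_dirder_key g (gM : g \in rootsM K c n r) g0 : Epos c g0 = (u, s) ->
  dirder base_coord (coord_of gM) (Lpair K c r S q) != 0 ->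
  g \notin S /\ (Epos c g = (u, s) \/ (pair_key g < pair_key g0)%N).
Proof.
move=> g0E; have gr := rootsM_rootlike K2 r_le gM.
rewrite Lpair_dirder; have [C _ ->] := right_dirder; have [C' _ ->] := left_dirder => nz.
have nS (t : ix * ix) : t \notin T -> poseq t (Epos c g) -> g \notin S.
  by move=> tT tE; apply: contra tT => gS; apply/rooksetP; exists g.
have us : (u, s) \notin T.
  by apply/negP=> usT; have := T_col usT (adm_right ad) => e; move: uv; rewrite e ltnn.
have pv : (p, v) \notin T.
  by apply/negP=> pvT; have := T_row pvT (adm_left ad) => e; move: uv; rewrite e ltnn.
have usn := right_normal K2 r_le S_base ad uu.
case: (boolP (poseq (u, s) (Epos c g))) => [usE|nus].
  split; first exact: nS usE.
  by left; apply/esym; apply: normal_poseq => //; apply: Epos_normal.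
have y0 : root_mx K c g u s = 0.
  by apply/eqP; move: nus; rewrite -(root_mx_neq0 K u s gr) negbK.
move: nz; rewrite y0 mul0r mulr0 add0r mulf_eq0 negb_or => /andP[+ _].
rewrite mulf_eq0 negb_or => /andP[+ _] => nz.
have pvE : poseq (p, v) (Epos c g).
  by move: nz; rewrite /left_mx; case: both_right;
    rewrite ?antitr_root_neq0 // root_mx_neq0.
split; first exact: nS pvE.
have pvn := left_normal K2 r_le S_base ad vv.
have := adm_cases ad; have := adm_order ad; case br: (both_right c r q) pvn => pvn.
  (* Both rooks in the central block: the coordinate of the second term is that
     of [(neg v, neg p)], and the rook [(neg u, neg p)] lies to the right of
     [(v, s)] unless it is equal to it. *)
  move=> /(_ isT) uv' [cu cv _ _ _].
  have gE : Epos c g = (neg v, neg p).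
    apply: normal_poseq (Epos_normal gr) pvn _; rewrite poseq_sym.
    by apply: poseq_trans pvE; rewrite /poseq eqxx orbT.
  have npT : (neg u, neg p) \in T := T_sym (adm_left ad).
  case: (eqVneq (neg u) v) => [uvE|uvE].
    left; rewrite gE -uvE negK; congr (_, _); apply: (T_row npT); rewrite uvE;
      exact: adm_right ad.
  right; rewrite /pair_key gE g0E /= -/(neg v) -/(neg p) central_neg // cv cu.
  apply: ltn_sub2l; first exact: ltn_ord.
  rewrite ltnNge; apply/negP => ps; move: uvE; apply/negP; rewrite negbK; apply/eqP.
  case: (eqVneq (neg p) s) => [e|ne]; first by apply: (T_col npT); rewrite e;
    exact: adm_right ad.
  have bl : ~~ shape r (neg u) v by apply: central_shape; rewrite ?central_neg.
  have side : ~~ shape r v (neg v) || (v <= neg s)%N by rewrite central_shape // central_neg.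
  have ltps : (neg p < s)%N by rewrite ltn_neqAle ps val_eqE ne.
  have := rookset_block_row K2 r_le S_base (adm_right ad) bl side npT ltps (leqnn _).
  by move=> vu; apply/val_inj/eqP; rewrite eqn_leq uv' vu.
(* Otherwise no reflection is involved: the second coordinate is that of [(p, v)],
   where [v] precedes [s]. *)
move=> _ /andP[up Ru].
have gE : Epos c g = (p, v).
  by apply: normal_poseq (Epos_normal gr) pvn _; rewrite poseq_sym.
right; rewrite /pair_key gE g0E /=.
have -> : central r u = false by rewrite /central [(u < _)%N]ltnNge Ru andbF.
have vs := vs_lt K2 r_le S_base ad.
case: (central r p); last by rewrite ltn_add2l.
by rewrite ltnS (leq_trans (leq_subr _ _)) // leq_addr.
Qed.

End Pair.

End Base.


(** * Algebraic independence *)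

Section Independence.
Variables (K : fieldType) (c : classical) (n : nat) (r : seq nat) (S : {set rsym n}).
Hypothesis charK0 : [pchar K] =i pred0.
Hypothesis r_le : (sumn r <= n)%N.
Hypothesis S_base : is_base K c r S.

Lemma two_neq0 : 2%:R != 0 :> K.
Proof. by rewrite ((pcharf0P K).1 charK0). Qed.
Let K2 := two_neq0.

Notation gen := (rsym n + 'rV[int]_n)%type.

Definition gens : seq gen := map inl (enum S) ++ map inr (Phi K c r S).

Definition gen_poly (l : gen) : {mpoly K[#|rootsM K c n r|]} :=
  match l with inl w => Mminor K c r S w | inr f => Lpol K c r S f end.

(** The coordinate by which a member of the system is detected. *)
Definition gen_root (l : gen) : option (rsym n) :=
  match l with
  | inl w => Some w
  | inr f => [pick g in rootsM K c n r | rvec g == f]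
  end.

Definition gen_key (l : gen) : nat :=
  match l, gen_root l with
  | inl w, _ => height c w
  | inr _, Some g => pair_key c r g
  | _, _ => 0%N
  end.

Lemma system_gens : system K c r S = map gen_poly gens.
Proof. by rewrite /system /gens map_cat -!map_comp. Qed.

Lemma gens_uniq : uniq gens.
Proof.
rewrite cat_uniq !map_inj_uniq ?enum_uniq ?undup_uniq //; try by move=> ? ? [].
by rewrite andbT /=; apply/hasPn => _ /mapP[f _ ->]; apply/negP => /mapP[].
Qed.

Lemma Phi_root f : f \in Phi K c r S -> exists q d g,
  [/\ admissible_spec K c r S q d, Lpol K c r S f = Lpair K c r S q,
      g \in rootsM K c n r, Epos c g = (left_col c r q, right_col c q) &
      gen_root (inr f) = Some g].
Proof.
move=> fP; have [q [qQ qf fL]] := Lpol_pair fP; have [d ad] := admissible K2 r_le S_base qQ.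
have [g [gM gE gf]] := us_root K2 r_le S_base ad.
exists q, d, g; split=> //=; case: pickP => [g' /andP[g'M /eqP g'f]|/(_ g)]; last first.
  by rewrite gM gf qf eqxx.
congr Some; apply: (@rvec_inj c); try exact: (rootsM_rootlike K2 r_le).
by rewrite g'f gf qf.
Qed.

Lemma gen_root_M l : l \in gens -> exists2 g, g \in rootsM K c n r & gen_root l = Some g.
Proof.
rewrite mem_cat => /orP[] /mapP[x xP ->].
  by exists x; rewrite // (base_rootsM S_base) // -mem_enum.
by have [q [d [g [_ _ gM _ gE]]]] := Phi_root xP; exists g.
Qed.

Lemma gen_self l g (gM : g \in rootsM K c n r) : l \in gens -> gen_root l = Some g ->
  dirder (base_coord S) (coord_of gM) (gen_poly l) != 0.
Proof.
rewrite mem_cat => /orP[] /mapP[x xP ->].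
  case=> e; move: gM; rewrite -e => gM; apply: Mminor_dirder_self => //.
  by rewrite -mem_enum.
have [q [d [g' [ad fL _ g'E xg]]]] := Phi_root xP.
rewrite xg => -[e]; rewrite e in g'E; rewrite /gen_poly fL.
exact: (Lpair_dirder_self K2 r_le S_base ad gM g'E).
Qed.

Lemma gen_triangular l l' g (gM : g \in rootsM K c n r) :
  l \in gens -> l' \in gens -> gen_root l' = Some g ->
  dirder (base_coord S) (coord_of gM) (gen_poly l) != 0 ->
  l' = l \/ (gen_key l' < gen_key l)%N.
Proof.
rewrite !mem_cat => /orP[] /mapP[x xP ->] /orP[] /mapP[y yP ->].
- case=> e; rewrite -e in gM *; rewrite mem_enum in xP.
  by case/(Mminor_dirder K2 r_le S_base xP) => _ [->|]; [left|right].
- rewrite mem_enum in xP; have [q [d [g' [ad _ _ g'E yg]]]] := Phi_root yP.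
  rewrite yg => -[e].
  case/(Mminor_dirder K2 r_le S_base xP) => gS _; exfalso.
  have gT := Epos_rookset c gS; rewrite -e g'E in gT.
  have e' := rookset_col K2 r_le S_base gT (adm_right ad); have := adm_lt ad.
  by rewrite e' ltnn.
- case=> e; rewrite -e in gM *; rewrite mem_enum in yP.
  have [q [d [g' [ad fL _ g'E _]]]] := Phi_root xP; rewrite /gen_poly fL.
  by case/(Lpair_dirder_key K2 r_le S_base ad g'E); rewrite yP.
move=> yg; have [q [d [g' [ad fL g'M g'E xg]]]] := Phi_root xP.
rewrite /gen_poly fL; case/(Lpair_dirder_key K2 r_le S_base ad g'E) => _ [gE|lt];
  [left|right]; last first.
  by rewrite /gen_key yg xg.
have gg' : g = g'.
  apply: (@Epos_inj c); try exact: (rootsM_rootlike K2 r_le).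
  by rewrite gE g'E.
congr inr; move: yg xg => /=; case: pickP => // h /andP[_ /eqP <-] [->].
by case: pickP => // h' /andP[_ /eqP <-] [->]; rewrite gg'.
Qed.

Lemma system_independent : alg_independent (system K c r S).
Proof.
have szE : size (system K c r S) = size gens by rewrite system_gens size_map.
pose l0 : gen := inr 0.
pose l (i : 'I_(size (system K c r S))) := nth l0 gens i.
have lG i : l i \in gens by rewrite mem_nth // -szE.
have rootP i : exists g, (g \in rootsM K c n r) && (gen_root (l i) == Some g).
  by have [g gM gE] := gen_root_M (lG i); exists g; rewrite gM gE eqxx.
pose rt i := xchoose (rootP i).
have rtM i : rt i \in rootsM K c n r by have /andP[] := xchooseP (rootP i).
have rtE i : gen_root (l i) = Some (rt i) by have /andP[_ /eqP] := xchooseP (rootP i).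
have nE k : (k < size gens)%N -> nth 0 (system K c r S) k = gen_poly (nth l0 gens k).
  by move=> kl; rewrite system_gens (nth_map l0).
have tE i : tnth (in_tuple (system K c r S)) i = gen_poly (l i).
  by rewrite (tnth_nth 0) nE // -szE.
apply: (jacobian_alg_independent charK0 (x0 := base_coord S)
          (w := fun i => coord_of (rtM i))).
rewrite -det_tr (det_keyed (key := fun i => gen_key (l i))).
  by apply/prodf_neq0 => i _; rewrite !mxE tE; apply: gen_self.
move=> i j; rewrite !mxE tE => /(gen_triangular (lG j) (lG i) (rtE i)) [e|];
  [left|by right].
apply/val_inj/eqP; move/eqP: e; rewrite /l nth_uniq ?gens_uniq // -?szE //.
Qed.

End Independence.

Theorem theorem15 (K : closedFieldType) (charK0 : [pchar K] =i pred0)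
  (c : classical) (n : nat) (n_gt0 : (0 < n)%N)
  (r : seq nat) (r_gt0 : all (fun t => (0 < t)%N) r) (r_le : (sumn r <= n)%N)
  (S : {set rsym n}) (S_base : is_base K c r S) :
  (forall f, f \in system K c r S -> N_invariant f)
  /\ alg_independent (system K c r S).
Proof.
split; last exact: system_independent.
exact: (system_invariant (two_neq0 charK0) r_le S_base).
Qed.
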